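(* Let $P$ be a simple $\mathfrak{S}$-module. Suppose that there exists $k\in\mathbb{Z}_+$ such that the action of $I_k$ on $P$ is injective. Then the following conditions are equivalent: (1) There exists $z\in\mathbb{Z}_+$ such that the actions of $L_i,G_i,I_i$, $i\ge z$, on $P$ are locally finite. (2) There exists $z\in\mathbb{Z}_+$ such that the actions of $L_i,G_i,I_i$, $i\ge z$, on $P$ are locally nilpotent. (3) There exist $r,s,t\in\mathbb{Z}_+$ such that $P$ is a locally finite $\mathfrak{S}^{(r,s,t)}$-module. (4) There exist $r,s,t\in\mathbb{Z}_+$ such that $P$ is a locally nilpotent $\mathfrak{S}^{(r,s,t)}$-module. (5) There exist $\alpha,\beta\in\mathbb{Z}_+$ with $\alpha\ge2\beta$ and a simple $\mathfrak{S}_{\alpha,\beta}$-module $V$ such that, for some $z\in\mathbb{Z}_+$, the action of $I_z$ on $V$ is injective and $L_iV=G_jV=I_lV=0$ for all $i>z+\alpha$, $j>z+\beta$, $l>z$, and such that $P\cong\mathrm{Ind}(V)=U(\mathfrak{S})\otimes_{U(\mathfrak{S}_{\alpha,\beta})}V$.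
   Context: $\mathbb{Z}_+$ denotes the nonnegative integers; everything is over $\mathbb{C}$. The super Heisenberg-Virasoro algebra of Ramond type is the Lie superalgebra $\mathfrak{S}=\bigoplus_{m\in\mathbb{Z}}\mathbb{C}L_m\oplus\bigoplus_{m\in\mathbb{Z}}\mathbb{C}G_m\oplus\bigoplus_{m\in\mathbb{Z}}\mathbb{C}I_m$ with even part $\mathrm{span}\{L_m,I_m\mid m\in\mathbb{Z}\}$, odd part $\mathrm{span}\{G_m\mid m\in\mathbb{Z}\}$ and super-brackets, for $m,n\in\mathbb{Z}$, $$[L_m,L_n]=(n-m)L_{m+n},\quad [L_m,G_n]=nG_{m+n},\quad [L_m,I_n]=nI_{m+n},\quad [G_m,G_n]=2I_{m+n},\quad [I_m,I_n]=[I_m,G_n]=0.$$ For $\alpha,\beta,r,s,t\in\mathbb{Z}_+$ with $\alpha\ge2\beta$, set $$\mathfrak{S}_{\alpha,\beta}=\bigoplus_{i\ge0}\mathbb{C}L_i\oplus\bigoplus_{i\ge0}\mathbb{C}I_{i-\alpha}\oplus\bigoplus_{i\ge0}\mathbb{C}G_{i-\beta},\qquad \mathfrak{S}^{(r,s,t)}=\bigoplus_{i\ge r}\mathbb{C}L_i\oplus\bigoplus_{i\ge s}\mathbb{C}I_i\oplus\bigoplus_{i\ge t}\mathbb{C}G_i.$$ Let $\mathcal{G}$ be a Lie superalgebra, $V$ a $\mathcal{G}$-module and $x\in\mathcal{G}$. The action of $x$ on $V$ is locally nilpotent if for every $v\in V$ there is $n\in\mathbb{Z}_+$ with $x^nv=0$,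 and locally finite if for every $v\in V$, $\dim\big(\sum_{n\in\mathbb{Z}_+}\mathbb{C}x^nv\big)<+\infty$. The action of $\mathcal{G}$ on $V$ is locally nilpotent if for every $v\in V$ there is $n\in\mathbb{Z}_+$ with $\mathcal{G}^nv=0$, and locally finite if for every $v\in V$, $\dim\big(\sum_{n\in\mathbb{Z}_+}\mathcal{G}^nv\big)<+\infty$; here $\mathcal{G}^nv$ is the span of all $x_1x_2\cdots x_nv$ with $x_i\in\mathcal{G}$. $U(\cdot)$ denotes the universal enveloping (super)algebra. All modules are $\mathbb{Z}_2$-graded. Standing conventions: simple (irreducible) modules are non-trivial, and on simple modules over $\mathfrak{S}$ or over a subalgebra containing the central element $I_0$, $I_0$ is assumed to act as a scalar $c_0$. *)

(* Defs.v *)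
(* Mathematical Components with the classical axioms of mathcomp.classical, which
   make membership in an arbitrary subspace decidable, as quotients require. *)
From HB Require Import structures.
From mathcomp Require Import all_boot all_order all_algebra.
From mathcomp Require Import boolp classical_sets reals finmap complex monalg.
From mathcomp Require Import ring zify.

Set Implicit Arguments.
Unset Strict Implicit.
Unset Printing Implicit Defensive.

Import Order.TTheory GRing.Theory Num.Theory.

Local Open Scope classical_set_scope.
Local Open Scope ring_scope.
Local Open Scope quotient_scope.


Section Span.
Context {K : fieldType}.

Definition subspace (V : lmodType K) (W : set V) : Prop :=
  W 0 /\ forall (a : K) (u v : V), W u -> W v -> W (a *: u + v).

Definition lspan (V : lmodType K) (A : set V) : {pred V} :=
  fun v => `[< forall W : set V, subspace W -> A `<=` W -> W v >].

Definition finite_dim (V : lmodType K) (W : {pred V}) : Prop :=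
  exists s : seq V, W =i lspan [set x | x \in s].

Lemma lspanP (V : lmodType K) (A : set V) (v : V) :
  reflect (forall W : set V, subspace W -> A `<=` W -> W v) (v \in lspan A).
Proof. by rewrite unfold_in; exact: asboolP. Qed.

Lemma lspan_mem (V : lmodType K) (A : set V) (v : V) : A v -> v \in lspan A.
Proof. by move=> Av; apply/lspanP => W _; exact. Qed.

Lemma lspan_ind (V : lmodType K) (A : set V) (W : set V) :
  subspace W -> A `<=` W -> forall v, v \in lspan A -> W v.
Proof. by move=> sW AW v /lspanP; exact. Qed.

Lemma lspan_submod (V : lmodType K) (A : set V) : submod_closed (lspan A).
Proof.
split=> [|a u v /lspanP hu /lspanP hv]; first by apply/lspanP => W [].
by apply/lspanP => W sW AW; apply: (sW.2); [exact: hu|exact: hv].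
Qed.

HB.instance Definition _ (V : lmodType K) (A : set V) :=
  GRing.isSubmodClosed.Build K V (lspan A) (lspan_submod A).

Lemma subspace_lspan (V : lmodType K) (A : set V) :
  subspace [set v | v \in lspan A].
Proof. by split=> [|a u v hu hv] /=; rewrite ?rpred0 // rpredD ?rpredZ. Qed.

Section LinearFun.
Context (V V' : lmodType K) (f : V -> V').
Hypothesis lf : linear f.

Lemma lin0 : f 0 = 0.
Proof. by have := lf (-1) 0 0; rewrite !scaleN1r !addNr. Qed.
Lemma linZ a u : f (a *: u) = a *: f u.
Proof. by have := lf a u 0; rewrite lin0 !addr0. Qed.
Lemma linD u v : f (u + v) = f u + f v.
Proof. by have := lf 1 u v; rewrite !scale1r. Qed.
Lemma linN u : f (- u) = - f u.
Proof. by rewrite -scaleN1r linZ scaleN1r. Qed.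
Lemma linB u v : f (u - v) = f u - f v.
Proof. by rewrite linD linN. Qed.
Lemma linBD a u v w : f (u - (a *: v + w)) = f u - (a *: f v + f w).
Proof. by rewrite linB lf. Qed.

End LinearFun.

Lemma subspace_ker (V V' : lmodType K) (f : V -> V') :
  linear f -> subspace [set v | f v = 0].
Proof.
move=> lf; split=> [|a u v /= hu hv] /=.
  exact: lin0.
by rewrite lf hu hv scaler0 addr0.
Qed.

End Span.

(* V / span(A) *)
Section QuotientModule.
Context {K : fieldType} (V : lmodType K) (A : set V).

Definition qmod : Type := {ideal_quot (lspan A)}.
HB.instance Definition _ := GRing.Zmodule.on qmod.

Definition qpi (v : V) : qmod := \pi_({ideal_quot (lspan A)}) v.
Definition qrepr (q : qmod) : V := repr (q : {ideal_quot (lspan A)}).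

Lemma qreprK (q : qmod) : qpi (qrepr q) = q.
Proof. exact: reprK. Qed.

Lemma qpi_eq (u v : V) : (qpi u == qpi v) = (u - v \in lspan A).
Proof. by rewrite Quotient.idealrBE. Qed.

Lemma qpi_eq0 (u : V) : (u \in lspan A) -> qpi u = qpi 0.
Proof. by move=> h; apply/eqP; rewrite qpi_eq subr0. Qed.

Lemma qpi_zmod_morphism : zmod_morphism qpi.
Proof. by move=> x y; rewrite /qpi raddfB. Qed.

HB.instance Definition _ :=
  GRing.isZmodMorphism.Build V qmod qpi qpi_zmod_morphism.

Lemma qreprB (v : V) : qrepr (qpi v) - v \in lspan A.
Proof. by rewrite -qpi_eq qreprK. Qed.

Definition qscale : K -> qmod -> qmod :=
  locked (fun a q => qpi (a *: qrepr q)).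

Lemma qscaleE a v : qscale a (qpi v) = qpi (a *: v).
Proof. by apply/eqP; rewrite /qscale -lock qpi_eq -scalerBr rpredZ ?qreprB. Qed.

Lemma qscaleA a b q : qscale a (qscale b q) = qscale (a * b) q.
Proof. by rewrite -(qreprK q) !qscaleE scalerA. Qed.
Lemma qscale1 : left_id 1 qscale.
Proof. by move=> q; rewrite -(qreprK q) qscaleE scale1r. Qed.
Lemma qscaleDr : right_distributive qscale +%R.
Proof.
move=> a q r; rewrite -(qreprK q) -(qreprK r) -raddfD !qscaleE.
by rewrite scalerDr raddfD.
Qed.
Lemma qscaleDl q : {morph qscale^~ q : a b / a + b}.
Proof. by move=> a b; rewrite -(qreprK q) !qscaleE scalerDl raddfD. Qed.

HB.instance Definition _ := GRing.Zmodule_isLmodule.Build K qmod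
  qscaleA qscale1 qscaleDr qscaleDl.

Lemma qpi_scalable : scalable qpi.
Proof. by move=> a v; rewrite -qscaleE. Qed.

HB.instance Definition _ := GRing.isScalable.Build K V qmod *:%R qpi qpi_scalable.

Lemma qpi0 v : v \in lspan A -> qpi v = 0.
Proof. by move/qpi_eq0; rewrite raddf0. Qed.

Section Descent.
Context (V' : lmodType K) (f : V -> V').
Hypotheses (lf : linear f) (fA : forall v, A v -> f v = 0).

Lemma descentE v : f (qrepr (qpi v)) = f v.
Proof.
have /(lspan_ind (subspace_ker lf) fA) /= : qrepr (qpi v) - v \in lspan A.
  exact: qreprB.
by rewrite -[qrepr _ - v]addrC -scaleN1r lf scaleN1r addrC => /subr0_eq.
Qed.

Lemma descent_linear : linear (f \o qrepr).
Proof.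
move=> a q r /=; rewrite -{1}(qreprK q) -{1}(qreprK r) -linearP descentE.
by rewrite lf.
Qed.
End Descent.

End QuotientModule.

(* Linear extension from the basis of a free module. This and a few more
   definitions are locked because failing conversions would otherwise unfold
   finite maps. *)
HB.lock Definition flift (K : fieldType) (X : choiceType) (V : lmodType K)
  (f : X -> V) (t : {malg K[X]}) : V := \sum_(x <- msupp t) t@_x *: f x.

Section FreeModule.
Context {K : fieldType} (X : choiceType).

Lemma fliftE (V : lmodType K) (f : X -> V) t :
  flift f t = \sum_(x <- msupp t) t@_x *: f x.
Proof. by rewrite flift.unlock. Qed.

Lemma fliftEw (V : lmodType K) (f : X -> V) (d : {fset X}) t :
  (msupp t `<=` d)%fset -> flift f t = \sum_(x <- d) t@_x *: f x.
Proof.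
move=> le; rewrite fliftE (big_fset_incl _ le) => //= x xd /mcoeff_outdom ->.
by rewrite scale0r.
Qed.

Lemma flift_linear (V : lmodType K) (f : X -> V) : linear (flift f).
Proof.
move=> a s t; pose d := (msupp (a *: s + t) `|` (msupp s `|` msupp t))%fset.
rewrite !(@fliftEw _ _ d).
- rewrite scaler_sumr -big_split /=; apply: eq_bigr => x _.
  by rewrite mcoeffD mcoeffZ scalerDl scalerA.
- by apply/fsubsetP => x xt; rewrite !inE xt !orbT.
- by apply/fsubsetP => x xt; rewrite !inE xt !orbT.
- by apply/fsubsetP => x xt; rewrite !inE xt.
Qed.

HB.instance Definition _ (V : lmodType K) (f : X -> V) :=
  GRing.isLinear.Build K {malg K[X]} V *:%R (flift f) (flift_linear f).

Lemma fliftU (V : lmodType K) (f : X -> V) x : flift f << x >> = f x.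
Proof. by rewrite (fliftEw _ msuppU_le) big_seq_fset1 mcoeffUU scale1r. Qed.

Lemma malg_ind (W : {malg K[X]} -> Prop) (D : pred X) :
    W 0 -> (forall a u v, W u -> W v -> W (a *: u + v)) ->
    (forall x, D x -> W << x >>) ->
  forall t, (forall x, x \in msupp t -> D x) -> W t.
Proof.
move=> W0 WD WX t Dt; rewrite (monalgE t) big_seq.
elim/big_ind: _ => // [u v hu hv|x /Dt /WX hx].
  by rewrite -[u]scale1r; apply: WD.
have -> : << t@_x *g x >> = t@_x *: << x >> + 0 :> {malg K[X]}.
  by apply/malgP => y; rewrite addr0 mcoeffZ !mcoeffU mulr_natr.
exact: WD.
Qed.

Lemma eq_linear_malg (V : lmodType K) (f g : {malg K[X]} -> V) :
  linear f -> linear g -> (forall x, f << x >> = g << x >>) -> f =1 g.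
Proof.
move=> lf lg fg t; apply: (@malg_ind (fun t => f t = g t) xpredT) => //.
- by rewrite !lin0.
- by move=> a u v hu hv; rewrite lf lg hu hv.
Qed.

End FreeModule.


(* Parities are booleans: [false] is even, [true] is odd, and [addb] is the
   addition of Z/2. *)
Record superspace (K : fieldType) := Superspace {
  ss_car :> lmodType K;
  ss_hom : bool -> set ss_car;
  ss_hom_subspace : forall i, subspace (ss_hom i);
  ss_hom_sum : forall v : ss_car, exists v0 v1 : ss_car,
    [/\ ss_hom false v0, ss_hom true v1 & v = v0 + v1];
  ss_hom_cap : forall v : ss_car, ss_hom false v -> ss_hom true v -> v = 0 }.

Arguments ss_hom {K s} i.

(* The Koszul sign (-1)^(ij). *)
Definition koszul (K : fieldType) (i j : bool) : K := (-1) ^+ (i && j).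

Record lie_superalgebra (K : fieldType) := LieSuperalgebra {
  lsa_space :> superspace K;
  lsa_br : lsa_space -> lsa_space -> lsa_space;
  lsa_br_linearl : forall y, linear (lsa_br^~ y);
  lsa_br_linearr : forall x, linear (lsa_br x);
  lsa_br_hom : forall i j x y, ss_hom i x -> ss_hom j y ->
    ss_hom (i (+) j) (lsa_br x y);
  lsa_br_skew : forall i j x y, ss_hom i x -> ss_hom j y ->
    lsa_br x y = - (koszul K i j *: lsa_br y x);
  lsa_br_jacobi : forall i j x y z, ss_hom i x -> ss_hom j y ->
    lsa_br x (lsa_br y z) =
      lsa_br (lsa_br x y) z + koszul K i j *: lsa_br y (lsa_br x z) }.

Record smodule (K : fieldType) (g : lie_superalgebra K) := Smodule {
  smod_space :> superspace K;
  act : g -> smod_space -> smod_space;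
  act_linearl : forall v, linear (act^~ v);
  act_linearr : forall x, linear (act x);
  act_hom : forall i j x v, ss_hom i x -> ss_hom j v ->
    ss_hom (i (+) j) (act x v);
  act_br : forall i j x y v, ss_hom i x -> ss_hom j y ->
    act (lsa_br x y) v = act x (act y v) - koszul K i j *: act y (act x v) }.

Arguments act {K g} s x v.

Section ModuleNotions.
Context {K : fieldType} {g : lie_superalgebra K}.

Definition graded_subspace (V : superspace K) (W : set V) : Prop :=
  subspace W /\ forall w, W w -> exists w0 w1,
    [/\ W w0, W w1, ss_hom false w0, ss_hom true w1 & w = w0 + w1].

Definition submodule (M : smodule g) (W : set M) : Prop :=
  graded_subspace W /\ forall x w, W w -> W (act M x w).

(* Simple modules are required to be non-trivial: g does not act by zero. *)
Definition simple_module (M : smodule g) : Prop :=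
  (exists x v, act M x v <> 0) /\
  (forall W : set M, submodule W -> W = [set 0] \/ W = setT).

(* Isomorphisms are even, i.e. preserve parity. *)
Definition isomorphic (M N : smodule g) : Prop :=
  exists f : M -> N, [/\ linear f, bijective f,
    forall i v, ss_hom i v -> ss_hom i (f v) &
    forall x v, f (act M x v) = act N x (f v)].

Definition locally_nilpotent_elt (M : smodule g) (x : g) : Prop :=
  forall v, exists n, iter n (act M x) v = 0.

Definition locally_finite_elt (M : smodule g) (x : g) : Prop :=
  forall v, finite_dim (lspan [set iter n (act M x) v | n in [set: nat]]).

(* A^n v: the span of all x_1 ... x_n v with x_i in A *)
Definition pow_act (M : smodule g) (A : set g) (n : nat) (v : M) : {pred M} :=
  lspan [set w | exists s : seq g,
    [/\ size s = n, forall x, x \in s -> A x & w = foldr (act M) v s]].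

Definition locally_nilpotent (M : smodule g) (A : set g) : Prop :=
  forall v : M, exists n, forall w, w \in pow_act A n v -> w = 0.

Definition locally_finite (M : smodule g) (A : set g) : Prop :=
  forall v : M, finite_dim (lspan [set w | exists n, w \in pow_act A n v]).

End ModuleNotions.


Section Parity.
Context {K : numFieldType} (V : superspace K).

Lemma parity_ex (v : V) : exists w : V, exists v0 v1,
  [/\ ss_hom false v0, ss_hom true v1, v = v0 + v1 & w = v0 - v1].
Proof.
by have [v0 [v1 [h0 h1 ->]]] := ss_hom_sum v; exists (v0 - v1), v0, v1.
Qed.

Definition parity (v : V) : V := projT1 (cid (parity_ex v)).

Lemma ss_homP i a (u v : V) : ss_hom i u -> ss_hom i v -> ss_hom i (a *: u + v).
Proof. exact: (@ss_hom_subspace K V i).2. Qed.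

Lemma ss_homB i (u v : V) : ss_hom i u -> ss_hom i v -> ss_hom i (u - v).
Proof. by move=> hu hv; rewrite addrC -scaleN1r; apply: ss_homP. Qed.

Lemma parityE (v0 v1 : V) :
  ss_hom false v0 -> ss_hom true v1 -> parity (v0 + v1) = v0 - v1.
Proof.
move=> h0 h1; rewrite /parity; case: cid => w /= [u0 [u1 [k0 k1 e ->]]].
have e0 : v0 - u0 = u1 - v1.
  by apply/eqP; rewrite subr_eq addrAC eq_sym subr_eq addrC -e addrC.
have z : v0 - u0 = 0 by apply: ss_hom_cap; [|rewrite e0]; exact: ss_homB.
have {e0} /subr0_eq -> : u1 - v1 = 0 by rewrite -e0.
by rewrite (subr0_eq z).
Qed.

Lemma parity_linear : linear parity.
Proof.
move=> a u v; have [u0 [u1 [h0 h1 ->]]] := ss_hom_sum u.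
have [v0 [v1 [k0 k1 ->]]] := ss_hom_sum v.
rewrite scalerDr addrACA !parityE //; try exact: ss_homP.
by rewrite scalerBr opprD addrACA.
Qed.

Lemma parity_hom i (v : V) : ss_hom i v -> parity v = (-1) ^+ i *: v.
Proof.
case: i => h /=.
  rewrite -{1}[v]add0r parityE ?add0r ?expr1 ?scaleN1r //.
  exact: (@ss_hom_subspace K V _).1.
rewrite -{1}[v]addr0 parityE ?subr0 ?expr0 ?scale1r //.
exact: (@ss_hom_subspace K V _).1.
Qed.

Lemma signed_cap (V' : lmodType K) (s : V' -> V') (v : V') :
  s v = (-1) ^+ false *: v -> s v = (-1) ^+ true *: v -> v = 0.
Proof.
move=> ->; rewrite expr0 expr1 scale1r scaleN1r => /eqP.
rewrite -addr_eq0 -mulr2n -scaler_nat scaler_eq0 pnatr_eq0 /=.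
by move/eqP.
Qed.

End Parity.


(* The free algebra on the underlying set of V; dividing by the relations
   [ax + y] = a[x] + [y] gives the tensor algebra of V. *)
Definition falg (K : fieldType) (V : lmodType K) : Type :=
  {malg K[{fmonom V}]}.

HB.lock Definition fword (K : fieldType) (V : lmodType K) (w : {fmonom V}) :
  falg V := (<< w >> : {malg K[{fmonom V}]}).

Section FreeAlgebra.
Context {K : fieldType} (V : lmodType K).
Local Notation falg := (falg V).
Local Notation fword := (@fword K V).

HB.instance Definition _ := GRing.Lalgebra.on falg.

Lemma falg_scalerAr (a : K) (s t : falg) : a *: (s * t) = s * (a *: t).
Proof.
have mulC (r : {malg K[{fmonom V}]}) : r * a%:MP = a *: r.
  apply/malgP => k; rewrite malgM_def fgmulgU mcoeffZ.
  rewrite [in RHS](monalgE r) !raddf_sum mulr_sumr /=; apply: eq_bigr => l _.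
  by rewrite !mcoeffU mulm1 mulrnAr mulrC.
have := mulC ((s : {malg K[{fmonom V}]}) * (t : {malg K[{fmonom V}]})).
by rewrite -mulrA mulC => ->.
Qed.

HB.instance Definition _ := GRing.Lalgebra_isAlgebra.Build K falg falg_scalerAr.

Definition fgen (x : V) : falg := fword (fmu x).

Definition falg_lift (A : algType K) (f : V -> A) (t : falg) : A :=
  flift (fun w : {fmonom V} => \prod_(x <- w) f x) t.

Definition falg_act (M : lmodType K) (f : V -> M -> M) (t : falg) (m : M) : M :=
  flift (fun w : {fmonom V} => foldr f m w) t.

Lemma falg_lift_linear (A : algType K) (f : V -> A) : linear (falg_lift f).
Proof. exact: flift_linear. Qed.

Lemma falg_act_linearl (M : lmodType K) (f : V -> M -> M) m :
  linear ((falg_act f)^~ m).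
Proof. by move=> a s t; rewrite /falg_act linearP. Qed.

Lemma falg_act_linearr (M : lmodType K) (f : V -> M -> M) t :
  (forall x, linear (f x)) -> linear (falg_act f t).
Proof.
move=> lf a m n; rewrite /falg_act !fliftE scaler_sumr -big_split /=.
apply: eq_bigr => w _; rewrite scalerA mulrC -scalerA -scalerDr; congr (_ *: _).
by elim: (w : seq V) => //= x s ->; rewrite lf.
Qed.

Lemma falg_ind (W : falg -> Prop) :
    W 0 -> (forall a u v, W u -> W v -> W (a *: u + v)) ->
    (forall w, W (fword w)) ->
  forall t, W t.
Proof.
move=> W0 WD WX t.
apply: (@malg_ind _ {fmonom V} W xpredT) => // w _.
by have := WX w; rewrite fword.unlock.
Qed.

Lemma eq_linear_falg (V' : lmodType K) (f f' : falg -> V') :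
  linear f -> linear f' ->
  (forall w, f (fword w) = f' (fword w)) -> f =1 f'.
Proof.
rewrite fword.unlock; exact: (@eq_linear_malg _ {fmonom V}).
Qed.

Lemma falg_mull_linear t : linear (fun s : falg => s * t).
Proof. by move=> a u v; rewrite mulrDl -scalerAl. Qed.

Lemma falg_mulr_linear s : linear (fun t : falg => s * t).
Proof. by move=> a u v; rewrite mulrDr -scalerAr. Qed.

Lemma fwordM w w' : fword w * fword w' = fword (mmul w w').
Proof. by rewrite fword.unlock [LHS]fgmulUU mulr1. Qed.

Lemma fword1 : fword (fmone V) = 1.
Proof. by rewrite fword.unlock. Qed.

Lemma fliftW (M : lmodType K) (f : {fmonom V} -> M) w :
  flift f (fword w : {malg K[{fmonom V}]}) = f w.
Proof. by rewrite fword.unlock fliftU. Qed.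

Lemma falg_liftM (A : algType K) (f : V -> A) s t :
  falg_lift f (s * t) = falg_lift f s * falg_lift f t.
Proof.
apply: (eq_linear_falg (f := fun s => falg_lift f (s * t))
                       (f' := fun s => falg_lift f s * falg_lift f t)) => [a u v|a u v|w].
- by rewrite (falg_mull_linear t a u v) falg_lift_linear.
- by rewrite falg_lift_linear mulrDl -scalerAl.
apply: (eq_linear_falg (f := fun t => falg_lift f (_ * t))
                       (f' := fun t => falg_lift f _ * falg_lift f t)) => [a u v|a u v|w'].
- by rewrite (falg_mulr_linear _ a u v) falg_lift_linear.
- by rewrite falg_lift_linear mulrDr -scalerAr.
by rewrite fwordM /falg_lift !fliftW fmM big_cat.
Qed.

Lemma falg_lift_rel (A : algType K) (f : V -> A) (a : K) r s t s' t' :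
  falg_lift f (r - (s * t - a *: (s' * t'))) = falg_lift f r
    - (falg_lift f s * falg_lift f t - a *: (falg_lift f s' * falg_lift f t')).
Proof.
have Ll := falg_lift_linear f.
rewrite -(falg_liftM f s t) -(falg_liftM f s' t') -(linZ Ll a (s' * t')).
by rewrite -(linB Ll (s * t) (a *: (s' * t'))) -(linB Ll r).
Qed.

Lemma falg_lift1 (A : algType K) (f : V -> A) : falg_lift f 1 = 1.
Proof. by rewrite -fword1 /falg_lift fliftW fmoneE big_nil. Qed.

Lemma falg_lift_gen (A : algType K) (f : V -> A) x : falg_lift f (fgen x) = f x.
Proof. by rewrite /falg_lift fliftW fmU big_seq1. Qed.

Lemma falg_actM (M : lmodType K) (f : V -> M -> M) s t m :
    (forall x, linear (f x)) ->
  falg_act f (s * t) m = falg_act f s (falg_act f t m).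
Proof.
move=> lf.
apply: (eq_linear_falg (f := fun s => falg_act f (s * t) m)
          (f' := fun s => falg_act f s (falg_act f t m))) => [a u v|a u v|w].
- by rewrite (falg_mull_linear t a u v) (falg_act_linearl f m).
- exact: (falg_act_linearl f _ a u v).
apply: (eq_linear_falg (f := fun t => falg_act f (_ * t) m)
          (f' := fun t => falg_act f _ (falg_act f t m))) => [a u v|a u v|w'].
- by rewrite (falg_mulr_linear _ a u v) (falg_act_linearl f m).
- by rewrite (falg_act_linearl f m a u v) falg_act_linearr.
by rewrite fwordM /falg_act !fliftW fmM foldr_cat.
Qed.

Lemma falg_act_rel (M : lmodType K) (f : V -> M -> M) (a : K) r s t s' t' m :
    (forall x, linear (f x)) ->
  falg_act f (r - (s * t - a *: (s' * t'))) m = falg_act f r m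
    - (falg_act f s (falg_act f t m) - a *: falg_act f s' (falg_act f t' m)).
Proof.
move=> lf; have Ll := falg_act_linearl f m.
rewrite -(falg_actM s t m lf) -(falg_actM s' t' m lf) -(linZ Ll a (s' * t')).
by rewrite -(linB Ll (s * t) (a *: (s' * t'))) -(linB Ll r).
Qed.

Lemma falg_act1 (M : lmodType K) (f : V -> M -> M) m : falg_act f 1 m = m.
Proof. by rewrite -fword1 /falg_act fliftW fmoneE. Qed.

Lemma falg_act_gen (M : lmodType K) (f : V -> M -> M) x m :
  falg_act f (fgen x) m = f x m.
Proof. by rewrite /falg_act fliftW fmU. Qed.

End FreeAlgebra.

Section Enveloping.
Context {K : fieldType} (g : lie_superalgebra K).

Definition env_rel : set (falg g) := [set r |
  (exists (a : K) (x y : g), r = fgen (a *: x + y) - (a *: fgen x + fgen y)) \/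
  (exists (i j : bool) (x y : g), [/\ ss_hom i x, ss_hom j y &
     r = fgen (lsa_br x y)
         - (fgen x * fgen y - koszul K i j *: (fgen y * fgen x))])].

(* its span is the two-sided ideal generated by [env_rel] *)
Definition env_ideal : set (falg g) :=
  [set t | exists a r b, env_rel r /\ t = a * r * b].

Definition env : Type := qmod env_ideal.
HB.instance Definition _ := GRing.Lmodule.on env.

Definition env_pi (t : falg g) : env := qpi env_ideal t.
Definition env_repr (u : env) : falg g := qrepr u.

Lemma env_reprK u : env_pi (env_repr u) = u. Proof. exact: qreprK. Qed.

Lemma env_pi_linear : linear env_pi.
Proof. by move=> a s t; rewrite /env_pi linearP. Qed.

HB.instance Definition _ :=
  GRing.isLinear.Build K (falg g) env *:%R env_pi env_pi_linear.

Lemma env_idealMl s t : t \in lspan env_ideal -> s * t \in lspan env_ideal.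
Proof.
move: t; apply: (@lspan_ind _ _ _ [set t | s * t \in lspan env_ideal]).
  split=> [|a u v hu hv] /=; first by rewrite mulr0 rpred0.
  by rewrite (falg_mulr_linear s a u v); exact: (rpredD (rpredZ a hu) hv).
move=> _ [a [r [b [hr ->]]]] /=; apply: lspan_mem.
by exists (s * a), r, b; split; [exact: hr | rewrite !mulrA].
Qed.

Lemma env_idealMr s t : t \in lspan env_ideal -> t * s \in lspan env_ideal.
Proof.
move: t; apply: (@lspan_ind _ _ _ [set t | t * s \in lspan env_ideal]).
  split=> [|a u v hu hv] /=; first by rewrite mul0r rpred0.
  by rewrite (falg_mull_linear s a u v); exact: (rpredD (rpredZ a hu) hv).
move=> _ [a [r [b [hr ->]]]] /=; apply: lspan_mem.
by exists a, r, (b * s); split; [exact: hr | exact: esym (mulrA (a * r) b s)].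
Qed.

Definition env_one : env := env_pi 1.
Definition env_mul : env -> env -> env :=
  locked (fun u v => env_pi (env_repr u * env_repr v)).

Lemma env_mulE s t : env_mul (env_pi s) (env_pi t) = env_pi (s * t).
Proof.
apply/eqP; rewrite /env_mul -lock /env_pi qpi_eq.
set s' := env_repr _; set t' := env_repr _.
have -> : s' * t' - s * t = s' * (t' - t) + (s' - s) * t.
  by rewrite mulrBr mulrBl addrA subrK.
by apply: rpredD; [apply: env_idealMl | apply: env_idealMr]; exact: qreprB.
Qed.

Lemma env_mulA : associative env_mul.
Proof.
move=> u v w; rewrite -(env_reprK u) -(env_reprK v) -(env_reprK w).
by rewrite !env_mulE mulrA.
Qed.
Lemma env_mul1 : left_id env_one env_mul.
Proof. by move=> u; rewrite -(env_reprK u) env_mulE mul1r. Qed.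
Lemma env_mulr1 : right_id env_one env_mul.
Proof. by move=> u; rewrite -(env_reprK u) env_mulE mulr1. Qed.
Lemma env_mulDl : left_distributive env_mul +%R.
Proof.
move=> u v w; rewrite -(env_reprK u) -(env_reprK v) -(env_reprK w).
by rewrite -raddfD !env_mulE mulrDl raddfD.
Qed.
Lemma env_mulDr : right_distributive env_mul +%R.
Proof.
move=> u v w; rewrite -(env_reprK u) -(env_reprK v) -(env_reprK w).
by rewrite -raddfD !env_mulE mulrDr raddfD.
Qed.

(* The augmentation of the free algebra kills the relations. *)
Lemma env_one_neq0 : env_one != 0.
Proof.
apply/eqP => e; have : (1 : falg g) \in lspan env_ideal.
  by rewrite -[1]subr0 -qpi_eq -/(env_pi 0) raddf0; apply/eqP.
pose aug (t : falg g) : K^o := (t : {malg K[{fmonom g}]})@_mone.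
have augl : linear aug by move=> a s t; rewrite /aug mcoeffD mcoeffZ.
have augM s t : aug (s * t) = aug s * aug t by rewrite /aug [LHS]rmorphM.
have auggen x : aug (fgen x) = 0 by rewrite /aug /fgen fword.unlock mcoeffU fm1_eq1.
have augN t : aug (- t) = - aug t by rewrite /aug mcoeffN.
have augD s t : aug (s + t) = aug s + aug t by rewrite /aug mcoeffD.
have augZ a t : aug (a *: t) = a * aug t by rewrite /aug mcoeffZ.
suff sub : env_ideal `<=` [set t | aug t = 0].
  move/(lspan_ind (subspace_ker augl) sub) => /= /eqP.
  by rewrite /aug mcoeffUU oner_eq0.
move=> _ [a [r [b [hr ->]]]] /=; rewrite !augM.
suff -> : aug r = 0 by rewrite mulr0 mul0r.
case: hr => [[c [x [y ->]]]|[i [j [x [y [_ _ ->]]]]]].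
  by rewrite !(augD, augN, augZ, auggen) mulr0 addr0 subr0.
by rewrite !(augD, augN, augZ, augM, auggen) !mulr0 !subr0.
Qed.

HB.instance Definition _ := GRing.Zmodule_isNzRing.Build env
  env_mulA env_mul1 env_mulr1 env_mulDl env_mulDr env_one_neq0.

Lemma env_piM s t : env_pi (s * t) = env_pi s * env_pi t.
Proof. by rewrite -env_mulE. Qed.

Lemma env_scalerAl (a : K) (u v : env) : a *: (u * v) = (a *: u) * v.
Proof.
rewrite -(env_reprK u) -(env_reprK v).
by rewrite -env_piM -!linearZ -env_piM scalerAl.
Qed.
HB.instance Definition _ := GRing.Lmodule_isLalgebra.Build K env env_scalerAl.

Lemma env_scalerAr (a : K) (u v : env) : a *: (u * v) = u * (a *: v).
Proof.
rewrite -(env_reprK u) -(env_reprK v).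
by rewrite -env_piM -!linearZ -env_piM scalerAr.
Qed.
HB.instance Definition _ := GRing.Lalgebra_isAlgebra.Build K env env_scalerAr.

Definition env_in (x : g) : env := env_pi (fgen x).

(* the homogeneous component of parity [i] of U(g) *)
Definition env_hom (i : bool) : {pred env} :=
  lspan [set u | exists s : seq (bool * g),
    [/\ forall p, p \in s -> ss_hom p.1 p.2,
        i = \big[addb/false]_(p <- s) p.1 & u = \prod_(p <- s) env_in p.2]].

Lemma env_in_linear : linear env_in.
Proof.
move=> a x y; apply/eqP; rewrite /env_in -linearP /env_pi qpi_eq lspan_mem //.
exists 1; eexists; exists 1; split; last by rewrite mulr1 mul1r.
by left; exists a, x, y.
Qed.

Lemma env_in_br i j x y : ss_hom i x -> ss_hom j y ->
  env_in (lsa_br x y) =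
    env_in x * env_in y - koszul K i j *: (env_in y * env_in x).
Proof.
move=> hx hy; apply/eqP; rewrite /env_in -!env_piM -linearZ -linearB.
rewrite /env_pi qpi_eq lspan_mem //.
exists 1; eexists; exists 1; split; last by rewrite mulr1 mul1r.
by right; exists i, j, x, y.
Qed.

End Enveloping.

(* U(h) -> A induced by a Lie superalgebra morphism h -> A into an algebra *)
Definition env_lift (K : fieldType) (h : lie_superalgebra K) (A : algType K)
  (f : h -> A) (u : env h) : A := falg_lift f (env_repr u).

(* the U(h)-module structure of an h-module *)
Definition env_act (K : fieldType) (h : lie_superalgebra K) (M : smodule h)
  (u : env h) (m : M) : M := falg_act (act M) (env_repr u) m.

Section EnvLift.
Context {K : fieldType} (h : lie_superalgebra K).

Lemma env_liftE (A : algType K) (f : h -> A) :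
    linear f ->
    (forall i j x y, ss_hom i x -> ss_hom j y ->
       f (lsa_br x y) = f x * f y - koszul K i j *: (f y * f x)) ->
  forall t, env_lift f (env_pi t) = falg_lift f t.
Proof.
move=> lf fbr t; have Ll := falg_lift_linear f.
apply: descentE; first exact: Ll.
move=> _ [a [r [b [hr ->]]]]; rewrite !falg_liftM.
suff -> : falg_lift f r = 0 by rewrite mulr0 mul0r.
case: hr => [[c [x [y ->]]]|[i [j [x [y [hx hy ->]]]]]].
  by rewrite (linBD Ll) !falg_lift_gen lf subrr.
by rewrite falg_lift_rel !falg_lift_gen (fbr i j) // subrr.
Qed.

Lemma env_actE (M : smodule h) t m :
  env_act (env_pi t) m = falg_act (act M) t m.
Proof.
have lM x : linear (act M x) := @act_linearr _ _ M x.
have Ll n := falg_act_linearl (act M) n.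
apply: (@descentE _ _ _ _ (fun t => falg_act (act M) t m)); first exact: Ll.
move=> _ [a [r [b [hr ->]]]]; rewrite !falg_actM //.
suff -> : falg_act (act M) r (falg_act (act M) b m) = 0.
  exact: lin0 (falg_act_linearr a lM).
set n := falg_act _ b m.
case: hr => [[c [x [y ->]]]|[i [j [x [y [hx hy ->]]]]]].
  rewrite (linBD (Ll n)) !falg_act_gen.
  by rewrite (@act_linearl _ _ M n) subrr.
by rewrite falg_act_rel // !falg_act_gen (@act_br _ _ M i j) // subrr.
Qed.

Lemma env_lift_morphism (A : algType K) (f : h -> A) : linear f ->
    (forall i j x y, ss_hom i x -> ss_hom j y ->
       f (lsa_br x y) = f x * f y - koszul K i j *: (f y * f x)) ->
  [/\ linear (env_lift f), {morph env_lift f : u v / u * v},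
      env_lift f 1 = 1 & forall x, env_lift f (env_in x) = f x].
Proof.
move=> lf fbr; split.
- move=> a u v; rewrite -(env_reprK u) -(env_reprK v) -linearP !env_liftE //.
  exact: falg_lift_linear.
- move=> u v; rewrite -(env_reprK u) -(env_reprK v) -env_piM !env_liftE //.
  exact: falg_liftM.
- by rewrite -[1]/(env_pi 1) env_liftE // falg_lift1.
- by move=> x; rewrite env_liftE // falg_lift_gen.
Qed.

Lemma env_act_linearl (M : smodule h) (m : M) : linear ((@env_act _ h M)^~ m).
Proof.
move=> a u v; rewrite -(env_reprK u) -(env_reprK v) -linearP !env_actE.
exact: falg_act_linearl.
Qed.

Lemma env_act_linearr (M : smodule h) (u : env h) : linear (@env_act _ h M u).
Proof. by apply: falg_act_linearr => x; exact: act_linearr. Qed.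

Lemma env_actM (M : smodule h) u v (m : M) :
  env_act (u * v) m = env_act u (env_act v m).
Proof.
rewrite -(env_reprK u) -(env_reprK v) -env_piM !env_actE.
by apply: falg_actM => x; exact: act_linearr.
Qed.

Lemma env_act1 (M : smodule h) (m : M) : env_act 1 m = m.
Proof. by rewrite -[1]/(env_pi 1) env_actE falg_act1. Qed.

Lemma env_act_in (M : smodule h) x (m : M) : env_act (env_in x) m = act M x m.
Proof. by rewrite env_actE falg_act_gen. Qed.

Lemma env_pi_word (w : {fmonom h}) :
  env_pi (fword w) = \prod_(x <- w) env_in x.
Proof.
have e0 : env_pi (fword (fmone h)) = 1 by rewrite fword1.
case: w => s; rewrite /=; elim: s => [|x s IH].
  by rewrite big_nil -fmoneE.
rewrite big_cons -IH -env_piM fwordM; congr (env_pi (fword _)).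
by rewrite /mmul /= fmmulE fmU.
Qed.

Lemma env_ind (W : set (env h)) :
    subspace W -> W 1 -> (forall x u, W u -> W (env_in x * u)) ->
  forall u, W u.
Proof.
move=> [W0 WD] W1 WM u; rewrite -(env_reprK u).
apply: (@falg_ind _ h (fun t => W (env_pi t))).
- by rewrite linear0.
- by move=> a s t hs ht; rewrite linearP; exact: WD.
move=> w; rewrite -/(fword w) env_pi_word.
by elim: (w : seq h) => [|x s IH]; rewrite ?big_nil ?big_cons //; exact: WM.
Qed.

End EnvLift.


Record subalgebra (K : fieldType) (g : lie_superalgebra K) := Subalgebra {
  sub_set :> set g;
  sub_graded : graded_subspace sub_set;
  sub_br_closed : forall x y, sub_set x -> sub_set y -> sub_set (lsa_br x y) }.

Section Subalgebra.
Context {K : fieldType} {g : lie_superalgebra K} (h : subalgebra g).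

Definition sub_pred : {pred g} := fun x => `[< sub_set h x >].

Lemma sub_predP x : reflect (sub_set h x) (x \in sub_pred).
Proof. by rewrite unfold_in; exact: asboolP. Qed.

Lemma sub_pred_submod : submod_closed sub_pred.
Proof.
have [[h0 hD] _] := sub_graded h.
split=> [|a x y /sub_predP hx /sub_predP hy]; apply/sub_predP => //.
exact: hD.
Qed.

HB.instance Definition _ := GRing.isSubmodClosed.Build K g sub_pred sub_pred_submod.

Record sub_car := SubElt { sub_val :> g; sub_valP : sub_val \in sub_pred }.

HB.instance Definition _ := [isSub for sub_val].
HB.instance Definition _ := [Choice of sub_car by <:].
HB.instance Definition _ := [SubChoice_isSubLmodule of sub_car by <:].

Definition sub_elt (x : g) (hx : sub_set h x) : sub_car := SubElt (introT (sub_predP x) hx).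

Lemma sub_mem (x : sub_car) : sub_set h (sub_val x).
Proof. exact/sub_predP/sub_valP. Qed.

Lemma sub_valD (x y : sub_car) : sub_val (x + y) = sub_val x + sub_val y.
Proof. exact: (raddfD (val : sub_car -> g)). Qed.

Lemma sub_valZ a (x : sub_car) : sub_val (a *: x) = a *: sub_val x.
Proof. exact: (GRing.valZ (a : K) x). Qed.

Lemma sub_val_linear : linear sub_val.
Proof. by move=> a x y; rewrite sub_valD sub_valZ. Qed.

Definition sub_hom (i : bool) : set sub_car := [set x | ss_hom i (sub_val x)].

Lemma sub_hom_subspace i : subspace (sub_hom i).
Proof.
have [H0 HD] := @ss_hom_subspace K g i; split=> [|a x y hx hy].
  by rewrite /sub_hom /mkset (lin0 sub_val_linear).
by rewrite /sub_hom /mkset sub_val_linear; exact: HD.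
Qed.

Lemma sub_hom_sum (x : sub_car) : exists x0 x1 : sub_car,
  [/\ sub_hom false x0, sub_hom true x1 & x = x0 + x1].
Proof.
have [_ /(_ _ (sub_mem x)) [x0 [x1 [h0 h1 k0 k1 e]]]] := sub_graded h.
exists (sub_elt h0), (sub_elt h1); split=> //.
by apply: val_inj; rewrite [RHS]sub_valD.
Qed.

Lemma sub_hom_cap (x : sub_car) : sub_hom false x -> sub_hom true x -> x = 0.
Proof.
move=> h0 h1; apply: val_inj; rewrite [val 0](lin0 sub_val_linear).
exact: ss_hom_cap.
Qed.

Definition sub_space : superspace K :=
  Superspace sub_hom_subspace sub_hom_sum sub_hom_cap.

Definition sub_br (x y : sub_space) : sub_space :=
  sub_elt (sub_br_closed (sub_mem x) (sub_mem y)).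

Lemma sub_br_linearl y : linear (sub_br^~ y).
Proof.
move=> a x x'; apply: val_inj; rewrite [RHS]sub_val_linear.
by rewrite [LHS]/(lsa_br _ _) sub_val_linear; exact: lsa_br_linearl.
Qed.

Lemma sub_br_linearr x : linear (sub_br x).
Proof.
move=> a y y'; apply: val_inj; rewrite [RHS]sub_val_linear.
by rewrite [LHS]/(lsa_br _ _) sub_val_linear; exact: lsa_br_linearr.
Qed.

Lemma sub_br_hom i j (x y : sub_space) : ss_hom i x -> ss_hom j y ->
  ss_hom (i (+) j) (sub_br x y).
Proof. exact: lsa_br_hom. Qed.

Lemma sub_br_skew i j (x y : sub_space) : ss_hom i x -> ss_hom j y ->
  sub_br x y = - (koszul K i j *: sub_br y x).
Proof.
move=> hx hy; apply: val_inj; rewrite [RHS](linN sub_val_linear) sub_valZ.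
exact: lsa_br_skew.
Qed.

Lemma sub_br_jacobi i j (x y z : sub_space) : ss_hom i x -> ss_hom j y ->
  sub_br x (sub_br y z) =
    sub_br (sub_br x y) z + koszul K i j *: sub_br y (sub_br x z).
Proof.
move=> hx hy; apply: val_inj; rewrite [RHS]sub_valD sub_valZ.
exact: lsa_br_jacobi.
Qed.

Definition sub_lsa : lie_superalgebra K :=
  LieSuperalgebra sub_br_linearl sub_br_linearr sub_br_hom sub_br_skew
    sub_br_jacobi.

End Subalgebra.


Definition ind_free (K : fieldType) (g : lie_superalgebra K) (V : lmodType K) :
  Type := {malg K[(env g * V)%type]}.

HB.instance Definition _ (K : fieldType) (g : lie_superalgebra K)
  (V : lmodType K) := GRing.Lmodule.on (ind_free g V).

HB.lock Definition pure (K : fieldType) (g : lie_superalgebra K)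
  (V : lmodType K) (u : env g) (v : V) : ind_free g V :=
  (<< (u, v) >> : {malg K[(env g * V)%type]}).

Section Induced.
Context {K : numFieldType} {g : lie_superalgebra K} (h : subalgebra g).
Context (V : smodule (sub_lsa h)).

(* U(h) -> U(g) *)
Definition env_incl : env (sub_lsa h) -> env g :=
  env_lift (fun x : sub_lsa h => env_in (sub_val x)).

(* U(g) tensored with V over U(h), as the quotient of the free vector space on
   U(g) x V by the bilinearity and balancing relations *)
Local Notation ind_free := (ind_free g V).

Definition ind_rel : set ind_free := [set r |
  [\/ exists a u u' v, r = pure (a *: u + u') v - (a *: pure u v + pure u' v),
      exists a u v v', r = pure u (a *: v + v') - (a *: pure u v + pure u v') |
      exists u b v, r = pure (u * env_incl b) v - pure u (env_act b v)]].

Definition ind_car : Type := qmod ind_rel.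
HB.instance Definition _ := GRing.Lmodule.on ind_car.

Definition tens (u : env g) (v : V) : ind_car := qpi ind_rel (pure u v).

Definition ind_mul (u : env g) (q : ind_car) : ind_car :=
  flift (fun p => tens (u * p.1) p.2) (qrepr q).

Definition ind_hom (i : bool) : set ind_car := [set q | q \in lspan [set r |
  exists j k (u : env g) (v : V), [/\ i = j (+) k, u \in env_hom j, ss_hom k v &
                      r = tens u v]]].

Lemma tens_linearl v : linear (tens^~ v).
Proof.
move=> a u u'; apply/eqP; rewrite /tens -linearP qpi_eq lspan_mem //.
by apply: Or31; exists a, u, u', v.
Qed.

Lemma tens_linearr u : linear (tens u).
Proof.
move=> a v v'; apply/eqP; rewrite /tens -linearP qpi_eq lspan_mem //.
by apply: Or32; exists a, u, v, v'.
Qed.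

Lemma tens_balanced u b v : tens (u * env_incl b) v = tens u (env_act b v).
Proof.
apply/eqP; rewrite /tens qpi_eq lspan_mem //.
by apply: Or33; exists u, b, v.
Qed.

Lemma ind_ind (W : set ind_car) :
  subspace W -> (forall u v, W (tens u v)) -> forall q, W q.
Proof.
move=> [W0 WD] WT q; rewrite -(qreprK q).
apply: (@malg_ind K (env g * V)%type (fun t => W (qpi ind_rel t)) xpredT) => //.
- by rewrite linear0.
- by move=> a s t hs ht; rewrite linearP; exact: WD.
- by case=> u v _; have := WT u v; rewrite /tens pure.unlock.
Qed.

Lemma ind_liftE (V' : lmodType K) (f : env g -> V -> V') :
    (forall v, linear (f^~ v)) -> (forall u, linear (f u)) ->
    (forall u b v, f (u * env_incl b) v = f u (env_act b v)) ->
  let F (q : ind_car) := flift (fun p => f p.1 p.2) (qrepr q) in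
  linear F /\ forall u v, F (tens u v) = f u v.
Proof.
move=> fl fr fb F; pose F0 : ind_free -> V' := flift (fun p => f p.1 p.2).
have lF0 : linear F0 by exact: flift_linear.
have F0E u v : F0 (pure u v) = f u v by rewrite /F0 pure.unlock fliftU.
have F0rel r : ind_rel r -> F0 r = 0.
  case=> [[a [u [u' [v ->]]]]|[a [u [v [v' ->]]]]|[u [b [v ->]]]].
  - by rewrite (linBD lF0) !F0E fl subrr.
  - by rewrite (linBD lF0) !F0E fr subrr.
  - by rewrite (linB lF0) !F0E fb subrr.
split; first exact: (descent_linear lF0 F0rel).
by move=> u v; rewrite -F0E; exact: (descentE lF0 F0rel).
Qed.

Lemma ind_mul_linear_tens u :
  linear (ind_mul u) /\ forall u' v, ind_mul u (tens u' v) = tens (u * u') v.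
Proof.
apply: (@ind_liftE _ (fun u' v => tens (u * u') v)).
- by move=> v a u1 u2; rewrite mulrDr -scalerAr tens_linearl.
- by move=> u' a v v'; rewrite tens_linearr.
- by move=> u' b v; rewrite mulrA tens_balanced.
Qed.

Lemma ind_mul_tens u u' v : ind_mul u (tens u' v) = tens (u * u') v.
Proof. exact: (ind_mul_linear_tens u).2. Qed.

Lemma ind_mul_linearr u : linear (ind_mul u).
Proof. exact: (ind_mul_linear_tens u).1. Qed.

Lemma ind_mul_linearl q : linear (ind_mul^~ q).
Proof.
move=> a u u'; apply: (@ind_ind [set q | ind_mul (a *: u + u') q =
  a *: ind_mul u q + ind_mul u' q]) => [|u1 v] /=.
  split=> [|b q1 q2 /= h1 h2] /=.
    by rewrite !(lin0 (ind_mul_linearr _)) scaler0 addr0.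
  rewrite !ind_mul_linearr h1 h2 !scalerDr !scalerA [b * a]mulrC.
  by rewrite addrACA.
by rewrite !ind_mul_tens mulrDl -scalerAl tens_linearl.
Qed.

Lemma ind_mulM u u' q : ind_mul (u * u') q = ind_mul u (ind_mul u' q).
Proof.
apply: (@ind_ind [set q | ind_mul (u * u') q = ind_mul u (ind_mul u' q)])
  => [|u1 v] /=; last by rewrite !ind_mul_tens mulrA.
split=> [|b q1 q2 /= h1 h2] /=; first by rewrite !(lin0 (ind_mul_linearr _)).
by rewrite !ind_mul_linearr h1 h2.
Qed.

Lemma env_hom_in i j (x : g) u :
  ss_hom i x -> u \in env_hom j -> env_in x * u \in env_hom (i (+) j).
Proof.
move=> hx; move: u.
apply: (@lspan_ind _ _ _ [set u | env_in x * u \in env_hom (i (+) j)]).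
  split=> [|a u v hu hv] /=; first by rewrite mulr0 rpred0.
  by rewrite mulrDr -scalerAr; exact: (rpredD (rpredZ a hu) hv).
move=> _ [s [hs -> ->]] /=; apply: lspan_mem; exists ((i, x) :: s).
rewrite !big_cons; split=> // p; rewrite inE => /orP[/eqP -> //|]; exact: hs.
Qed.

Lemma env_hom_sum (u : env g) : exists u0 u1,
  [/\ u0 \in env_hom false, u1 \in env_hom true & u = u0 + u1].
Proof.
move: u; apply: (@env_ind _ _ [set u | exists u0 u1,
  [/\ u0 \in env_hom false, u1 \in env_hom true & u = u0 + u1]]).
- split=> [|a _ _ [u0 [u1 [h0 h1 ->]]] [v0 [v1 [k0 k1 ->]]]] /=.
    by exists 0, 0; rewrite !rpred0 addr0.
  exists (a *: u0 + v0), (a *: u1 + v1); rewrite scalerDr addrACA.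
  by split=> //; [exact: (rpredD (rpredZ a h0))|exact: (rpredD (rpredZ a h1))].
- exists 1, 0; rewrite rpred0 addr0; split=> //; apply: lspan_mem.
  by exists [::]; rewrite !big_nil.
- move=> x _ [u0 [u1 [h0 h1 ->]]] /=.
  have [x0 [x1 [k0 k1 ->]]] := ss_hom_sum x.
  rewrite -[x0]scale1r (env_in_linear 1 x0 x1) scale1r.
  exists (env_in x0 * u0 + env_in x1 * u1), (env_in x1 * u0 + env_in x0 * u1).
  split.
  + exact: (rpredD (env_hom_in k0 h0) (env_hom_in k1 h1)).
  + exact: (rpredD (env_hom_in k1 h0) (env_hom_in k0 h1)).
  + rewrite mulrDl !mulrDr [X in _ + X = _]addrC addrACA.
    by congr (_ + _); exact: addrC.
Qed.

Lemma ind_hom_subspace i : subspace (ind_hom i).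
Proof. exact: subspace_lspan. Qed.

Lemma ind_hom_tens j k u v : u \in env_hom j -> ss_hom k v ->
  ind_hom (j (+) k) (tens u v).
Proof. by move=> hu hv; apply: lspan_mem; exists j, k, u, v. Qed.

Lemma ind_hom_sum (q : ind_car) : exists q0 q1,
  [/\ ind_hom false q0, ind_hom true q1 & q = q0 + q1].
Proof.
have D i a q1 q2 : ind_hom i q1 -> ind_hom i q2 -> ind_hom i (a *: q1 + q2).
  exact: (ind_hom_subspace i).2.
move: q; apply: (@ind_ind [set q | exists q0 q1,
  [/\ ind_hom false q0, ind_hom true q1 & q = q0 + q1]]).
  split=> [|a _ _ [u0 [u1 [h0 h1 ->]]] [v0 [v1 [k0 k1 ->]]]] /=.
    exists 0, 0; rewrite addr0.
    by split=> //; exact: (ind_hom_subspace _).1.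
  exists (a *: u0 + v0), (a *: u1 + v1); rewrite scalerDr addrACA.
  by split=> //; exact: D.
move=> u v; have [u0 [u1 [h0 h1 ->]]] := env_hom_sum u.
have [v0 [v1 [k0 k1 ->]]] := ss_hom_sum v.
exists (1 *: tens u0 v0 + tens u1 v1), (1 *: tens u1 v0 + tens u0 v1); split.
- by apply: D; [exact: (ind_hom_tens h0 k0)|exact: (ind_hom_tens h1 k1)].
- by apply: D; [exact: (ind_hom_tens h1 k0)|exact: (ind_hom_tens h0 k1)].
rewrite !scale1r (linD (tens_linearl _)) !(linD (tens_linearr _)).
rewrite [X in _ + X = _]addrC addrACA.
by congr (_ + _); exact: addrC.
Qed.

(* The parity involutions of U(g), U(h) and of the tensor product, used to show
   that the even and odd parts of the latter meet trivially. *)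
Definition env_parity (k : lie_superalgebra K) : env k -> env k :=
  env_lift (fun x : k => env_in (parity x)).

Lemma env_parity_morphism (k : lie_superalgebra K) :
  [/\ linear (@env_parity k), {morph @env_parity k : u v / u * v},
      env_parity (1 : env k) = 1 &
      forall x : k, env_parity (env_in x) = env_in (parity x)].
Proof.
have inL : linear (@env_in _ k) := @env_in_linear _ k.
apply: env_lift_morphism => [a x y|i j x y hx hy].
  by rewrite parity_linear inL.
rewrite (parity_hom (lsa_br_hom hx hy)) (parity_hom hx) (parity_hom hy).
rewrite !(linZ inL) (env_in_br hx hy).
have ZM a b (u v : env k) : (a *: u) * (b *: v) = (a * b) *: (u * v).
  by rewrite -scalerAl -scalerAr scalerA.
rewrite !ZM signr_addb scalerBr !scalerA; congr (_ - _ *: _).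
by rewrite mulrC; congr (_ * _); exact: mulrC.
Qed.

Lemma sub_val_parity (x : sub_lsa h) : sub_val (parity x) = parity (sub_val x : g).
Proof.
have [x0 [x1 [h0 h1 ->]]] := ss_hom_sum x.
rewrite (parityE h0 h1) (linB (@sub_val_linear _ _ h)).
by rewrite (linD (@sub_val_linear _ _ h)) parityE.
Qed.

Lemma env_incl_morphism :
  [/\ linear env_incl, {morph env_incl : u v / u * v},
      env_incl 1 = 1 & forall x, env_incl (env_in x) = env_in (sub_val x)].
Proof.
apply: env_lift_morphism => [a x y|i j x y hx hy].
  by rewrite sub_val_linear; exact: env_in_linear.
exact: env_in_br.
Qed.

Lemma env_parity_incl b : env_parity (env_incl b) = env_incl (env_parity b).
Proof.
have [lp pM p1 pin] := env_parity_morphism g.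
have [lp' pM' p1' pin'] := env_parity_morphism (sub_lsa h).
have [li iM i1 iin] := env_incl_morphism.
move: b; apply: (@env_ind _ _ [set b | env_parity (env_incl b) =
  env_incl (env_parity b)]) => /= [||x b /= hb].
- split=> [|a u v /= hu hv] /=.
    by rewrite (lin0 li) (lin0 lp) (lin0 lp') (lin0 li).
  by rewrite li lp lp' li hu hv.
- by rewrite i1 p1 p1' i1.
- by rewrite iM pM pM' iM hb pin' !iin pin sub_val_parity.
Qed.

Lemma parity_act (k : lie_superalgebra K) (M : smodule k) (x : k) (m : M) :
  parity (act M x m) = act M (parity x) (parity m).
Proof.
have lr y : linear (act M y) by exact: act_linearr.
have ll n : linear ((act M)^~ n) by exact: act_linearl.
have hlp i j (y : k) (n : M) : ss_hom i y -> ss_hom j n ->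
    parity (act M y n) = act M (parity y) (parity n).
  move=> hy hn; rewrite (parity_hom (act_hom hy hn)) (parity_hom hy).
  by rewrite (parity_hom hn) (linZ (ll _)) (linZ (lr _)) scalerA signr_addb.
have [x0 [x1 [h0 h1 ->]]] := ss_hom_sum x.
have [m0 [m1 [k0 k1 ->]]] := ss_hom_sum m.
rewrite (linD (ll _)) !(linD (lr _)) !(linD (@parity_linear _ _)).
rewrite (linD (ll _)) !(linD (lr _)).
by rewrite !(hlp _ _ _ _ h0 k0, hlp _ _ _ _ h0 k1, hlp _ _ _ _ h1 k0,
             hlp _ _ _ _ h1 k1).
Qed.

Lemma parity_env_act (b : env (sub_lsa h)) (v : V) :
  parity (env_act b v) = env_act (env_parity b) (parity v).
Proof.
have [lp pM p1 pin] := env_parity_morphism (sub_lsa h).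
have ll n : linear ((@env_act _ _ V)^~ n) by exact: env_act_linearl.
move: b v; apply: (@env_ind _ _ [set b | forall v, parity (env_act b v) =
  env_act (env_parity b) (parity v)]) => /= [||x b /= hb v].
- split=> [v|a u u' /= hu hu' v] /=.
    by rewrite (lin0 lp) !(lin0 (ll _)) (lin0 (@parity_linear _ _)).
  by rewrite lp !(ll _ _ _ _) parity_linear hu hu'.
- by move=> v; rewrite p1 !env_act1.
- by rewrite pM pin !env_actM !env_act_in parity_act hb.
Qed.

Lemma env_parity_hom i (u : env g) : u \in env_hom i -> env_parity u = (-1) ^+ i *: u.
Proof.
have [lp pM p1 pin] := env_parity_morphism g.
move: u; apply: (@lspan_ind _ _ _ [set u | env_parity u = (-1) ^+ i *: u]).
  split=> [|a u v /= hu hv] /=; first by rewrite (lin0 lp) scaler0.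
  by rewrite lp hu hv scalerDr !scalerA mulrC.
move=> _ [s [hs -> ->]] /=; elim: s hs => [|p s IH] hs.
  by rewrite !big_nil p1 expr0 scale1r.
rewrite !big_cons pM pin IH; last by move=> q qs; apply: hs; rewrite inE qs orbT.
rewrite (parity_hom (hs p _)) ?mem_head // (linZ (@env_in_linear _ g)).
by rewrite -scalerAl -scalerAr scalerA signr_addb.
Qed.

Lemma ind_hom_cap (q : ind_car) : ind_hom false q -> ind_hom true q -> q = 0.
Proof.
have [lp pM p1 pin] := env_parity_morphism g.
pose s (q : ind_car) : ind_car :=
  flift (fun p => tens (env_parity p.1) (parity p.2)) (qrepr q).
have [ls sE] : linear s /\
    forall u v, s (tens u v) = tens (env_parity u) (parity v).
  apply: (@ind_liftE _ (fun u v => tens (env_parity u) (parity v))).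
  - by move=> v a u u'; rewrite lp tens_linearl.
  - by move=> u a v v'; rewrite parity_linear tens_linearr.
  - move=> u b v; rewrite pM env_parity_incl tens_balanced.
    by rewrite parity_env_act.
have sh i r : ind_hom i r -> s r = (-1) ^+ i *: r.
  move: r; apply: (@lspan_ind _ _ _ [set r | s r = (-1) ^+ i *: r]).
    split=> [|a r r' /= hr hr'] /=; first by rewrite (lin0 ls) scaler0.
    by rewrite ls hr hr' scalerDr !scalerA mulrC.
  move=> _ [j [k [u [v [-> hu hv ->]]]]] /=.
  rewrite sE (env_parity_hom hu) (parity_hom hv) (linZ (tens_linearl _)).
  by rewrite (linZ (tens_linearr _)) scalerA signr_addb.
by move=> /sh h0 /sh h1; exact: signed_cap h0 h1.
Qed.

Definition ind_space : superspace K :=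
  Superspace ind_hom_subspace ind_hom_sum ind_hom_cap.

Definition ind_act (x : g) (q : ind_space) : ind_space := ind_mul (env_in x) q.

Lemma ind_act_linearl q : linear (ind_act^~ q).
Proof. by move=> a x y; rewrite /ind_act env_in_linear ind_mul_linearl. Qed.

Lemma ind_act_linearr x : linear (ind_act x).
Proof. exact: ind_mul_linearr. Qed.

Lemma ind_act_hom i j (x : g) (q : ind_space) :
  ss_hom i x -> ss_hom j q -> ss_hom (i (+) j) (ind_act x q).
Proof.
move=> hx; have [H0 HD] := ind_hom_subspace (i (+) j).
move: q; apply: (@lspan_ind _ _ _ [set q | ind_hom (i (+) j) (ind_act x q)]).
  split=> [|a q q' /= hq hq'] /=; first by rewrite (lin0 (ind_act_linearr x)).
  by rewrite ind_act_linearr; exact: HD.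
move=> _ [k [l [u [v [-> hu hv ->]]]]] /=; rewrite /ind_act ind_mul_tens addbA.
by apply: ind_hom_tens => //; exact: env_hom_in.
Qed.

Lemma ind_act_br i j (x y : g) (q : ind_space) : ss_hom i x -> ss_hom j y ->
  ind_act (lsa_br x y) q =
    ind_act x (ind_act y q) - koszul K i j *: ind_act y (ind_act x q).
Proof.
move=> hx hy; have ll := ind_mul_linearl q.
by rewrite /ind_act (env_in_br hx hy) (linB ll) (linZ ll) !ind_mulM.
Qed.

Definition Ind : smodule g :=
  Smodule ind_act_linearl ind_act_linearr ind_act_hom ind_act_br.

End Induced.


(* The elements supported in D are the span of the basis vectors indexed by D. *)
Definition basis_span (K : fieldType) (X : choiceType) (D : pred X) :
  set {malg K[X]} := [set x | forall a, a \in msupp x -> D a].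

Section BasisSpan.
Context {K : fieldType} {X : choiceType}.
Implicit Types D E : pred X.

Lemma basis_span_subspace D : subspace (@basis_span K X D).
Proof.
split=> [a|a x y hx hy b]; first by rewrite msupp0 inE.
move/(fsubsetP (msuppD_le _ _)); rewrite inE => /orP[|/hy //].
by move/(fsubsetP (msuppZ_le _ _))/hx.
Qed.

Lemma basis_spanU D a : D a -> basis_span D (<< a >> : {malg K[X]}).
Proof. by move=> Da b; rewrite msuppU oner_eq0 inE => /eqP ->. Qed.

Lemma basis_spanUE D a : basis_span D (<< a >> : {malg K[X]}) -> D a.
Proof. by apply; rewrite msuppU oner_eq0 inE. Qed.

Lemma basis_span_ind D (W : {malg K[X]} -> Prop) :
  subspace W -> (forall a, D a -> W << a >>) -> forall x, basis_span D x -> W x.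
Proof. by move=> [W0 WD] WU x; exact: malg_ind. Qed.

Lemma basis_span_sum D E (x : {malg K[X]}) : basis_span D x ->
  exists x0 x1, [/\ basis_span D x0, basis_span D x1,
    basis_span (predC E) x0, basis_span E x1 & x = x0 + x1].
Proof.
have [D0 DD] := basis_span_subspace D; have [E0 ED] := basis_span_subspace E.
have [C0 CD] := basis_span_subspace (predC E).
move: x; apply: basis_span_ind.
  split; first by exists 0, 0; rewrite addr0.
  move=> a _ _ [u0 [u1 [? ? ? ? ->]]] [v0 [v1 [? ? ? ? ->]]].
  exists (a *: u0 + v0), (a *: u1 + v1).
  by rewrite scalerDr addrACA; split; by [exact: DD|exact: ED|exact: CD|].
move=> a Da; have [Ea|nEa] := boolP (E a).
  by exists 0, << a >>; rewrite add0r; split=> //; exact: basis_spanU.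
by exists << a >>, 0; rewrite addr0; split=> //; exact: basis_spanU.
Qed.

Lemma basis_span_cap E (x : {malg K[X]}) :
  basis_span (predC E) x -> basis_span E x -> x = 0.
Proof.
move=> hC hE; apply/malgP => a; rewrite mcoeff0.
by have [xa|//] := msuppP x a; have := hC a xa; rewrite /= hE.
Qed.

End BasisSpan.

Inductive hv_gen := genL of int | genG of int | genI of int.

Definition hv_gen_code (a : hv_gen) : (int + int) + int :=
  match a with
  | genL m => inl (inl m) | genG m => inl (inr m) | genI m => inr m
  end.
Definition hv_gen_decode (c : (int + int) + int) : hv_gen :=
  match c with
  | inl (inl m) => genL m | inl (inr m) => genG m | inr m => genI m
  end.
Lemma hv_gen_codeK : cancel hv_gen_code hv_gen_decode. Proof. by case. Qed.

HB.instance Definition _ := Choice.copy hv_gen (can_type hv_gen_codeK).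

Definition hv_odd (a : hv_gen) : bool := if a is genG _ then true else false.

Section HV.
Context (K : fieldType).

Local Notation S0 := {malg K[hv_gen]}.

Definition hv_bracket (a b : hv_gen) : S0 :=
  match a, b with
  | genL m, genL n => (n - m)%:~R *: << genL (m + n) >>
  | genL m, genG n => n%:~R *: << genG (m + n) >>
  | genG m, genL n => - m%:~R *: << genG (m + n) >>
  | genL m, genI n => n%:~R *: << genI (m + n) >>
  | genI m, genL n => - m%:~R *: << genI (m + n) >>
  | genG m, genG n => 2 *: << genI (m + n) >>
  | genI _, genI _ | genI _, genG _ | genG _, genI _ => 0
  end.

Definition hv_hom (i : bool) : set S0 :=
  basis_span [pred a | hv_odd a == i].

Lemma hv_hom_sum (x : S0) : exists x0 x1,
  [/\ hv_hom false x0, hv_hom true x1 & x = x0 + x1].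
Proof.
have [//|x0 [x1 [_ _ h0 h1 ->]]] := @basis_span_sum K _ xpredT hv_odd x.
exists x0, x1; split=> // a; first by move/h0 => /= /negbTE ->.
by move/h1 => /= ->.
Qed.

Lemma hv_hom_cap (x : S0) : hv_hom false x -> hv_hom true x -> x = 0.
Proof.
move=> h0 h1; apply: (@basis_span_cap K _ hv_odd) => a.
  by move/h0 => /= /eqP ->.
by move/h1 => /= /eqP ->.
Qed.

Definition hv_space : superspace K :=
  Superspace (fun i => basis_span_subspace _) hv_hom_sum hv_hom_cap.

Definition hv_br (x y : hv_space) : hv_space :=
  flift (fun a => flift (hv_bracket a) y) x.

Lemma hv_brU a b : hv_br << a >> << b >> = hv_bracket a b.
Proof. by rewrite /hv_br !fliftU. Qed.

Lemma hv_br_linearl y : linear (hv_br^~ y).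
Proof. exact: flift_linear. Qed.

Lemma hv_br_linearr x : linear (hv_br x).
Proof.
move=> a y y'; rewrite /hv_br !fliftE scaler_sumr -big_split /=.
apply: eq_bigr => b _; rewrite flift_linear scalerDr !scalerA.
by rewrite [x@_b * a]mulrC.
Qed.

(* All brackets have the form c *: << d >> with d independent of the bracketing
   of iterated brackets. *)
Definition hv_coef (a b : hv_gen) : K :=
  match a, b with
  | genL m, genL n => (n - m)%:~R
  | genL m, genG n | genL m, genI n => n%:~R
  | genG m, genL n | genI m, genL n => - m%:~R
  | genG m, genG n => 2
  | _, _ => 0
  end.
Definition hv_idx (a b : hv_gen) : hv_gen :=
  match a, b with
  | genL m, genL n => genL (m + n)
  | genL m, genG n | genG m, genL n => genG (m + n)
  | genL m, genI n | genI m, genL n | genG m, genG n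
  | genI m, genI n | genI m, genG n | genG m, genI n => genI (m + n)
  end.

Lemma hv_bracketE a b : hv_bracket a b = hv_coef a b *: << hv_idx a b >>.
Proof. by case: a b => m [] n //=; rewrite scale0r. Qed.

Lemma hv_idxC a b : hv_idx a b = hv_idx b a.
Proof. by case: a b => m [] n /=; rewrite addrC. Qed.

Lemma hv_idxA a b c : hv_idx a (hv_idx b c) = hv_idx (hv_idx a b) c.
Proof. by case: a b c => m [] n [] p /=; rewrite addrA. Qed.

Lemma hv_coefC a b :
  hv_coef a b = - (koszul K (hv_odd a) (hv_odd b) * hv_coef b a).
Proof. by rewrite /koszul; case: a b => m [] n /=; ring. Qed.

Lemma hv_coef_jacobi a b c :
  hv_coef b c * hv_coef a (hv_idx b c) =
    hv_coef a b * hv_coef (hv_idx a b) c +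
    koszul K (hv_odd a) (hv_odd b) * hv_coef a c * hv_coef b (hv_idx a c).
Proof. by rewrite /koszul; case: a b c => m [] n [] p /=; ring. Qed.

Lemma hv_bracket_hom a b :
  hv_hom (hv_odd a (+) hv_odd b) (hv_bracket a b).
Proof.
have Z i c (x : S0) : hv_hom i x -> hv_hom i (c *: x).
  have [H0 HD] := @basis_span_subspace K _ [pred a | hv_odd a == i].
  by move=> hx; rewrite -[_ *: _]addr0; apply: HD.
case: a b => m [] n /=; try (by apply: Z; apply: basis_spanU);
  exact: (@basis_span_subspace K _ _).1.
Qed.

Lemma hv_br_hom i j (x y : hv_space) : ss_hom i x -> ss_hom j y ->
  ss_hom (i (+) j) (hv_br x y).
Proof.
have [H0 HD] := @ss_hom_subspace K hv_space (i (+) j).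
move=> hx hy; move: x hx; apply: basis_span_ind.
  split=> [|a x x' hx hx'] /=; first by rewrite (lin0 (hv_br_linearl y)).
  by rewrite (hv_br_linearl y); exact: HD.
move=> a /eqP ea; move: y hy; apply: basis_span_ind.
  split=> [|c y y' hy hy'] /=; first by rewrite (lin0 (hv_br_linearr _)).
  by rewrite (hv_br_linearr _); exact: HD.
by move=> b /eqP <-; rewrite hv_brU -ea; exact: hv_bracket_hom.
Qed.

Lemma hv_br_skew i j (x y : hv_space) : ss_hom i x -> ss_hom j y ->
  hv_br x y = - (koszul K i j *: hv_br y x).
Proof.
have lz := hv_br_linearl; have rz := hv_br_linearr.
move=> hx hy; move: x hx; apply: basis_span_ind.
  split=> [|c x x' /= hx hx'] /=.
    by rewrite (lin0 (lz _)) (lin0 (rz _)) scaler0 oppr0.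
  by rewrite lz rz hx hx' scalerDr !scalerA opprD scalerN !scalerA [c * _]mulrC.
move=> a /eqP <-; move: y hy; apply: basis_span_ind.
  split=> [|c y y' /= hy hy'] /=.
    by rewrite (lin0 (lz _)) (lin0 (rz _)) scaler0 oppr0.
  by rewrite lz rz hy hy' scalerDr !scalerA opprD scalerN !scalerA [c * _]mulrC.
move=> b /eqP <-; rewrite !hv_brU !hv_bracketE hv_idxC !scalerA -scaleNr.
by rewrite hv_coefC.
Qed.

Lemma hv_br_jacobi i j (x y z : hv_space) : ss_hom i x -> ss_hom j y ->
  hv_br x (hv_br y z) = hv_br (hv_br x y) z + koszul K i j *: hv_br y (hv_br x z).
Proof.
have lz := hv_br_linearl; have rz := hv_br_linearr.
move=> hx hy; move: x hx; apply: basis_span_ind.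
  split=> [|c x x' /= hx hx'] /=.
    by rewrite !(lin0 (lz _), lin0 (rz _)) scaler0 addr0.
  rewrite lz (lz y) !lz (rz y) hx hx' !scalerDr !scalerA [c * koszul _ _ _]mulrC.
  by rewrite addrACA.
move=> a /eqP <-; move: y hy; apply: basis_span_ind.
  split=> [|c y y' /= hy hy'] /=.
    by rewrite !(lin0 (lz _), lin0 (rz _)) scaler0 addr0.
  rewrite (lz z) (rz << a >>) (rz << a >>) !lz hy hy' !scalerDr !scalerA.
  by rewrite [c * koszul _ _ _]mulrC addrACA.
move=> b /eqP <-.
have hz : basis_span xpredT z by [].
move: z hz; apply: basis_span_ind => [|c _].
  split=> [|c z z' /= hz hz'] /=.
    by rewrite !(lin0 (rz _)) scaler0 addr0.
  rewrite !rz hz hz' !scalerDr !scalerA [c * koszul _ _ _]mulrC.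
  by rewrite addrACA.
rewrite !hv_brU !hv_bracketE !(linZ (rz _)) (linZ (lz _)) !hv_brU !hv_bracketE.
rewrite !scalerA hv_idxA [hv_idx b (hv_idx a c)]hv_idxA [hv_idx b a]hv_idxC.
by rewrite -scalerDl hv_coef_jacobi.
Qed.

Definition hv : lie_superalgebra K :=
  LieSuperalgebra hv_br_linearl hv_br_linearr hv_br_hom hv_br_skew hv_br_jacobi.

Definition hvL (m : int) : hv := << genL m >> : S0.
Definition hvG (m : int) : hv := << genG m >> : S0.
Definition hvI (m : int) : hv := << genI m >> : S0.

Lemma hv_brackets (m n : int) :
  [/\ lsa_br (hvL m) (hvL n) = (n - m)%:~R *: hvL (m + n),
      lsa_br (hvL m) (hvG n) = n%:~R *: hvG (m + n),
      lsa_br (hvL m) (hvI n) = n%:~R *: hvI (m + n),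
      lsa_br (hvG m) (hvG n) = 2 *: hvI (m + n) &
      lsa_br (hvI m) (hvI n) = 0 /\ lsa_br (hvI m) (hvG n) = 0].
Proof. by split; [| | | |split]; exact: hv_brU. Qed.

(* S^(r,s,t). As [G_t, G_t] = 2 I_(2t), it is a subalgebra only if s <= 2t;
   otherwise it is just a subspace. *)
Definition hv_trunc (r s t : nat) : set hv :=
  basis_span (fun a : hv_gen => match a with
    | genL i => r%:Z <= i | genI i => s%:Z <= i | genG i => t%:Z <= i end).

(* The basis of S_{alpha,beta}. Closure under the bracket needs 2 beta <= alpha,
   because of [G_(-beta), G_(-beta)] = 2 I_(-2 beta). *)
Definition hv_ab_gen (alpha beta : nat) (a : hv_gen) : bool :=
  match a with
  | genL i => 0 <= i | genI i => - alpha%:Z <= i | genG i => - beta%:Z <= i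
  end.

Section SubalgebraAB.
Context (alpha beta : nat).
Hypothesis le_ab : (2 * beta <= alpha)%N.

Lemma hv_ab_graded :
  graded_subspace (basis_span (hv_ab_gen alpha beta) : set hv).
Proof.
split=> [|x hx]; first exact: basis_span_subspace.
have [x0 [x1 [h0 h1 k0 k1 ->]]] := basis_span_sum hv_odd hx.
exists x0, x1; split=> // a; first by move/k0 => /= /negbTE ->.
by move/k1 => /= ->.
Qed.

Lemma hv_ab_closed (x y : hv) :
  basis_span (hv_ab_gen alpha beta) x -> basis_span (hv_ab_gen alpha beta) y ->
  basis_span (hv_ab_gen alpha beta) (lsa_br x y).
Proof.
have [H0 HD] := @basis_span_subspace K _ (hv_ab_gen alpha beta).
move=> hx hy; move: x hx; apply: basis_span_ind.
  split=> [|c x x' /= hx hx'] /=; first by rewrite (lin0 (hv_br_linearl y)).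
  by rewrite (hv_br_linearl y); exact: HD.
move=> a ha; move: y hy; apply: basis_span_ind.
  split=> [|c y y' /= hy hy'] /=; first by rewrite (lin0 (hv_br_linearr _)).
  by rewrite (hv_br_linearr _); exact: HD.
move=> b hb; rewrite [lsa_br _ _]hv_brU.
have Z c d : hv_ab_gen alpha beta d ->
    basis_span (hv_ab_gen alpha beta) (c *: << d >> : S0).
  by move=> hd; rewrite -[_ *: _]addr0; apply: HD => //; exact: basis_spanU.
by case: a b ha hb => m [] n /= ha hb; try (by []); apply: Z; rewrite /=; lia.
Qed.

Definition hv_ab : subalgebra hv := Subalgebra hv_ab_graded hv_ab_closed.

Lemma hv_abL (i : nat) : sub_set hv_ab (hvL i).
Proof. exact: basis_spanU. Qed.
Lemma hv_abG (i : nat) : sub_set hv_ab (hvG i).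
Proof. by apply: basis_spanU; rewrite /=; lia. Qed.
Lemma hv_abI (i : nat) : sub_set hv_ab (hvI i).
Proof. by apply: basis_spanU; rewrite /=; lia. Qed.

(* L_i, G_i and I_i, for i >= 0, as elements of S_{alpha,beta} *)
Definition abL (i : nat) : sub_lsa hv_ab := sub_elt (@hv_abL i).
Definition abG (i : nat) : sub_lsa hv_ab := sub_elt (@hv_abG i).
Definition abI (i : nat) : sub_lsa hv_ab := sub_elt (@hv_abI i).

End SubalgebraAB.

End HV.

Arguments hvL {K} m.
Arguments hvG {K} m.
Arguments hvI {K} m.

(* Main.v *)
(* Let F_N be the span of the L_i, G_i, I_i with i >= N.  All five conditions are
   equivalent to: some nonzero v in P satisfies F_N v = 0 for some N.

   Under (1), an eigenvector of L_l (l large) generates a finite-dimensional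
   subspace E stable under F_(l+1), by a reordering argument.  A nontrivial linear
   relation between the L_m on E can be reduced, by brackets with the L_m it
   involves, to L_m = 0 on E for one m; then F_N E = 0 for some N.
   If F_N v = 0, brackets with long words in F_N raise degrees beyond N, so that
   the vectors killed by all long words form a submodule, and this gives (4); as
   every vector is moreover killed by some F_M, only finitely many words matter,
   and this gives (3).

   For (5), let z be the largest index such that I_z is injective: each I_l with
   l > z is locally nilpotent, and the space V of the vectors killed by L_i
   (i > z + alpha), G_j (j > z + beta), I_l (l > z) is nonzero for large beta
   and alpha = 2 beta.  Since I_z is injective, the killing letters detect the
   missing ones: [L_(z+alpha+i), I_(-alpha-i)], [G_(z+beta+i), G_(-beta-i)] and
   [I_(z+i), L_(-i)] are nonzero multiples of I_z.  Hence in any module generated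
   by a copy of V every vector is carried by a word in the killing letters to a
   nonzero vector of that copy, unless it lies there already.  This shows both
   that V is simple and that Ind V -> P is injective, without any basis of U(S). *)

Require Import Defs.
From HB Require Import structures.
From mathcomp Require Import all_boot all_order all_algebra.
From mathcomp Require Import boolp classical_sets reals finmap complex monalg.
From mathcomp Require Import zify.

Set Implicit Arguments.
Unset Strict Implicit.
Unset Printing Implicit Defensive.

Import Order.TTheory GRing.Theory Num.Theory.

Local Open Scope classical_set_scope.
Local Open Scope ring_scope.

(** * Linear algebra *)

Section Subspaces.
Context {K : fieldType} {V : lmodType K}.
Implicit Types (W : set V) (A : set V) (f : V -> V).

Lemma subspace0 W : subspace W -> W 0. Proof. by case. Qed.

Lemma subspaceZ W a v : subspace W -> W v -> W (a *: v).
Proof. by move=> [W0 WD] Wv; rewrite -[_ *: _]addr0; apply: WD. Qed.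

Lemma subspaceD W u v : subspace W -> W u -> W v -> W (u + v).
Proof. by move=> [W0 WD] Wu Wv; rewrite -[u]scale1r; apply: WD. Qed.

Lemma subspaceN W v : subspace W -> W v -> W (- v).
Proof. by move=> sW Wv; rewrite -scaleN1r; apply: subspaceZ. Qed.

Lemma subspaceB W u v : subspace W -> W u -> W v -> W (u - v).
Proof. by move=> sW Wu Wv; apply: subspaceD => //; apply: subspaceN. Qed.

Lemma subspace_sum W (I : eqType) (r : seq I) (F : I -> V) :
  subspace W -> (forall i, i \in r -> W (F i)) -> W (\sum_(i <- r) F i).
Proof.
move=> sW WF; rewrite big_seq; elim/big_ind: _ => //; first exact: subspace0.
by move=> u v; apply: subspaceD.
Qed.

Lemma subspace_preim (V' : lmodType K) (W : set V') (f : V -> V') :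
  linear f -> subspace W -> subspace [set v | W (f v)].
Proof.
move=> lf [W0 WD]; split=> [|a u v /= hu hv] /=; first by rewrite lin0.
by rewrite lf; apply: WD.
Qed.

Lemma subspace_forall (I : Type) (D : I -> Prop) (W : I -> set V) :
  (forall i, D i -> subspace (W i)) -> subspace [set v | forall i, D i -> W i v].
Proof.
move=> sW; split=> [i Di|a u v hu hv i Di]; first exact: (sW i Di).1.
by apply: (sW i Di).2; [apply: hu|apply: hv].
Qed.

Lemma lspan_le A W v : subspace W -> A `<=` W -> v \in lspan A -> W v.
Proof. by move=> sW AW; apply: lspan_ind. Qed.

Lemma lspan_mono A B v : A `<=` B -> v \in lspan A -> v \in lspan B.
Proof.
move=> AB; apply: (lspan_le (subspace_lspan B)) => u /AB; exact: lspan_mem.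
Qed.

Lemma lspan_stable A f v :
  linear f -> (forall u, A u -> f u \in lspan A) ->
  v \in lspan A -> f v \in lspan A.
Proof.
move=> lf fA; apply: (lspan_le (W := [set v | f v \in lspan A])) => //.
exact: (subspace_preim lf (subspace_lspan A)).
Qed.

Lemma iter_linear f n : linear f -> linear (iter n f).
Proof. by move=> lf; elim: n => // n IH a u v; rewrite /= (IH a u v) lf. Qed.

Lemma lin_sum (V' : lmodType K) (g : V -> V') (I : Type) (r : seq I) (P : pred I) F :
  linear g -> g (\sum_(i <- r | P i) F i) = \sum_(i <- r | P i) g (F i).
Proof.
move=> lg; elim/big_rec2: _ => [|i x y _ <-]; first exact: lin0.
exact: linD.
Qed.

Lemma lspan_seqP (s : seq V) v : v \in lspan [set x | x \in s] ->
  exists c : 'I_(size s) -> K, v = \sum_i c i *: s`_i.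
Proof.
apply: (lspan_le (W := [set v | exists c : 'I_(size s) -> K, v = \sum_i c i *: s`_i])).
  split=> [|a _ _ [c ->] [d ->]].
    by exists (fun=> 0); rewrite big1 // => i _; rewrite scale0r.
  exists (fun i => a * c i + d i); rewrite scaler_sumr -big_split /=.
  by apply: eq_bigr => i _; rewrite scalerDl scalerA.
move=> x /= xs; have lt : (index x s < size s)%N by rewrite index_mem.
exists (fun i => (i == Ordinal lt)%:R); rewrite (bigD1 (Ordinal lt)) //= eqxx.
rewrite scale1r nth_index // big1 ?addr0 // => i /negbTE ->.
by rewrite scale0r.
Qed.

(** There are more vectors than generators: the coefficient matrix [B] has one more row than
    columns, so its left kernel contains a nonzero row. *)
Lemma lspan_dependent (s : seq V) (F : nat -> V) :
  (forall i, F i \in lspan [set x | x \in s]) ->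
  exists c : 'I_(size s).+1 -> K,
    (exists i, c i != 0) /\ \sum_i c i *: F i = 0.
Proof.
move=> Fs; have [A FA] : exists A : nat -> 'I_(size s) -> K,
    forall i, F i = \sum_j A i j *: s`_j.
  have /choice [A HA] : forall i, exists c : 'I_(size s) -> K, F i = \sum_j c j *: s`_j.
    by move=> i; apply: lspan_seqP.
  by exists A.
pose B : 'M[K]_((size s).+1, size s) := \matrix_(i, j) A i j.
have kB : kermx B != 0.
  rewrite kermx_eq0 /row_free neq_ltn; apply/orP; left.
  by rewrite ltnS rank_leq_col.
have /rowV0Pn [u /sub_kermxP uB u0] := kB.
exists (fun i => u 0 i); split.
  apply/existsP; apply: contra_neqT u0 => /existsPn h.
  by apply/rowP => i; rewrite mxE; apply/eqP/negPn/h.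
under eq_bigr => i _ do rewrite FA scaler_sumr.
rewrite exchange_big /= big1 // => j _.
under eq_bigr => i _ do rewrite scalerA.
rewrite -scaler_suml; have /matrixP /(_ 0 j) := uB.
rewrite !mxE => e; suff -> : \sum_i u 0 i * A i j = 0 by rewrite scale0r.
by rewrite -[RHS]e; apply: eq_bigr => i _; rewrite mxE.
Qed.

(** Local finiteness in the weak form used below: a finite list whose span contains the orbit, not
    necessarily one with the same span. *)
Definition orbit_bounded f := forall u, exists s : seq V,
  forall p, iter p f u \in lspan [set x | x \in s].

(** The relation reads p(f) u = 0; it comes from the linear dependence of the first [(size s).+1]
    iterates. *)
Lemma iter_relation f u : orbit_bounded f ->
  exists p : {poly K}, p != 0 /\ \sum_(i < size p) p`_i *: iter i f u = 0.
Proof.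
move=> /(_ u) [s hs]; have [c [[i ci] e]] := lspan_dependent hs.
(* [insub] turns an index into an ordinal; the default 0 is never read, as [j] stays below
   [(size s).+1]. *)
pose p := \poly_(j < (size s).+1) odflt 0 (omap c (insub j)).
have pE (j : 'I_(size s).+1) : p`_j = c j.
  by rewrite coef_poly ltn_ord valK.
have p0 : p != 0 by apply: contra_neq ci => p0; rewrite -pE p0 coef0.
exists p; split=> //; rewrite -[RHS]e.
rewrite (big_ord_widen _ (fun i : nat => p`_i *: iter i f u) (size_poly _ _)).
rewrite big_mkcond /=; apply: eq_bigr => j _.
case: ifPn => [_|]; first by rewrite pE.
by rewrite -leqNgt => le; rewrite -pE nth_default ?scale0r.
Qed.

(** Dividing p(f) u = 0 by the leading coefficient of p expresses the iterate of order deg p through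
    the lower ones, so n = deg p works. *)
Lemma orbit_finite f u : linear f -> orbit_bounded f ->
  exists n, forall p, iter p f u \in lspan [set iter q f u | q in [set q | (q < n)%N]].
Proof.
move=> lf /(iter_relation u) [p [p0 e]].
have sp : (0 < size p)%N by rewrite size_poly_gt0.
exists (size p).-1; elim=> [|m IH].
  (* In degree 0 the nonzero constant p kills u, so u = 0 lies even in the span of the empty set. *)
  case: (posnP (size p).-1) => [z|pos]; last by apply: lspan_mem; exists 0%N.
  move: e; have -> : size p = 1%N by rewrite -(prednK sp) z.
  rewrite big_ord1 /= => /eqP; rewrite scaler_eq0.
  have: lead_coef p != 0 by rewrite lead_coef_eq0.
  by rewrite /lead_coef z => /negbTE -> /= /eqP ->; rewrite rpred0.
apply: (@lspan_stable _ f (iter m f u)) => // _ [q /= lt <-]; rewrite -iterS.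
have [lt'|] := ltnP q.+1 (size p).-1; first by apply: lspan_mem; exists q.+1.
move=> le; have {le} eq1 : q.+1 = (size p).-1 by apply/eqP; rewrite eqn_leq le andbT; exact: lt.
rewrite eq1; move: e; rewrite -(prednK sp) big_ord_recr /= => /eqP.
rewrite addrC addr_eq0 => /eqP e.
have l0 : p`_(size p).-1 != 0 by rewrite -/(lead_coef p) lead_coef_eq0.
rewrite -[X in X \in _]scale1r -(mulVf l0) -scalerA e.
rewrite rpredZ // rpredN; apply: rpred_sum => i _; rewrite rpredZ //.
by apply: lspan_mem; exists i => //=.
Qed.

End Subspaces.

(** Induction on the degree of p with p(f) u = 0: if p = q (X - r), either u is an eigenvector for
    r, or f u - r u is nonzero and annihilated by q. *)
Lemma eigenvector_ex (K : closedFieldType) (V : lmodType K) (f : V -> V) (u : V) :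
  linear f -> orbit_bounded f -> u <> 0 ->
  exists (a : K) (v : V), v <> 0 /\ f v = a *: v.
Proof.
move=> lf /(iter_relation u) [p [p0 e]] u0.
have [n] := ubnP (size p); elim: n => // n IH in p u p0 e u0 *.
rewrite ltnS => le.
have [s1|s1] := eqVneq (size p) 1%N.
  move: e; rewrite s1 big_ord1 /= => /eqP; rewrite scaler_eq0 => /orP[|/eqP//].
  have: lead_coef p != 0 by rewrite lead_coef_eq0.
  by rewrite /lead_coef s1 => /negbTE ->.
have [r] := closed_rootP _ s1.
move=> /factor_theorem [q pq].
have q0 : q != 0 by apply: contra_neq p0 => q0; rewrite pq q0 mul0r.
have szp : size p = (size q).+1 by rewrite pq size_Mmonic ?monicXsubC // size_XsubC addn2.
have [e0|ne0] := pselect (f u - r *: u = 0).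
  by exists r, u; split=> //; apply: subr0_eq.
apply: (IH q (f u - r *: u)) => //; last by rewrite -ltnS -szp.
rewrite -[RHS]e szp.
(* Both sums are extended to the size of p, where their coefficients differ by those of q (X -
   r). *)
transitivity (\sum_(i < size q) q`_i *: iter i.+1 f u -
              \sum_(i < size q) (r * q`_i) *: iter i f u).
  rewrite -sumrB; apply: eq_bigr => i _.
  by rewrite (linB (iter_linear i lf)) (linZ (iter_linear i lf)) -iterSr scalerBr scalerA [r * _]mulrC.
have -> : \sum_(i < size q) (r * q`_i) *: iter i f u =
          \sum_(i < (size q).+1) (r * q`_i) *: iter i f u.
  by rewrite big_ord_recr /= [q`_(size q)]nth_default // mulr0 scale0r addr0.
have -> : \sum_(i < size q) q`_i *: iter i.+1 f u =
          \sum_(i < (size q).+1) (if (i : nat) is j.+1 then q`_j else 0) *: iter i f u.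
  by rewrite big_ord_recl /= scale0r add0r.
rewrite -sumrB; apply: eq_bigr => i _; rewrite -scalerBl; congr (_ *: _).
rewrite pq mulrBr coefB coefMX coefMC [r * _]mulrC.
by case: (i : nat).
Qed.

(** * Finitely spanned subspaces *)

Section FiniteDimension.
Context {K : fieldType} {V : lmodType K}.
Implicit Types (W : set V) (f : V -> V) (s : seq V).

Lemma lspan_seq_cons x s v : v \in lspan [set y | y \in x :: s] ->
  exists a y, y \in lspan [set y | y \in s] /\ v = a *: x + y.
Proof.
apply: (lspan_le (W := [set v | exists a y,
  y \in lspan [set y | y \in s] /\ v = a *: x + y])).
  split=> [|c _ _ [a [y [ys ->]]] [b [z [zs ->]]]] /=.
    by exists 0, 0; rewrite rpred0 scale0r addr0.
  exists (c * a + b), (c *: y + z); split; first by rewrite rpredD ?rpredZ.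
  by rewrite scalerDr scalerA addrACA scalerDl.
move=> y /=; rewrite inE => /orP[/eqP ->|ys].
  by exists 1, 0; rewrite rpred0 scale1r addr0.
by exists 0, y; rewrite scale0r add0r; split=> //; apply: lspan_mem.
Qed.

(** Induction on the list: W meets the span of the tail in a finitely spanned W'. If W has a vector
    w outside that span, its coefficient on x is nonzero, so w can be used to eliminate x from any
    vector of W, leaving an element of W'. *)
Lemma subspace_finite W s : subspace W ->
    (forall v, W v -> v \in lspan [set x | x \in s]) ->
  exists t : seq V, forall v, W v <-> v \in lspan [set x | x \in t].
Proof.
elim: s W => [|x s IH] W sW Ws.
  by exists [::] => v; split=> [/Ws //|]; apply: lspan_le => // y.
pose W' := [set v | W v /\ v \in lspan [set y | y \in s]].
have sW' : subspace W'.
  split=> [|a u v [Wu us] [Wv vs]]; first by split; [exact: sW.1|exact: rpred0].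
  by split; [exact: sW.2|rewrite rpredD ?rpredZ].
have [t ht] := IH W' sW' (fun v => @proj2 _ _).
have [[w [Ww nw]]|h] := pselect (exists w, W w /\ w \notin lspan [set y | y \in s]).
  exists (w :: t) => v; split=> [Wv|].
    have [a [y [ys ew]]] := lspan_seq_cons (Ws _ Ww).
    have [b [z [zs ev]]] := lspan_seq_cons (Ws _ Wv).
    have a0 : a != 0.
      by apply: contraNneq nw => a0; rewrite ew a0 scale0r add0r.
    rewrite -(subrK ((b / a) *: w) v) rpredD //; last first.
      by rewrite rpredZ //; apply: lspan_mem; rewrite /= mem_head.
    have /ht : W' (v - (b / a) *: w).
      split; first by apply: subspaceB => //; apply: subspaceZ.
      rewrite ev ew scalerDr scalerA divfK // opprD addrACA subrr add0r.
      by rewrite rpredB ?rpredZ.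
    by apply: lspan_mono => u /= ut; rewrite inE ut orbT.
  apply: lspan_le => // u /=; rewrite inE => /orP[/eqP -> //|ut].
  by have /ht [] : u \in lspan [set y | y \in t] by apply: lspan_mem.
exists t => v; split=> [Wv|/ht []//]; apply/ht; split=> //.
by apply: contrapT => /negP nv; apply: h; exists v.
Qed.

Lemma lspan_cat s t v :
  v \in lspan [set x | x \in s] \/ v \in lspan [set x | x \in t] ->
  v \in lspan [set x | x \in s ++ t].
Proof.
by case; apply: lspan_mono => x /= xs; rewrite mem_cat xs ?orbT.
Qed.

Lemma orbit_bounded_seq f s : linear f -> orbit_bounded f ->
  exists t : seq V, forall v p, v \in lspan [set x | x \in s] ->
    iter p f v \in lspan [set x | x \in t].
Proof.
move=> lf bf; elim: s => [|x s [t ht]].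
  exists [::] => v p; apply: (lspan_le (W := [set v |
    iter p f v \in lspan [set x | x \in ([::] : seq V)]])) => //.
  exact: (subspace_preim (iter_linear p lf) (subspace_lspan _)).
have [r hr] := bf x; exists (r ++ t) => v p /lspan_seq_cons [a [y [ys ->]]].
rewrite (iter_linear p lf) rpredD ?rpredZ //; apply: lspan_cat.
  by left; apply: hr.
by right; apply: ht.
Qed.

End FiniteDimension.

(* The Poincare-Birkhoff-Witt reordering argument, for operators satisfying
   commutation relations whose right-hand sides are shorter by one letter.  The
   letters outside [D] are redundant when acting on [B]. *)
Section SortedWords.
Context {K : fieldType} {V : lmodType K} (X : nat -> V -> V).
Hypothesis lX : forall i, linear (X i).
Hypothesis comm : forall i j, exists (e c : K) k, forall w,
  X i (X j w) = e *: X j (X i w) + c *: X k w.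
Context (D : pred nat) (B : set V).
Hypothesis D_down : forall i j, (i <= j)%N -> D j -> D i.

Definition sorted_words (m : nat) : set V := [set w | exists s b,
  [/\ sorted leq s, all D s, (size s <= m)%N, B b & w = foldr X b s]].

Hypothesis base : forall j b, ~~ D j -> B b -> X j b \in lspan (sorted_words 1).

Lemma sorted_words_mono m n v : (m <= n)%N ->
  v \in lspan (sorted_words m) -> v \in lspan (sorted_words n).
Proof.
move=> le; apply: lspan_mono => _ [s [b [? ? ls ? ->]]].
by exists s, b; split=> //; exact: leq_trans le.
Qed.

(** Induction on the length, then on the letter j. If j cannot be put in front of the first letter
    a, then a < j; after the exchange, X a acts last and the inner induction applies, while the
    commutator acts on a word shorter by one. *)
Lemma sorted_words_step m j v :
  v \in lspan (sorted_words m) -> X j v \in lspan (sorted_words m.+1).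
Proof.
elim: m j v => [|m IHm] j.
  move=> v; apply: (lspan_le (W := [set v | X j v \in lspan (sorted_words 1)])).
    exact: (subspace_preim (lX j) (subspace_lspan _)).
  move=> _ [[|i s] [b [_ _ ls Bb ->]]] //=.
  have [Dj|/base] := boolP (D j); last exact.
  by apply: lspan_mem; exists [:: j], b; rewrite /= Dj.
elim/ltn_ind: j => j IHj v.
apply: (lspan_le (W := [set v | X j v \in lspan (sorted_words m.+2)])).
  exact: (subspace_preim (lX j) (subspace_lspan _)).
move=> _ [[|a s] [b [ss Ds ls Bb ->]]] /=.
  have [Dj|/base h] := boolP (D j); last exact: (sorted_words_mono _ (h _ Bb)).
  by apply: lspan_mem; exists [:: j], b; rewrite /= Dj.
have /= /andP[Da Ds'] := Ds.
have [/andP[Dj ja]|nja] := boolP (D j && (j <= a)%N).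
  by apply: lspan_mem; exists [:: j, a & s], b; split=> //=; rewrite ?ja ?Dj.
have aj : (a < j)%N.
  by rewrite ltnNge; apply: contra nja => ja; rewrite ja (D_down ja).
have ws : foldr X b s \in lspan (sorted_words m).
  by apply: lspan_mem; exists s, b; split=> //; exact: path_sorted ss.
have [e [c [k ->]]] := comm j a.
rewrite rpredD ?rpredZ //; first by apply: IHj => //; apply: IHm.
by apply: (sorted_words_mono _ (IHm k _ ws)).
Qed.

Lemma sorted_words_stable j v :
  v \in lspan (\bigcup_m sorted_words m) -> X j v \in lspan (\bigcup_m sorted_words m).
Proof.
apply: (lspan_le (W := [set v | X j v \in lspan (\bigcup_m sorted_words m)])).
  exact: (subspace_preim (lX j) (subspace_lspan _)).
move=> w [m _ wm] /=; have /(sorted_words_step j) := lspan_mem wm.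
by apply: lspan_mono => u um; exists m.+1.
Qed.

End SortedWords.

(** * Finite-dimensional hulls under locally finite operators *)

Section LocallyFiniteWords.
Context {K : fieldType} {V : lmodType K} (X : nat -> V -> V).
Hypothesis lX : forall i, linear (X i).
Hypothesis bX : forall i, orbit_bounded (X i).

(** A sorted word is a product of powers of X 0, ..., X n-1 in this order, and the powers of each X
    i keep a finite span within a finite span. The induction on k treats the letters from n - k on,
    adding the smallest one at each step. *)
Lemma sorted_words_bounded n v : exists t : seq V, forall s,
  sorted leq s -> all (fun i => (i < n)%N) s -> foldr X v s \in lspan [set x | x \in t].
Proof.
suff [t ht] : exists t : seq V, forall s, sorted leq s ->
    all (fun i => (n - n <= i < n)%N) s -> foldr X v s \in lspan [set x | x \in t].
  by exists t => s ss sn; apply: ht => //; rewrite subnn.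
elim: {1 4}n (leqnn n) => [|k IH] lek.
  exists [:: v] => -[_ _|i s _ /=]; last by rewrite subn0 leqNgt; case: ltnP.
  by apply: lspan_mem; rewrite /= mem_head.
have [t ht] := IH (ltnW lek); set c := (n - k.+1)%N.
have [t' ht'] := orbit_bounded_seq t (lX c) (bX c); exists t' => s ss hs.
(* The occurrences of the smallest letter c form an initial block. *)
have [p [s' [es ss' hs']]] : exists p s', [/\ s = nseq p c ++ s', sorted leq s' &
    all (fun i => (n - k <= i < n)%N) s'].
  elim: s ss hs => [|i s IHs] /= ss; first by exists 0%N, [::].
  case/andP=> hi /(IHs (path_sorted ss)) [p [s' [es ss' hs']]].
  have [->|ic] := eqVneq i c; first by exists p.+1, s'; rewrite /= es.
  exists 0%N, (i :: s); split=> //=; apply/andP; split; first by lia.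
  move: ss; rewrite path_sortedE; last by move=> ? ? ?; exact: leq_trans.
  case/andP=> /allP ge _; apply/allP => j js.
  have := ge j js; have: (j < n)%N.
    move: js; rewrite es mem_cat => /orP[|/(allP hs')]; last by case/andP.
    by move/nseqP => [-> _]; rewrite /c; lia.
  by lia.
rewrite es foldr_cat.
have -> : foldr X (foldr X v s') (nseq p c) = iter p (X c) (foldr X v s').
  by elim: p {es} => //= p ->.
by apply: ht'; apply: ht.
Qed.

(** By reordering, the sorted words in the letters below n applied to v span a stable space; it lies
    in a finite span, hence has a finite generating list itself. *)
Lemma locally_finite_hull n v :
    (forall i j, exists (e c : K) k, forall w,
       X i (X j w) = e *: X j (X i w) + c *: X k w) ->
    (forall j, X j v \in lspan [set X i v | i in [set i | (i < n)%N]]) ->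
  exists t : seq V, [/\ v \in lspan [set x | x \in t] &
    forall j u, u \in lspan [set x | x \in t] -> X j u \in lspan [set x | x \in t]].
Proof.
move=> comm hv; pose D := [pred i | (i < n)%N].
have Dd i j : (i <= j)%N -> D j -> D i by exact: leq_ltn_trans.
have base j b : ~~ D j -> [set v] b -> X j b \in lspan (sorted_words X D [set v] 1).
  move=> _ ->; apply: lspan_mono (hv j) => _ [i /= lt <-].
  by exists [:: i], v; rewrite /= lt.
have st := sorted_words_stable lX comm Dd base.
have [t0 ht0] := sorted_words_bounded n v.
have bd u : u \in lspan (\bigcup_m sorted_words X D [set v] m) ->
    u \in lspan [set x | x \in t0].
  apply: (lspan_le (subspace_lspan _)).
  by move=> _ [m _ [s [_ [ss Ds _ -> ->]]]]; exact: ht0.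
have [t ht] := subspace_finite (subspace_lspan _) bd.
exists t; split; first by apply/ht; apply: lspan_mem; exists 0%N => //; exists [::], v.
by move=> j u /ht /(st j) /ht.
Qed.

End LocallyFiniteWords.

(** * Modules over the super Heisenberg-Virasoro algebra *)

Definition hv_deg (a : hv_gen) : int :=
  match a with genL m => m | genG m => m | genI m => m end.

Lemma hv_deg_idx a b : hv_deg (hv_idx a b) = hv_deg a + hv_deg b.
Proof. by case: a b => m [] n. Qed.

Section HVModules.
Context {K : numFieldType} (M : smodule (hv K)).
Implicit Types (a b : hv_gen) (u v w : M) (N : int) (W : set M).

Definition hv_op a w : M := act M (<< a >> : {malg K[hv_gen]}) w.

Lemma hv_op_linear a : linear (hv_op a).
Proof. exact: act_linearr. Qed.

Lemma hv_opC a b w : hv_op a (hv_op b w) =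
  koszul K (hv_odd a) (hv_odd b) *: hv_op b (hv_op a w)
  + hv_coef K a b *: hv_op (hv_idx a b) w.
Proof.
have h c : @ss_hom K (hv K) (hv_odd c) (<< c >> : {malg K[hv_gen]}).
  by apply: basis_spanU => /=.
have := act_br w (h a) (h b); rewrite [lsa_br _ _]hv_brU hv_bracketE.
rewrite (linZ (act_linearl _)) -/(hv_op (hv_idx a b) w) => ->.
by rewrite addrCA subrr addr0.
Qed.

Lemma hv_opLL m n w : hv_op (genL m) (hv_op (genL n) w) =
  hv_op (genL n) (hv_op (genL m) w) + (n - m)%:~R *: hv_op (genL (m + n)) w.
Proof. by rewrite hv_opC /koszul /= scale1r. Qed.

Lemma hv_opLG m n w : hv_op (genL m) (hv_op (genG n) w) =
  hv_op (genG n) (hv_op (genL m) w) + n%:~R *: hv_op (genG (m + n)) w.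
Proof. by rewrite hv_opC /koszul /= scale1r. Qed.

Lemma hv_opLI m n w : hv_op (genL m) (hv_op (genI n) w) =
  hv_op (genI n) (hv_op (genL m) w) + n%:~R *: hv_op (genI (m + n)) w.
Proof. by rewrite hv_opC /koszul /= scale1r. Qed.

Lemma hv_opGG m n w : hv_op (genG m) (hv_op (genG n) w) =
  - hv_op (genG n) (hv_op (genG m) w) + 2 *: hv_op (genI (m + n)) w.
Proof. by rewrite hv_opC /koszul /= expr1 scaleN1r. Qed.

Lemma hv_opII m n w : hv_op (genI m) (hv_op (genI n) w) =
  hv_op (genI n) (hv_op (genI m) w).
Proof. by rewrite hv_opC /koszul /= scale0r addr0 scale1r. Qed.

Lemma hv_opIG m n w : hv_op (genI m) (hv_op (genG n) w) =
  hv_op (genG n) (hv_op (genI m) w).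
Proof. by rewrite hv_opC /koszul /= scale0r addr0 scale1r. Qed.

Lemma act_basis_span (D : pred hv_gen) W (x : hv K) w :
  subspace W -> (forall a, D a -> W (hv_op a w)) -> basis_span D x ->
  W (act M x w).
Proof.
move=> sW WD; move: x; apply: basis_span_ind; last exact: WD.
exact: (subspace_preim (act_linearl w) sW).
Qed.

Lemma act_ops W (x : hv K) w :
  subspace W -> (forall a, W (hv_op a w)) -> W (act M x w).
Proof. by move=> sW Wa; apply: (@act_basis_span xpredT). Qed.

Lemma hv_op_hom a i w : ss_hom i w -> ss_hom (hv_odd a (+) i) (hv_op a w).
Proof. by apply: act_hom; apply: basis_spanU => /=. Qed.

Lemma hom_sum_eq0 i v0 v1 :
  ss_hom i v0 -> ss_hom (~~ i) v1 -> v0 + v1 = 0 -> v0 = 0 /\ v1 = 0.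
Proof.
move=> h0 h1 /eqP; rewrite addr_eq0 => /eqP e.
have h1' : ss_hom i v1.
  by rewrite -[v1]opprK -e; apply: subspaceN => //; exact: ss_hom_subspace.
have v10 : v1 = 0 by case: i {h0} h1 h1' => /= ? ?; exact: ss_hom_cap.
by rewrite e v10 oppr0.
Qed.

(** Letters are homogeneous, so the two images have opposite parities and cannot cancel. This is why
    annihilators of letters are graded. *)
Lemma hv_op_split a i w0 w1 : ss_hom i w0 -> ss_hom (~~ i) w1 ->
  hv_op a (w0 + w1) = 0 -> hv_op a w0 = 0 /\ hv_op a w1 = 0.
Proof.
move=> h0 h1; rewrite (linD (hv_op_linear a)); apply: (hom_sum_eq0 (i := hv_odd a (+) i)).
  exact: hv_op_hom.
by rewrite -addbN; exact: hv_op_hom.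
Qed.

Lemma graded_homP W : subspace W ->
  (forall w0 w1, ss_hom false w0 -> ss_hom true w1 -> W (w0 + w1) -> W w0 /\ W w1) ->
  graded_subspace W.
Proof.
move=> sW h; split=> // w Ww; have [w0 [w1 [h0 h1 e]]] := ss_hom_sum w.
by rewrite e in Ww; have [? ?] := h _ _ h0 h1 Ww; exists w0, w1.
Qed.

Lemma submoduleP W : graded_subspace W -> (forall a w, W w -> W (hv_op a w)) ->
  submodule W.
Proof. by move=> [sW hW] WM; split=> // x w Ww; apply: act_ops => // a; apply: WM. Qed.

Lemma simple_full W w : simple_module M -> submodule W -> W w -> w <> 0 ->
  forall v, W v.
Proof.
move=> [_ sM] /sM [->//|-> _ _ v]; exact: I.
Qed.

Definition killed_from N w := forall a, N <= hv_deg a -> hv_op a w = 0.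

Lemma killed_from_subspace N : subspace [set w | killed_from N w].
Proof.
apply: (@subspace_forall _ _ _ _ (fun a => [set w | hv_op a w = 0])) => a _.
exact: subspace_ker (hv_op_linear a).
Qed.

Lemma killed_from_mono N N' w : N <= N' -> killed_from N w -> killed_from N' w.
Proof. by move=> le h a la; apply: h; apply: le_trans la. Qed.

(** A letter b of degree at least N + |deg a| kills w, and so does [b, a], whose degree is still at
    least N. *)
Lemma killed_from_op N a w : killed_from N w ->
  killed_from (N + `|hv_deg a|) (hv_op a w).
Proof.
move=> h b lb; rewrite hv_opC !h; first by rewrite (lin0 (hv_op_linear _)) !scaler0 addr0.
  by rewrite hv_deg_idx; lia.
by lia.
Qed.

Lemma killed_from_op_ge0 N a w : 0 <= hv_deg a -> killed_from N w ->
  killed_from N (hv_op a w).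
Proof.
move=> a0 h b lb; rewrite hv_opC !h; first by rewrite (lin0 (hv_op_linear _)) !scaler0 addr0.
  by rewrite hv_deg_idx; lia.
by lia.
Qed.

(** Letting the bound N depend on the vector makes the set stable under letters of negative degree
    too. *)
Lemma killed_from_submodule : submodule [set w : M | exists N, killed_from N w].
Proof.
apply: submoduleP => [|a w [N h]]; last by exists (N + `|hv_deg a|); exact: killed_from_op.
apply: graded_homP => [|w0 w1 h0 h1 [N h]].
  split=> [|c u v [N hu] [N' hv]]; first by exists 0; exact: (killed_from_subspace 0).1.
  exists (Num.max N N'); apply: (killed_from_subspace _).2.
    by apply: killed_from_mono hu; rewrite le_max lexx.
  by apply: killed_from_mono hv; rewrite le_max lexx orbT.
by split; exists N => a /h /(hv_op_split h0 h1) [].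
Qed.

End HVModules.

(** * From local finiteness to a killed vector *)

(* An enumeration of the basis vectors of degree > l: [3 q + r] stands for the
   [r]-th one among L, G, I of degree [l + 1 + q]. *)
Definition hv_letter (l k : nat) : hv_gen :=
  let d := (l.+1 + k %/ 3)%:Z in
  match (k %% 3)%N with 0 => genL d | 1 => genG d | _ => genI d end.

Lemma hv_deg_letter l k : hv_deg (hv_letter l k) = (l.+1 + k %/ 3)%:Z.
Proof. by rewrite /hv_letter; case: (k %% 3)%N => [|[|n]]. Qed.

Lemma hv_letter_ex l a : l%:Z < hv_deg a -> exists k, a = hv_letter l k.
Proof.
have E (n : int) : l%:Z < n -> exists q : nat, n = (l.+1 + q)%:Z.
  by move=> ln; exists `|n - l.+1%:Z|%N; lia.
case: a => n /= /E [q ->].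
- by exists (q * 3 + 0)%N; rewrite /hv_letter modnMDl divnMDl //= ?addn0.
- by exists (q * 3 + 1)%N; rewrite /hv_letter modnMDl divnMDl //= ?addn0.
- by exists (q * 3 + 2)%N; rewrite /hv_letter modnMDl divnMDl //= ?addn0.
Qed.

(** Each degree occupies three indices, so raising the degree by l shifts the enumeration by 3 l. *)
Lemma hv_idx_letter (l k : nat) : hv_idx (genL l) (hv_letter l k) = hv_letter l (k + 3 * l).
Proof.
rewrite /hv_letter [(k + _)%N]addnC mulnC modnMDl divnMDl //.
have -> : (l.+1 + (l + k %/ 3))%:Z = l%:Z + (l.+1 + k %/ 3)%:Z by lia.
by case: (k %% 3)%N => [|[|n]].
Qed.

(** The coefficient is d - l for L_d and d for G_d and I_d, and d > l >= 0. *)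
Lemma hv_coef_letter (K : numFieldType) (l k : nat) : hv_coef K (genL l) (hv_letter l k) != 0.
Proof.
rewrite /hv_letter; case: (k %% 3)%N => [|[|n]] /=; rewrite intr_eq0; lia.
Qed.

Section LocallyFiniteToKilled.
Context {K : numClosedFieldType} (M : smodule (hv K)).
Local Notation op := (@hv_op K M).

(** Within a residue class, D = L_l acts by D x_m = lam x_m + c_m x_(m+1) with c_m nonzero. So the
    x_m and the iterates of D on x_0 span each other, in a triangular way, and local finiteness of D
    at x_0 bounds the former. *)
Lemma letters_finite_class (l : nat) (lam : K) (v : M) j :
  orbit_bounded (op (genL l%:Z)) -> op (genL l%:Z) v = lam *: v ->
  exists n : nat, forall m, op (hv_letter l (j + m * (3 * l))) v \in
    lspan [set op (hv_letter l (j + p * (3 * l))) v | p in [set p | (p < n)%N]].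
Proof.
set D := op (genL l%:Z) => bD Dv.
pose x m := op (hv_letter l (j + m * (3 * l))) v.
have lD : linear D by exact: hv_op_linear.
have [c [c0 Dx]] : exists c : nat -> K, (forall m, c m != 0) /\
    forall m, D (x m) = lam *: x m + c m *: x m.+1.
  exists (fun m => hv_coef K (genL l) (hv_letter l (j + m * (3 * l)))); split.
    by move=> m; exact: hv_coef_letter.
  move=> m; rewrite /D /x hv_opC -/D Dv (linZ (hv_op_linear _)).
  have -> : koszul K (hv_odd (genL l)) (hv_odd (hv_letter l (j + m * (3 * l)))) = 1.
    by [].
  by rewrite scale1r hv_idx_letter (mulSnr m) addnA.
have [n hn] := orbit_finite (x 0%N) lD bD; exists n => m; rewrite -/(x m).
have it q : iter q D (x 0%N) \in lspan [set x p | p in [set p | (p <= q)%N]].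
  elim: q => [|q IH]; first by apply: lspan_mem; exists 0%N.
  rewrite iterS; move: IH; apply: (lspan_le (W := [set u | D u \in
      lspan [set x p | p in [set p | (p <= q.+1)%N]]])).
    exact: (subspace_preim lD (subspace_lspan _)).
  move=> _ [p /= pq <-]; rewrite Dx rpredD ?rpredZ //; apply: lspan_mem.
    by exists p => //=; apply: leqW.
  by exists p.+1.
have xm : x m \in lspan [set iter q D (x 0%N) | q in [set: nat]].
  elim: m => [|m IH]; first by apply: lspan_mem; exists 0%N.
  have -> : x m.+1 = (c m)^-1 *: (D (x m) - lam *: x m).
    by rewrite Dx addrC addKr scalerA mulVf ?scale1r.
  rewrite rpredZ // rpredB ?rpredZ //; apply: lspan_stable => // _ [q _ <-].
  by apply: lspan_mem; exists q.+1.
move: xm; apply: (lspan_le (subspace_lspan _)) => _ [q _ <-].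
move: (hn q); apply: (lspan_le (subspace_lspan _)) => _ [p /= pn <-].
move: (it p); apply: lspan_mono => _ [r /= rp <-]; exists r => //=.
exact: leq_ltn_trans pn.
Qed.

(** The indices fall into 3 l residue classes, each finitely spanned; N exceeds the indices needed
    in all of them. *)
Lemma letters_finite (l : nat) (lam : K) (v : M) : (0 < l)%N ->
  orbit_bounded (op (genL l%:Z)) -> op (genL l%:Z) v = lam *: v ->
  exists n : nat, forall j, op (hv_letter l j) v \in
    lspan [set op (hv_letter l i) v | i in [set i | (i < n)%N]].
Proof.
move=> l0 bD Dv.
have /choice [n hn] := fun j => letters_finite_class j bD Dv.
pose N := (\max_(j < 3 * l) (j + n j * (3 * l)))%N; exists N => i.
have lt : (i %% (3 * l) < 3 * l)%N by rewrite ltn_mod; lia.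
have := hn (i %% (3 * l))%N (i %/ (3 * l))%N; rewrite addnC -divn_eq.
apply: lspan_mono => _ [p /= pn <-]; exists (i %% (3 * l) + p * (3 * l))%N => //=.
apply: leq_trans (leq_bigmax (Ordinal lt)) => /=.
by rewrite ltn_add2l ltn_mul2r pn andbT; lia.
Qed.

(** * Relations between the L_m on a finite-dimensional stable space *)

Section Hull.
Context (l : nat) (t : seq M).
Local Notation E u := (u \in lspan [set x | x \in t]).
Hypothesis stE : forall m u, l%:Z < m -> E u -> E (op (genL m) u).

(** On the span of d vectors the L_m with m > l act through d by d matrices, so d ^ 2 + 1 of these
    matrices are linearly dependent. *)
Lemma L_relation : exists (S : seq int) (c : int -> K),
  [/\ S <> [::], uniq S, forall m, m \in S -> l%:Z < m /\ c m != 0 &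
    forall u, E u -> \sum_(m <- S) c m *: op (genL m) u = 0].
Proof.
pose d := size t.
have /choice [A hA] : forall m : nat, exists A : 'M[K]_d,
    forall i : 'I_d, op (genL (l.+1 + m)%:Z) t`_i = \sum_j A i j *: t`_j.
  move=> m; have /choice [a ha] : forall i : 'I_d, exists a : 'I_d -> K,
      op (genL (l.+1 + m)%:Z) t`_i = \sum_j a j *: t`_j.
    move=> i; apply: lspan_seqP; apply: stE; first by lia.
    by apply: lspan_mem; rewrite /= mem_nth.
  exists (\matrix_(i, j) a i j) => i; rewrite ha.
  by apply: eq_bigr => j _; rewrite mxE.
pose s : seq 'M[K]_d := [seq delta_mx p.1 p.2 | p <- enum {: 'I_d * 'I_d}].
have As m : A m \in lspan [set x | x \in s].
  rewrite (matrix_sum_delta (A m)); apply: rpred_sum => i _; apply: rpred_sum => j _.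
  rewrite rpredZ //; apply: lspan_mem => /=; apply/mapP; exists (i, j) => //.
  by rewrite mem_enum.
have [c [[i0 ci0] e]] := lspan_dependent As.
pose f (i : 'I_(size s).+1) : int := (l.+1 + i)%:Z.
have fI : injective f by move=> i j; rewrite /f => h; apply: ord_inj; lia.
(* [C] carries the coefficients over along the injection [f], with 0 outside its image. *)
pose C (m : int) : K := odflt 0 (omap c [pick i | f i == m]).
have CE i : C (f i) = c i.
  rewrite /C; case: pickP => [j /eqP /fI -> //|/(_ i)]; by rewrite eqxx.
exists [seq f i | i <- enum 'I_(size s).+1 & c i != 0], C; split.
- move=> h; have : f i0 \in [seq f i | i <- enum 'I_(size s).+1 & c i != 0].
    by apply: map_f; rewrite mem_filter ci0 mem_enum.
  by rewrite h.
- by rewrite map_inj_uniq // filter_uniq // enum_uniq.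
- move=> _ /mapP [j + ->].
  rewrite mem_filter => /andP[cj _]; rewrite CE; split=> //.
  by rewrite /f; lia.
move=> u; apply: (lspan_le (W := [set u | \sum_(m <- _) C m *: op (genL m) u = 0])).
  apply: (@subspace_ker _ _ _ (fun u => \sum_(m <- _) C m *: op (genL m) u)).
  move=> a x y; rewrite scaler_sumr -big_split /=; apply: eq_bigr => m _.
  by rewrite (hv_op_linear (genL m) a x y) scalerDr !scalerA mulrC.
move=> _ /= /(nthP 0) [k kd <-]; rewrite big_map big_filter big_enum_cond /=.
transitivity (\sum_i c i *: op (genL (l.+1 + i)%:Z) t`_k).
  rewrite big_mkcond /=; apply: eq_bigr => i _; rewrite CE.
  by case: eqP => [->|_]; rewrite ?scale0r.
under eq_bigr => i _ do rewrite (hA i (Ordinal kd)) scaler_sumr.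
rewrite exchange_big big1 // => j _ /=.
under eq_bigr => i _ do rewrite scalerA.
rewrite -scaler_suml; move/matrixP/(_ (Ordinal kd) j): e.
rewrite summxE mxE => e; rewrite (_ : \sum_i _ = 0) ?scale0r //.
by rewrite -[RHS]e; apply: eq_bigr => i _; rewrite mxE.
Qed.

(* Bracketing a relation with L_(m0) kills its m0-term and no other. *)
Lemma L_relation_single (S : seq int) (c : int -> K) :
  S <> [::] -> uniq S -> (forall m, m \in S -> l%:Z < m /\ c m != 0) ->
  (forall u, E u -> \sum_(m <- S) c m *: op (genL m) u = 0) ->
  exists m, l%:Z < m /\ forall u, E u -> op (genL m) u = 0.
Proof.
have [n] := ubnP (size S); elim: n => // n IH in S c *.
case: S => [//|m0 S]; rewrite ltnS /= => sz _ /andP[m0S uS] hS hE.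
have [lm0 cm0] := hS m0 (mem_head _ _).
have [S0|S0] := eqVneq S [::].
  exists m0; split=> // u /hE; rewrite S0 big_seq1 => /eqP.
  by rewrite scaler_eq0 (negbTE cm0) => /eqP.
(* The bracket of L_m0 with c_m L_m is c_m (m - m0) L_(m0+m), written here in terms of the new index
   m0 + m. *)
apply: (IH [seq m0 + m | m <- S] (fun m => c (m - m0) * (m - m0 - m0)%:~R)).
- by rewrite size_map.
- by case: (S) S0.
- by rewrite map_inj_uniq //; exact: addrI.
- move=> _ /mapP [m mS ->]; have [lm cm] := hS m (mem_behead (s := m0 :: S) mS).
  rewrite [m0 + m]addrC addrK; split; first by lia.
  rewrite mulf_neq0 // intr_eq0 subr_eq0.
  by apply: contraNneq m0S => <-.
move=> u Eu; rewrite big_map.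
have eq0 : \sum_(m <- m0 :: S) c m *: op (genL m) (op (genL m0) u) = 0.
  by apply: hE; apply: stE.
have eq1 : \sum_(m <- m0 :: S) c m *: op (genL m0) (op (genL m) u) = 0.
  transitivity (op (genL m0) (\sum_(m <- m0 :: S) c m *: op (genL m) u)).
    rewrite (lin_sum _ _ _ (hv_op_linear _)); apply: eq_bigr => m _.
    by rewrite (linZ (hv_op_linear _)).
  by rewrite hE // (lin0 (hv_op_linear _)).
have: \sum_(m <- m0 :: S) (c m *: op (genL m0) (op (genL m) u) -
    c m *: op (genL m) (op (genL m0) u)) = 0 by rewrite sumrB eq0 eq1 subrr.
rewrite big_cons subrr add0r => e; rewrite -[RHS]e; apply: eq_bigr => m _.
rewrite hv_opLL [m0 + m]addrC /= !addrK scalerDr scalerA.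
by rewrite [X in _ = X - _]addrC addrK.
Qed.

(** If L_m = 0 on E, then [L_(n-m), L_m] = (2 m - n) L_n gives L_n = 0 for n > 2 m. The brackets of
    L_(n-l-1) with G_(l+1) and I_(l+1) then give (l + 1) G_n = 0 and (l + 1) I_n = 0 for large n. *)
Lemma hull_killed : (forall a u, l%:Z < hv_deg a -> E u -> E (op a u)) ->
  exists N, forall u, E u -> killed_from N u.
Proof.
move=> stE'; have [S [c [S0 uS hS hE]]] := L_relation.
have [m [lm hm]] := L_relation_single S0 uS hS hE.
have hL n u : m + m < n -> E u -> op (genL n) u = 0.
  move=> mn Eu; have := hv_opLL (n - m) m u.
  rewrite !hm //; last by apply: stE => //; lia.
  rewrite (lin0 (hv_op_linear _)) add0r subrK => /esym/eqP.
  by rewrite scaler_eq0 intr_eq0 => /orP[|/eqP //]; lia.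
(* The bound ensures n - (l + 1) > 2 m. *)
exists (m + m + 2 + l%:Z) => u Eu [] n /= ln; first by apply: hL => //; lia.
  have := hv_opLG (n - l.+1%:Z) l.+1%:Z u; rewrite !hL //; try lia; last first.
    by apply: stE' => //=; lia.
  rewrite (lin0 (hv_op_linear _)) add0r subrK => /esym/eqP.
  by rewrite scaler_eq0 intr_eq0 => /orP[|/eqP //]; lia.
have := hv_opLI (n - l.+1%:Z) l.+1%:Z u; rewrite !hL //; try lia; last first.
  by apply: stE' => //=; lia.
rewrite (lin0 (hv_op_linear _)) add0r subrK => /esym/eqP.
by rewrite scaler_eq0 intr_eq0 => /orP[|/eqP //]; lia.
Qed.

End Hull.

Lemma locally_finite_killed (z : nat) (u : M) : u <> 0 ->
  (forall a, z%:Z <= hv_deg a -> orbit_bounded (op a)) ->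
  exists N (v : M), v <> 0 /\ killed_from N v.
Proof.
(* The successor makes l positive, as the splitting into classes modulo 3 l requires. *)
move=> u0 bz; pose l := z.+1.
have bl : orbit_bounded (op (genL l%:Z)) by apply: bz => /=; lia.
have [lam [v [v0 Dv]]] := eigenvector_ex (hv_op_linear _) bl u0.
have [n hn] := letters_finite (ltn0Sn z) bl Dv.
pose X k := op (hv_letter l k).
have [||||t [vt stt]] := @locally_finite_hull K M X _ _ n v.
- by move=> i; exact: hv_op_linear.
- by move=> i; apply: bz; rewrite hv_deg_letter; lia.
- move=> i j; exists (koszul K (hv_odd (hv_letter l i)) (hv_odd (hv_letter l j))).
  exists (hv_coef K (hv_letter l i) (hv_letter l j)).
  have [|k hk] := @hv_letter_ex l (hv_idx (hv_letter l i) (hv_letter l j)).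
    by rewrite hv_deg_idx !hv_deg_letter; lia.
  by exists k => w; rewrite /X hv_opC hk.
- exact: hn.
have st a w : l%:Z < hv_deg a -> w \in lspan [set x | x \in t] ->
    op a w \in lspan [set x | x \in t].
  by move=> /hv_letter_ex [k ->]; exact: stt.
have [|N hN] := @hull_killed l t _ st; first by move=> m w lm; apply: st.
by exists N, v; split=> //; apply: hN.
Qed.

End LocallyFiniteToKilled.

(** * Nilpotency of words of positive degree *)

Section Nilpotency.
Context {K : numFieldType} (M : smodule (hv K)).
Local Notation op := (@hv_op K M).
Implicit Types (a b : hv_gen) (u v w : M) (N : int).

(** The recursion strips the rightmost letter of a word, the first to act. *)
Fixpoint words_kill N (p : nat) w : Prop :=
  if p is q.+1 then forall a, N <= hv_deg a -> words_kill N q (op a w) else w = 0.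

Lemma words_kill_subspace N p : subspace [set w | words_kill N p w].
Proof.
elim: p => [|p IH] /=; first by split=> // a u v /= -> ->; rewrite scaler0 addr0.
apply: (@subspace_forall _ _ _ _ (fun a => [set w | words_kill N p (op a w)])) => a _.
exact: (subspace_preim (hv_op_linear a) IH).
Qed.

Lemma words_killS N p w : words_kill N p w -> words_kill N p.+1 w.
Proof.
elim: p w => [|p IH] w; last by move=> h a la; apply: IH; apply: h.
by move=> -> a _ /=; rewrite (lin0 (hv_op_linear a)).
Qed.

Lemma words_kill_mono N p q w : (p <= q)%N -> words_kill N p w -> words_kill N q w.
Proof. by move=> /subnKC <-; elim: (q - p)%N => [|n IH] /=; rewrite ?addn0 ?addnS // => /IH /words_killS. Qed.

Lemma words_kill_split N p i w0 w1 : ss_hom i w0 -> ss_hom (~~ i) w1 ->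
  words_kill N p (w0 + w1) -> words_kill N p w0 /\ words_kill N p w1.
Proof.
elim: p i w0 w1 => [|p IH] i w0 w1 h0 h1 /=; first exact: hom_sum_eq0 h0 h1.
move=> h; have IH' a : N <= hv_deg a ->
    words_kill N p (op a w0) /\ words_kill N p (op a w1).
  move=> /h; rewrite (linD (hv_op_linear a)).
  by apply: (IH (hv_odd a (+) i)); rewrite -?addbN; exact: hv_op_hom.
by split=> a /IH' [].
Qed.

(* A letter of degree at least N is itself absorbed in the word; a commutator
   with a word letter raises the degree, which allows an induction on the
   defect q of the degree. *)
Lemma words_kill_op N (q p : nat) : 0 < N -> exists n, forall a w,
  N - q%:Z <= hv_deg a -> words_kill N p w -> words_kill N n (op a w).
Proof.
move=> N0; elim: q p => [|q IHq] p.
  by exists p => a w; rewrite subr0 => la /words_killS; apply.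
elim: p => [|p [n2 IHp]].
  by exists 0%N => a w _ /= ->; exact: lin0 (hv_op_linear a).
(* [n2] serves the term a (b w), where b w is killed by words of length p. [n1] serves the
   commutator, whose degree is at least N + N - (q + 1), hence at least N - q as N > 0. *)
have [n1 h1] := IHq p.+1; exists (maxn n1 n2).+1 => a w la hw b lb.
rewrite hv_opC; apply: (words_kill_subspace _ _).2.
  by apply: words_kill_mono (leq_maxr _ _) _; apply: IHp => //; apply: hw.
apply: (subspaceZ _ (words_kill_subspace _ _)).
apply: words_kill_mono (leq_maxl _ _) _; apply: h1 => //.
by rewrite hv_deg_idx; lia.
Qed.

Lemma words_kill_submodule N : 0 < N -> submodule [set w : M | exists p, words_kill N p w].
Proof.
move=> N0; apply: submoduleP => [|a w [p h]].
  apply: graded_homP => [|w0 w1 h0 h1 [p h]]; last first.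
    by have [k0 k1] := words_kill_split (i := false) h0 h1 h; split; exists p.
  split=> [|c u v [p hu] [q hv]]; first by exists 0%N.
  exists (maxn p q); apply: (words_kill_subspace _ _).2.
    exact: words_kill_mono (leq_maxl _ _) hu.
  exact: words_kill_mono (leq_maxr _ _) hv.
have [n hn] := words_kill_op `|N - hv_deg a|%N p N0.
by exists n; apply: hn => //; lia.
Qed.

Lemma simple_words_kill N v : simple_module M -> 0 < N -> v <> 0 -> killed_from N v ->
  forall w, exists p, words_kill N p w.
Proof.
move=> sM N0 v0 kv; apply: (simple_full sM (words_kill_submodule N0) _ v0).
by exists 1%N.
Qed.

Lemma simple_killed_from N v : simple_module M -> v <> 0 -> killed_from N v ->
  forall w : M, exists N', killed_from N' w.
Proof.
move=> sM v0 kv; apply: (simple_full sM (killed_from_submodule M) _ v0).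
by exists N.
Qed.

Lemma hv_truncE (n : nat) : hv_trunc n n n = basis_span [pred a | n%:Z <= hv_deg a] :> set (hv K).
Proof. by rewrite /hv_trunc; congr basis_span; apply/funext => -[]. Qed.

Lemma words_kill_foldr (n p : nat) w (s : seq (hv K)) :
  words_kill n%:Z p w -> size s = p -> (forall x, x \in s -> hv_trunc n n n x) ->
  foldr (act M) w s = 0.
Proof.
elim: p w s => [|p IH] w s; first by move=> /= -> /size0nil ->.
case/lastP: s => // s x hw; rewrite size_rcons foldr_rcons => -[sz] hs.
apply: IH => //; last by move=> y ys; apply: hs; rewrite mem_rcons inE ys orbT.
apply: (@act_basis_span _ _ [pred a | n%:Z <= hv_deg a] [set w | words_kill n%:Z p w]).
- exact: words_kill_subspace.
- by move=> a /hw.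
- by rewrite -hv_truncE; apply: hs; rewrite mem_rcons mem_head.
Qed.

Lemma words_kill_locally_nilpotent (n : nat) : (forall w, exists p, words_kill n%:Z p w) ->
  locally_nilpotent M (hv_trunc n n n).
Proof.
move=> h w; have [p hp] := h w; exists p => u.
apply: (lspan_le (W := [set u | u = 0])); first by split=> // a x y -> ->; rewrite scaler0 addr0.
by move=> _ [s [sz hs ->]]; exact: (words_kill_foldr hp sz hs).
Qed.

(** Letters of positive degree preserve [killed_from N], so at each stage only those of degree below
    N matter, and there are finitely many of them. The list is therefore built together with the
    property that its members are killed from N on. *)
Lemma words_finite (l p : nat) N w : killed_from N w ->
  exists t : seq M, forall s : seq (hv K), (size s <= p)%N ->
    (forall x, x \in s -> hv_trunc l.+1 l.+1 l.+1 x) ->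
    foldr (act M) w s \in lspan [set x | x \in t].
Proof.
move=> kw; suff [t [_ ht]] : exists t : seq M, (forall y, y \in t -> killed_from N y) /\
    forall s : seq (hv K), (size s <= p)%N ->
    (forall x, x \in s -> hv_trunc l.+1 l.+1 l.+1 x) ->
    foldr (act M) w s \in lspan [set x | x \in t] by exists t.
elim: p => [|p [t [kt ht]]].
  exists [:: w]; split=> [y|s]; first by rewrite inE => /eqP ->.
  by rewrite leqn0 => /nilP -> _; apply: lspan_mem; rewrite /= mem_head.
(* The letter of index k has degree l + 1 + k / 3, which exceeds N once k >= 3 |N|. *)
pose n := (3 * `|N|)%N.
exists (t ++ [seq op (hv_letter l k) y | y <- t, k <- iota 0 n]); split=> [y|s].
  rewrite mem_cat => /orP[/kt //|/allpairsP [[u k] /= [ut _ ->]]].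
  by apply: killed_from_op_ge0; [rewrite hv_deg_letter|exact: kt].
case: s => [_ _|x s]; first by apply: lspan_cat; left; apply: (ht [::]).
rewrite ltnS /= => sz hs; have := ht s sz (fun y ys => hs y (mem_behead (s := x :: s) ys)).
move: (foldr _ _ _) => u ut.
apply: (@act_basis_span _ _ [pred a | l.+1%:Z <= hv_deg a]
  [set v | v \in lspan [set x | x \in _]]); first exact: subspace_lspan.
  move=> a /= la; have [k ka] : exists k, a = hv_letter l k by apply: hv_letter_ex; lia.
  rewrite ka; move: ut; apply: (lspan_le (W := [set u | op (hv_letter l k) u \in _])).
    exact: (subspace_preim (hv_op_linear _) (subspace_lspan _)).
  move=> y /= yt; have [kn|nk] := ltnP k n.
    apply: lspan_cat; right; apply: lspan_mem => /=.
    by apply/allpairsP; exists (y, k); rewrite mem_iota.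
  rewrite (kt y yt) ?rpred0 // hv_deg_letter.
  have : (`|N| <= k %/ 3)%N by rewrite leq_divRL // mulnC.
  by lia.
by rewrite -hv_truncE; apply: hs; rewrite mem_head.
Qed.

(** Words longer than p vanish on w, and those of length at most p stay in a finite span. *)
Lemma words_kill_locally_finite (l : nat) :
  (forall w, exists p, words_kill l.+1%:Z p w) -> (forall w : M, exists N, killed_from N w) ->
  locally_finite M (hv_trunc l.+1 l.+1 l.+1).
Proof.
move=> hp hN w; have [p wp] := hp w; have [N wN] := hN w.
have [t ht] := words_finite l p wN.
have [|s hs] := @subspace_finite _ _ _ t
  (subspace_lspan [set u | exists n, u \in pow_act (hv_trunc l.+1 l.+1 l.+1) n w]).
  move=> v; apply: (lspan_le (subspace_lspan _)) => u [n].
  apply: (lspan_le (subspace_lspan _)) => _ [s [sz hs ->]] /=.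
  have [np|pn] := leqP n p; first by apply: ht => //; rewrite sz.
  by rewrite (words_kill_foldr (words_kill_mono (ltnW pn) wp) sz hs) rpred0.
by exists s => v; apply/idP/idP => /hs.
Qed.

(** The sum r + s + t dominates the three thresholds, and a power of one letter is a particular
    word. *)
Lemma locally_nilpotent_elt_trunc r s t a : locally_nilpotent M (hv_trunc r s t) ->
  (r + s + t)%:Z <= hv_deg a ->
  locally_nilpotent_elt M (<< a >> : {malg K[hv_gen]}).
Proof.
move=> h la v; have [n hn] := h v; exists n; apply: hn; apply: lspan_mem.
exists (nseq n (<< a >> : {malg K[hv_gen]})); split; first by rewrite size_nseq.
  move=> x; rewrite mem_nseq => /andP[_ /eqP ->]; apply: basis_spanU.
  by case: a la => m /=; lia.
by elim: (n) => //= m ->.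
Qed.

Lemma locally_finite_trunc_bounded r s t a : locally_finite M (hv_trunc r s t) ->
  (r + s + t)%:Z <= hv_deg a -> orbit_bounded (op a).
Proof.
move=> h la v; have [u hu] := h v; exists u => n; rewrite -hu; apply: lspan_mem; exists n.
apply: lspan_mem.
exists (nseq n (<< a >> : {malg K[hv_gen]})); split; first by rewrite size_nseq.
  move=> x; rewrite mem_nseq => /andP[_ /eqP ->]; apply: basis_spanU.
  by case: a la => m /=; lia.
by elim: n => //= n ->.
Qed.

Lemma locally_nilpotent_elt_finite (x : hv K) :
  locally_nilpotent_elt M x -> locally_finite_elt M x.
Proof.
move=> h v; have [n hn] := h v.
have lx : linear (act M x) by exact: act_linearr.
exists [seq iter q (act M x) v | q <- iota 0 n] => w; apply/idP/idP.
  apply: (lspan_le (subspace_lspan _)) => _ [q _ <-].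
  have [qn|nq] := ltnP q n.
    by apply: lspan_mem; apply: map_f; rewrite mem_iota.
  by rewrite -(subnK nq) iterD hn (lin0 (iter_linear _ lx)) /= rpred0.
by apply: lspan_mono => u /= /mapP [q _ ->]; exists q.
Qed.

Lemma locally_finite_elt_bounded a :
  locally_finite_elt M (<< a >> : {malg K[hv_gen]}) -> orbit_bounded (op a).
Proof.
by move=> h v; have [s hs] := h v; exists s => p; rewrite -hs; apply: lspan_mem; exists p.
Qed.

End Nilpotency.

(** * The generating subspace of an induced module *)

Section InducedModule.
Context {K : numFieldType} {g : lie_superalgebra K} (h : subalgebra g).
Context (V : smodule (sub_lsa h)).

Lemma act_tens1 (x : sub_lsa h) (v : V) :
  act (Ind V) (sub_val x) (tens 1 v) = tens 1 (act V x v).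
Proof.
have [_ _ _ iin] := env_incl_morphism h.
rewrite [LHS]ind_mul_tens mulr1 -iin -[env_incl _]mul1r tens_balanced.
by rewrite env_act_in.
Qed.

(** As u ⊗ v = u (1 ⊗ v), the whole module would vanish with 1 ⊗ V. *)
Lemma Ind_tens1_neq0 (q : Ind V) : q <> 0 -> exists v : V, tens 1 v <> 0 :> Ind V.
Proof.
move=> q0; apply: contrapT => nv; apply: q0.
move: q; apply: (@ind_ind _ _ h V [set q | q = 0]).
  by split=> // a u v -> ->; rewrite scaler0 addr0.
move=> u v; have v0 : tens 1 v = 0 :> Ind V.
  by apply: contrapT => v0; apply: nv; exists v.
by rewrite /= -[u]mulr1 -ind_mul_tens v0 (lin0 (ind_mul_linearr _)).
Qed.

End InducedModule.

Lemma isomorphic_killed_from (K : numFieldType) (P Q : smodule (hv K)) N (q : Q) :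
  isomorphic P Q -> q <> 0 -> killed_from N q -> exists p : P, p <> 0 /\ killed_from N p.
Proof.
move=> [f [lf [f' fK f'K] _ fact]] q0 kq; exists (f' q); split.
  by move=> e; apply: q0; rewrite -[q]f'K e (lin0 lf).
move=> a la; apply: (can_inj fK); rewrite fact f'K (lin0 lf); exact: kq.
Qed.

(** * Vectors annihilated by the top letters *)

(* The Weyl algebra argument: if [D, Y] = k C with D = 0 on U, then D
   differentiates the polynomials in Y with coefficients in U. *)
Section Heisenberg.
Context {K : numFieldType} {V : lmodType K} (U : set V) (D Y C : V -> V) (k : K).
Hypotheses (lD : linear D) (lY : linear Y) (sU : subspace U).
Hypotheses (D0 : forall u, U u -> D u = 0) (CU : forall u, U u -> U (C u)).
Hypotheses (CI : forall u, U u -> C u = 0 -> u = 0) (k0 : k != 0).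
Hypotheses (DY : forall w, D (Y w) = Y (D w) + k *: C w).
Hypotheses (CY : forall w, C (Y w) = Y (C w)).

(** D acts as k C d/dY. *)
Lemma heisenberg_derive p u : U u ->
  D (iter p.+1 Y u) = (p.+1%:R * k) *: iter p Y (C u).
Proof.
elim: p u => [|p IH] u Uu; first by rewrite /= DY D0 // (lin0 lY) add0r mul1r.
rewrite iterS DY IH // (linZ lY) -iterS.
have -> : C (iter p.+1 Y u) = iter p.+1 Y (C u) by elim: p.+1 => //= n <-.
by rewrite -scalerDl; congr (_ *: _); rewrite -[p.+2]addn1 natrD mulrDl mul1r.
Qed.

Lemma heisenberg_vanish p q u : U u -> (p < q)%N -> iter q D (iter p Y u) = 0.
Proof.
elim: q p u => // q IH [|p] u Uu pq; rewrite iterSr.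
  by rewrite D0 // (lin0 (iter_linear q lD)).
by rewrite heisenberg_derive // (linZ (iter_linear q lD)) IH ?scaler0 //; exact: CU.
Qed.

(** The constant is p! k^p, nonzero in characteristic 0. *)
Lemma heisenberg_top p u : U u ->
  exists c, c != 0 /\ iter p D (iter p Y u) = c *: iter p C u.
Proof.
elim: p u => [|p IH] u Uu; first by exists 1; rewrite oner_eq0 scale1r.
have [c [c0 e]] := IH _ (CU Uu); exists ((p.+1%:R * k) * c); split.
  by rewrite !mulf_neq0 // pnatr_eq0.
by rewrite iterSr heisenberg_derive // (linZ (iter_linear p lD)) e scalerA -iterSr.
Qed.

Lemma iter_injective_on p u : U u -> iter p C u = 0 -> u = 0.
Proof. by elim: p u => [|p IH] u Uu //; rewrite iterSr => /(IH _ (CU Uu)) /(CI Uu). Qed.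

Lemma iter_stable_on p u : U u -> U (iter p C u).
Proof. by move=> Uu; elim: p => //= p; exact: CU. Qed.

Definition poly_in : set V := [set w | exists n (u : nat -> V),
  (forall p, U (u p)) /\ w = \sum_(p < n) iter p Y (u p)].

Lemma poly_in_subspace : subspace poly_in.
Proof.
split=> [|a _ _ [m [u [Uu ->]]] [n [v [Uv ->]]]].
  by exists 0%N, (fun=> 0); split=> [_|]; [exact: sU.1|rewrite big_ord0].
(* Both polynomials are padded with zero coefficients to the common length m + n. *)
pose cut m (u : nat -> V) p := if (p < m)%N then u p else 0.
have cutE l (x : nat -> V) : (l <= m + n)%N ->
    \sum_(p < l) iter p Y (x p) = \sum_(p < m + n) iter p Y (cut l x p).
  move=> le; rewrite (big_ord_widen _ (fun p => iter p Y (x p)) le) big_mkcond /=.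
  apply: eq_bigr => p _; rewrite /cut; case: ifP => // _.
  by rewrite (lin0 (iter_linear p lY)).
exists (m + n)%N, (fun p => a *: cut m u p + cut n v p); split.
  by move=> p; apply: sU.2; rewrite /cut; case: ifP => // _; exact: sU.1.
rewrite (cutE m u) ?leq_addr // (cutE n v) ?leq_addl // scaler_sumr -big_split /=.
by apply: eq_bigr => p _; rewrite (iter_linear p lY).
Qed.

Lemma poly_in_sub u : U u -> poly_in u.
Proof. by move=> Uu; exists 1%N, (fun=> u); rewrite big_ord1. Qed.

Lemma poly_in_mulY w : poly_in w -> poly_in (Y w).
Proof.
move=> [n [u [Uu ->]]]; exists n.+1, (fun p => if p is q.+1 then u q else 0); split.
  by case=> // ; exact: sU.1.
rewrite (lin_sum _ _ _ lY) big_ord_recl /= add0r.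
by apply: eq_bigr.
Qed.

Lemma poly_in_stable f w : linear f -> (forall w, f (Y w) = Y (f w)) ->
  (forall u, U u -> U (f u)) -> poly_in w -> poly_in (f w).
Proof.
move=> lf fY fU [n [u [Uu ->]]]; exists n, (fun p => f (u p)); split.
  by move=> p; apply: fU.
rewrite (lin_sum _ _ _ lf); apply: eq_bigr => p _.
by elim: (p : nat) (u p) => //= q IH x; rewrite fY IH.
Qed.

(** If Y^p u_p is the leading term, D^p kills the lower ones and turns it into a nonzero multiple of
    C^p u_p, which is nonzero since C is injective on U. *)
Lemma poly_in_reach w : poly_in w ->
  U w \/ exists q, U (iter q.+1 D w) /\ iter q.+1 D w <> 0.
Proof.
move=> [n [u [Uu ->]]]; elim: n => [|[|n] IH].
- by left; rewrite big_ord0; exact: sU.1.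
- by left; rewrite big_ord1; exact: Uu.
have [un0|un0] := pselect (u n.+1 = 0).
  have e : iter n.+1 Y (u n.+1) = 0 by rewrite un0 (lin0 (iter_linear n.+1 lY)).
  suff -> : \sum_(p < n.+2) iter p Y (u p) = \sum_(p < n.+1) iter p Y (u p) by [].
  by rewrite big_ord_recr -[RHS]addr0; congr (_ + _); exact: e.
right; exists n; rewrite big_ord_recr (linD (iter_linear _ lD)).
rewrite (lin_sum _ _ _ (iter_linear _ lD)) big1 ?add0r; last first.
  by move=> p _; apply: heisenberg_vanish; [exact: Uu|exact: (ltn_ord p)].
have [c [c0 ->]] := heisenberg_top n.+1 (Uu n.+1); split.
  by apply: subspaceZ => //; apply: iter_stable_on.
move=> /eqP; rewrite scaler_eq0 (negbTE c0) => /eqP /(iter_injective_on (Uu _)).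
exact: un0.
Qed.

End Heisenberg.

(** * Generation by words, and words leading back to a subspace *)

Section Generated.
Context {K : numFieldType} (M : smodule (hv K)).
Local Notation op := (@hv_op K M).
Implicit Types (a b : hv_gen) (u v w : M) (D : pred hv_gen) (U V W : set M).

Definition generated D V : set M :=
  [set w | w \in lspan [set u | exists s v, [/\ all D s, V v & u = foldr op v s]]].

Lemma generated_subspace D V : subspace (generated D V).
Proof. exact: subspace_lspan. Qed.

Lemma generated_sub D V v : V v -> generated D V v.
Proof. by move=> Vv; apply: lspan_mem; exists [::], v. Qed.

Lemma generated_op D V a w : D a -> generated D V w -> generated D V (op a w).
Proof.
move=> Da; apply: lspan_stable; first exact: hv_op_linear.
by move=> _ [s [v [Ds Vv ->]]]; apply: lspan_mem; exists (a :: s), v; rewrite /= Da.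
Qed.

Lemma generated_ind D V W : subspace W -> V `<=` W ->
  (forall a w, D a -> W w -> W (op a w)) -> generated D V `<=` W.
Proof.
move=> sW VW stW w; apply: (lspan_le sW) => _ [s [v [Ds Vv ->]]].
elim: s Ds => [|a s IH] /=; first by move=> _; apply: VW.
by case/andP=> Da /IH; apply: stW.
Qed.

Lemma generated_mono D D' V w : (forall a, D a -> D' a) ->
  generated D V w -> generated D' V w.
Proof.
move=> DD'; move: w; apply: generated_ind; first exact: generated_subspace.
  exact: generated_sub.
by move=> a w /DD'; exact: generated_op.
Qed.

(** Since the word is nonempty, only the first alternative remains for a vector killed by all
    letters of [T]. *)
Definition reaches (T : pred hv_gen) U w := U w \/
  exists s, [/\ s <> [::], all T s, U (foldr op w s) & foldr op w s <> 0].

(** Concatenating words allows the letters outside S_{alpha,beta} to be removed in stages. *)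
Lemma reaches_trans T U V w : (forall u, U u -> reaches T V u) ->
  reaches T U w -> reaches T V w.
Proof.
move=> UV [/UV //|[s [s0 Ts Us ns]]]; right.
have [Vs|[s' [s'0 Ts' Vs' ns']]] := UV _ Us; first by exists s.
exists (s' ++ s); rewrite all_cat Ts Ts' foldr_cat; split=> //.
by case: s' s'0 {Ts' Vs' ns'}.
Qed.

Lemma foldr_nseq_op a w n : foldr op w (nseq n a) = iter n (op a) w.
Proof. by elim: n => //= n ->. Qed.

End Generated.

(** * Removing the I- and G-letters of low degree *)

Section Towers.
Context {K : numFieldType} (M : smodule (hv K)) (alpha beta z : nat).
Hypothesis le_ab : (2 * beta <= alpha)%N.
Local Notation op := (@hv_op K M).

(* The letters of S_{alpha,beta} annihilating V in condition (5). *)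
Definition hv_top (a : hv_gen) : bool :=
  match a with
  | genL i => (z + alpha)%:Z < i | genG i => (z + beta)%:Z < i | genI i => z%:Z < i
  end.

Lemma hv_top_ab a : hv_top a -> hv_ab_gen alpha beta a.
Proof. by case: a => i /=; lia. Qed.

Context (V : set M).
Hypothesis sV : subspace V.
Hypothesis V_ab : forall a v, hv_ab_gen alpha beta a -> V v -> V (op a v).
Hypothesis V_top : forall a v, hv_top a -> V v -> op a v = 0.
Hypothesis V_inj : forall v, V v -> op (genI z) v = 0 -> v = 0.

Local Notation reach := (reaches hv_top).
Local Notation gen D := (generated D V).

Definition I_killed : set M := [set w | forall l, z%:Z < l -> op (genI l) w = 0].

Lemma I_killed_subspace : subspace I_killed.
Proof.
apply: (@subspace_forall _ _ _ _ (fun l => [set w | op (genI l) w = 0])) => l _.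
exact: subspace_ker (hv_op_linear _).
Qed.

Lemma I_killed_V : V `<=` I_killed.
Proof. by move=> v Vv l lz; apply: V_top. Qed.

Lemma I_killed_I m w : I_killed w -> I_killed (op (genI m) w).
Proof. by move=> h l lz; rewrite hv_opII h // (lin0 (hv_op_linear _)). Qed.

Lemma I_killed_G m w : I_killed w -> I_killed (op (genG m) w).
Proof. by move=> h l lz; rewrite hv_opIG h // (lin0 (hv_op_linear _)). Qed.

Lemma hv_opIL m n w : op (genI m) (op (genL n) w) =
  op (genL n) (op (genI m) w) - m%:~R *: op (genI (m + n)) w.
Proof. by rewrite hv_opLI [n + m]addrC addrK. Qed.

Lemma I_killed_L m w : 0 <= m -> I_killed w -> I_killed (op (genL m) w).
Proof.
move=> m0 h l lz; rewrite hv_opIL !h //; last by lia.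
by rewrite (lin0 (hv_op_linear _)) scaler0 subr0.
Qed.

(** Only L_m fails to commute with I_z, and the bracket is a multiple of I_(z+m), which kills w
    because m > 0. *)
Lemma I_killed_top a w : hv_top a -> I_killed w ->
  I_killed (op a w) /\ op (genI z) (op a w) = op a (op (genI z) w).
Proof.
case: a => m /= am kw; split.
- by apply: I_killed_L => //; lia.
- by rewrite hv_opIL (kw (z%:Z + m)) ?scaler0 ?subr0 //; lia.
- exact: I_killed_G.
- exact: hv_opIG.
- exact: I_killed_I.
- exact: hv_opII.
Qed.

(** The word carrying w into V commutes with I_z, so I_z w = 0 would make I_z kill a nonzero vector
    of V. *)
Lemma reach_inj w : I_killed w -> reach V w -> op (genI z) w = 0 -> w = 0.
Proof.
move=> kw [/V_inj //|[s [_ Ts Vs ns]]] e; case: ns; apply: V_inj => //.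
suff [_ ->] : I_killed (foldr op w s) /\
    op (genI z) (foldr op w s) = foldr op (op (genI z) w) s.
  by rewrite e; elim: (s) => //= a r ->; exact: (lin0 (hv_op_linear a)).
elim: s Ts {Vs} => //= a s IH /andP[Ta /IH [ks es]].
by have [? ->] := I_killed_top Ta ks; rewrite es.
Qed.

Definition I_from (n : nat) : pred hv_gen := fun a =>
  if a is genI m then - (alpha + n)%:Z <= m else false.
Definition G_from (n : nat) : pred hv_gen := fun a =>
  match a with genI _ => true | genG m => - (beta + n)%:Z <= m | genL _ => false end.
Definition I_all : pred hv_gen := fun a => if a is genI _ then true else false.
Definition GI_all : pred hv_gen := fun a => if a is genL _ then false else true.

Lemma I_killed_GI (D : pred hv_gen) : (forall a, D a -> GI_all a) -> gen D `<=` I_killed.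
Proof.
move=> DG; apply: generated_ind; first exact: I_killed_subspace.
  exact: I_killed_V.
by case=> m w /DG // _; [exact: I_killed_G|exact: I_killed_I].
Qed.

(** L_m kills V, and its bracket with a letter I_i of stage n is a multiple of I_(m+i), where m + i
    > z. [I_killed] is carried along so that this term vanishes. *)
Lemma L_kills_I_from n m w : (z + alpha + n)%:Z < m -> gen (I_from n) w ->
  op (genL m) w = 0.
Proof.
move=> mz; move: w; suff h : gen (I_from n) `<=` [set w | I_killed w /\ op (genL m) w = 0].
  by move=> w /h [].
apply: generated_ind.
- split=> [|c u v [ku hu] [kv hv]] /=.
    by split; [exact: I_killed_subspace.1|rewrite (lin0 (hv_op_linear _))].
  split; first exact: I_killed_subspace.2.
  by rewrite hv_op_linear hu hv scaler0 addr0.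
- by move=> v Vv; split; [exact: I_killed_V|apply: V_top => //=; lia].
case=> // i w /= hi [kw hw]; split; first exact: I_killed_I.
by rewrite hv_opLI hw kw ?(lin0 (hv_op_linear _)) ?scaler0 ?addr0 //; lia.
Qed.

Lemma G_kills_G_from n m w : (z + beta + n)%:Z < m -> gen (G_from n) w ->
  op (genG m) w = 0.
Proof.
move=> mz; move: w; suff h : gen (G_from n) `<=` [set w | I_killed w /\ op (genG m) w = 0].
  by move=> w /h [].
apply: generated_ind.
- split=> [|c u v [ku hu] [kv hv]] /=.
    by split; [exact: I_killed_subspace.1|rewrite (lin0 (hv_op_linear _))].
  split; first exact: I_killed_subspace.2.
  by rewrite hv_op_linear hu hv scaler0 addr0.
- by move=> v Vv; split; [exact: I_killed_V|apply: V_top => //=; lia].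
case=> // i w /= hi [kw hw]; split.
- exact: I_killed_G.
- by rewrite hv_opGG hw kw ?(lin0 (hv_op_linear _)) ?oppr0 ?scaler0 ?addr0 //; lia.
- exact: I_killed_I.
- by rewrite -hv_opIG hw (lin0 (hv_op_linear _)).
Qed.

(** Stage n + 1 consists of the polynomials in y = I_(-(alpha+n+1)) over stage n. The letter x =
    L_(z+alpha+n+1) kills stage n, and [x, y] is a nonzero multiple of I_z, injective there by
    induction: the Weyl algebra argument applies. *)
Lemma I_from_reach n w : gen (I_from n) w -> reach V w.
Proof.
elim: n w => [|n IH] w.
  move=> hw; left; move: w hw; apply: generated_ind => //.
  by case=> // m w /= hm; apply: V_ab => /=; lia.
set y := genI (- (alpha + n.+1)%:Z); set x := genL (z + alpha + n.+1)%:Z.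
pose U := gen (I_from n); pose k : K := (- (alpha + n.+1)%:Z)%:~R.
have k0 : k != 0 by rewrite intr_eq0; lia.
have sU : subspace U by exact: generated_subspace.
have D0 u : U u -> op x u = 0 by apply: L_kills_I_from; lia.
have CU u : U u -> U (op (genI z) u) by apply: generated_op => /=; lia.
have CI u : U u -> op (genI z) u = 0 -> u = 0.
  move=> Uu; apply: reach_inj; last exact: IH.
  by apply: I_killed_GI Uu; case.
have DY u : op x (op y u) = op y (op x u) + k *: op (genI z) u.
  by rewrite hv_opLI; congr (_ + _ *: op (genI _) u); lia.
have CY u : op (genI z) (op y u) = op y (op (genI z) u) by exact: hv_opII.
move=> hw; apply: (@reaches_trans _ _ _ U); first exact: IH.
have /(poly_in_reach (hv_op_linear _) (hv_op_linear _) sU D0 CU CI k0 DY CY)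
    : poly_in U (op y) w.
  move: w hw; apply: generated_ind.
  - exact: poly_in_subspace (hv_op_linear _) sU.
  - by move=> v Vv; apply: poly_in_sub; exact: generated_sub.
  case=> // m w /= hm; have [-> |mn] := eqVneq m (- (alpha + n.+1)%:Z).
    exact: (@poly_in_mulY _ _ U (op y) (hv_op_linear y) sU).
  apply: poly_in_stable; first exact: hv_op_linear.
    by move=> u; exact: hv_opII.
  by move=> u; apply: generated_op => /=; lia.
case=> [Uw|[q [Uq nq]]]; first by left.
right; exists (nseq q.+1 x); rewrite foldr_nseq_op all_nseq; split=> //=.
by lia.
Qed.

Lemma I_all_from w : gen I_all w -> exists n, gen (I_from n) w.
Proof.
move: w; apply: generated_ind.
- split=> [|c u v [m hu] [n hv]]; first by exists 0%N; exact: (generated_subspace _ _).1.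
  exists (maxn m n); apply: (generated_subspace _ _).2.
    by apply: generated_mono hu => -[] // i /=; lia.
  by apply: generated_mono hv => -[] // i /=; lia.
- by move=> v Vv; exists 0%N; exact: generated_sub.
case=> // i w _ [n hn]; exists (maxn n `|i|%N); apply: generated_op => /=; first by lia.
by apply: generated_mono hn => -[] // j /=; lia.
Qed.

Lemma I_all_reach w : gen I_all w -> reach V w.
Proof. by move=> /I_all_from [n]; exact: I_from_reach. Qed.

(** For m >= -beta, G_m preserves V and commutes with the I-letters, so it adds nothing. *)
Lemma G_from0 w : gen (G_from 0) w -> gen I_all w.
Proof.
move: w; apply: generated_ind; first exact: generated_subspace.
  by move=> v; exact: generated_sub.
case=> // [m w /= hm|m w _]; last exact: generated_op.
move: w; apply: (@generated_ind _ _ _ _ [set w | gen I_all (op (genG m) w)]).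
- exact: (subspace_preim (hv_op_linear _) (generated_subspace _ _)).
- by move=> v Vv /=; apply: generated_sub; apply: V_ab => //=; lia.
by case=> // i w _ /= hw; rewrite -hv_opIG; exact: generated_op.
Qed.

(** With y = G_(-(beta+n+1)), the square y y is an I-letter, so stage n + 1 is U + y U. The letter x
    = G_(z+beta+n+1) kills U and sends b + y b' to 2 I_z b', which is nonzero unless b' = 0. *)
Lemma G_from_reach n w : gen (G_from n) w -> reach V w.
Proof.
elim: n w => [|n IH] w; first by move/G_from0; exact: I_all_reach.
set y := genG (- (beta + n.+1)%:Z); set x := genG (z + beta + n.+1)%:Z.
pose U := gen (G_from n).
have sU : subspace U by exact: generated_subspace.
have D0 u : U u -> op x u = 0 by apply: G_kills_G_from; lia.
have CU u : U u -> U (op (genI z) u) by apply: generated_op.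
have CI u : U u -> op (genI z) u = 0 -> u = 0.
  move=> Uu; apply: reach_inj; last exact: IH.
  by apply: I_killed_GI Uu; case.
have DY u : op x (op y u) = - op y (op x u) + 2 *: op (genI z) u.
  by rewrite hv_opGG; congr (_ + _ *: op (genI _) u); lia.
have UI m u : U u -> U (op (genI m) u) by apply: generated_op.
have ly : linear (op y) by exact: hv_op_linear.
have yy u : op y (op y u) = op (genI (- (beta + n.+1)%:Z - (beta + n.+1)%:Z)) u.
  have /eqP := hv_opGG (- (beta + n.+1)%:Z) (- (beta + n.+1)%:Z) u.
  rewrite addrC -subr_eq opprK -mulr2n -scaler_nat => /eqP.
  by apply: scalerI; rewrite pnatr_eq0.
move=> hw; apply: (@reaches_trans _ _ _ U); first exact: IH.
have [b [b' [Ub Ub' ->]]] : exists b b', [/\ U b, U b' & w = b + op y b'].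
  move: w hw; apply: generated_ind.
  - split=> [|c _ _ [b [b' [Ub Ub' ->]]] [d [d' [Ud Ud' ->]]]].
      by exists 0, 0; rewrite (lin0 ly) addr0; split=> //; exact: sU.1.
    exists (c *: b + d), (c *: b' + d'); rewrite ly scalerDr addrACA.
    by split=> //; exact: sU.2.
  - move=> v Vv; exists v, 0; rewrite (lin0 ly) addr0; split=> //.
      exact: generated_sub.
    exact: sU.1.
  case=> // m w hm [b [b' [Ub Ub' ->]]]; rewrite (linD (hv_op_linear _)).
    have [e|mn] := eqVneq m (- (beta + n.+1)%:Z).
      rewrite e -/y yy addrC.
      by exists (op (genI (- (beta + n.+1)%:Z - (beta + n.+1)%:Z)) b'), b; split=> //; exact: UI.
    have UG u : U u -> U (op (genG m) u).
      by apply: generated_op => /=; move: hm => /=; lia.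
    exists (op (genG m) b + 2 *: op (genI (m - (beta + n.+1)%:Z)) b'), (- op (genG m) b').
    split.
    - apply: subspaceD => //; first exact: UG.
      by apply: subspaceZ => //; exact: UI.
    - by apply: subspaceN => //; exact: UG.
    - by rewrite (linN ly) hv_opGG -addrA [- _ + _]addrC.
  rewrite hv_opIG; exists (op (genI m) b), (op (genI m) b').
  by split=> //; exact: UI.
have [b'0|b'0] := pselect (b' = 0); first by left; rewrite b'0 (lin0 ly) addr0.
right; exists [:: x] => /=.
rewrite (linD (hv_op_linear _)) D0 // add0r DY D0 // (lin0 ly) oppr0 add0r.
split=> //; first by rewrite andbT; lia.
  by apply: subspaceZ => //; exact: CU.
move=> /eqP; rewrite scaler_eq0 pnatr_eq0 /= => /eqP /(CI _ Ub').
exact: b'0.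
Qed.

Lemma GI_all_reach w : gen GI_all w -> reach V w.
Proof.
move=> hw; suff [n] : exists n, gen (G_from n) w by exact: G_from_reach.
move: w hw; apply: generated_ind.
- split=> [|c u v [m hu] [n hv]]; first by exists 0%N; exact: (generated_subspace _ _).1.
  exists (maxn m n); apply: (generated_subspace _ _).2.
    by apply: generated_mono hu => -[] // i /=; lia.
  by apply: generated_mono hv => -[] // i /=; lia.
- by move=> v Vv; exists 0%N; exact: generated_sub.
case=> // i w _ [n hn]; last by exists n; exact: generated_op.
exists (maxn n `|i|%N); apply: generated_op => /=; first by lia.
by apply: generated_mono hn => -[] // j /=; lia.
Qed.

Lemma GI_all_inj w : gen GI_all w -> op (genI z) w = 0 -> w = 0.
Proof.
move=> hw; apply: reach_inj; last exact: GI_all_reach.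
exact: I_killed_GI hw.
Qed.

(** L_m preserves V, and its brackets with G- and I-letters are again such letters. *)
Lemma GI_all_L m w : 0 <= m -> gen GI_all w -> gen GI_all (op (genL m) w).
Proof.
move=> m0; have sg := generated_subspace GI_all V.
move: w; suff h : gen GI_all `<=` [set w | gen GI_all w /\ gen GI_all (op (genL m) w)].
  by move=> w /h [].
apply: generated_ind.
- split=> [|c u v [hu ku] [hv kv]].
    by split; rewrite ?(lin0 (hv_op_linear _)); exact: sg.1.
  by split; rewrite ?hv_op_linear; exact: sg.2.
- by move=> v Vv; split; apply: generated_sub => //; apply: V_ab => //=; lia.
move=> a w ha [gw hw]; split; first exact: generated_op.
rewrite hv_opC; apply: sg.2; first exact: generated_op.
by apply: subspaceZ => //; apply: generated_op => //; case: a ha.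
Qed.

End Towers.

(** * Triangular pairing of I-words with words in the L_m, m < 0 *)

Section LowerL.
Context {K : numFieldType} (M : smodule (hv K)) (z : nat).
Local Notation op := (@hv_op K M).
Implicit Types (s lam : seq nat) (t : seq int) (w : M).

(* The index i stands for L_{-(i+1)}, which has weight i + 1. *)
Definition Lneg (i : nat) : M -> M := op (genL (- i.+1%:Z)).
Lemma Lneg_linear i : linear (Lneg i). Proof. exact: hv_op_linear. Qed.

(** Indices are shifted by z: 0 stands for I_z, and the positive indices for the letters that will
    kill the base space. *)
Definition Iword t w : M := foldr (fun x => op (genI (z%:Z + x))) w t.
Definition weight s : int := \sum_(i <- s) i.+1%:Z.
Definition total t : int := \sum_(x <- t) x.
Definition nonzeros t : nat := count (fun x => x != 0) t.

Lemma Iword_linear t : linear (Iword t).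
Proof. elim: t => [|x t IH] a u v //; exact: etrans (congr1 _ (IH a u v)) (hv_op_linear _ _ _ _). Qed.

Lemma Iword_I m t w : Iword t (op (genI m) w) = op (genI m) (Iword t w).
Proof. by elim: t => //= x t ->; rewrite hv_opII. Qed.

Lemma Iword_rem x t w : x \in t -> Iword t w = op (genI (z%:Z + x)) (Iword (rem x t) w).
Proof.
elim: t => //= y t IH; rewrite inE; case: (eqVneq y x) => [-> //|yx].
by move=> /= /IH ->; rewrite hv_opII.
Qed.

Lemma Iword_perm t t' w : perm_eq t t' -> Iword t w = Iword t' w.
Proof.
elim: t t' => [|x t IH] t' pt.
  by have /nilP -> : size t' == 0%N by rewrite -(perm_size pt).
have xt' : x \in t' by rewrite -(perm_mem pt) mem_head.
rewrite (Iword_rem w xt') /= (IH (rem x t')) //.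
by rewrite -(perm_cons x) (perm_trans pt) // perm_to_rem.
Qed.

(** The Leibniz rule: the bracket of I_(z+x) with L_(-(i+1)) is a multiple of I_(z+x-(i+1)), so each
    term lowers one index by i + 1. The letters of an I-word commute, so the changed one may be put
    in front. *)
Lemma Iword_Lneg t i w : Iword t (Lneg i w) = Lneg i (Iword t w) +
  \sum_(x <- t) (- (z%:Z + x)%:~R) *: Iword ((x - i.+1%:Z) :: rem x t) w.
Proof.
elim: t => [|y t IH]; first by rewrite big_nil addr0.
rewrite big_cons [LHS]/= IH (linD (hv_op_linear _)) (lin_sum _ _ _ (hv_op_linear _)).
have -> : op (genI (z%:Z + y)) (Lneg i (Iword t w)) = Lneg i (Iword (y :: t) w) +
    (- (z%:Z + y)%:~R) *: Iword ((y - i.+1%:Z) :: rem y (y :: t)) w.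
  rewrite /Lneg hv_opC /koszul /= scale1r eqxx addrA.
  by congr (_ + _ *: _); rewrite mulrNz.
rewrite -addrA; congr (_ + (_ + _)); rewrite !big_seq; apply: eq_bigr => x xt.
rewrite (linZ (hv_op_linear _)); congr (_ *: _).
rewrite -[LHS]/(Iword [:: y, x - i.+1%:Z & rem x t] w); apply: Iword_perm.
rewrite (perm_catCA [:: y] [:: x - i.+1%:Z] (rem x t)) /= perm_cons.
case: eqP => [->|_]; last by rewrite perm_refl.
by rewrite perm_sym perm_to_rem.
Qed.

Lemma total_cons x t : total (x :: t) = x + total t.
Proof. exact: big_cons. Qed.

Lemma total_rem x t : x \in t -> total t = x + total (rem x t).
Proof. by move=> xt; rewrite /total (perm_big _ (perm_to_rem xt)) big_cons. Qed.

Lemma nonzeros_rem x t : x \in t -> nonzeros t = ((x != 0) + nonzeros (rem x t))%N.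
Proof. by move=> /perm_to_rem /permP; apply. Qed.

Section Base.
Variable B : set M.
Hypothesis sB : subspace B.
Hypothesis B_kill : forall b l, B b -> z%:Z < l -> op (genI l) b = 0.
Hypothesis B_inj : forall b, B b -> op (genI z) b = 0 -> b = 0.
Hypothesis B_I : forall m b, B b -> B (op (genI m) b).

Lemma Iword_pos_eq0 b t x : B b -> x \in t -> 0 < x -> Iword t b = 0.
Proof.
move=> Bb xt x0; have := Iword_perm b (perm_to_rem xt).
rewrite /= -Iword_I => ->; rewrite B_kill ?(lin0 (Iword_linear _)) //; lia.
Qed.

Lemma sum_pos_ex t : 0 < total t -> exists2 x, x \in t & 0 < x.
Proof.
move=> h; apply/hasP; apply: contraTT h; rewrite -all_predC => /allP h.
rewrite -leNgt /total big_seq; elim/big_ind: _ => // [x y|x /h] /=; last by rewrite -leNgt.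
by move=> hx hy; lia.
Qed.

(** Moving the first L-letter out leaves a shorter L-word below it, and in each commutator lowers
    weight and total by the same amount, while at most one index becomes 0. So the hypothesis
    persists until s is empty, when some index is positive and its letter kills b. *)
Lemma Iword_vanish s t b : B b ->
  weight s < total t \/
    weight s = total t /\ (size s < nonzeros t)%N ->
  Iword t (foldr Lneg b s) = 0.
Proof.
move=> Bb; elim: s t => [|i s IH] t.
  rewrite /weight big_nil => h.
  suff [x xt x0] : exists2 x, x \in t & 0 < x by exact: Iword_pos_eq0 xt x0.
  case: h => [/sum_pos_ex //|[e]]; rewrite /nonzeros -has_count => /hasP [x xt x0].
  have [xp|xn] := ltP 0 x; first by exists x.
  (* The total is 0 here, so if x is negative the other indices have a positive sum. *)
  have [|y yt y0] := @sum_pos_ex (rem x t); last by exists y => //; exact: mem_rem yt.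
  by rewrite -(ltrD2l x) -total_rem // -e addr0 lt_neqAle x0.
rewrite /weight big_cons -/(weight s) => h; rewrite /= Iword_Lneg IH; last first.
  by left; lia.
rewrite (lin0 (Lneg_linear i)) add0r big_seq big1 // => x xt.
rewrite IH ?scaler0 // total_cons; have := total_rem xt; have := nonzeros_rem xt.
case: h => [h|[h sz]] e1 e2; first by left; lia.
by right; split; [lia|]; move: e1 sz; rewrite /nonzeros /=; case: (x != 0); lia.
Qed.

(** Each L_(-(i+1)) of [lam] is matched with I_(z+i+1), their bracket being a multiple of I_z; [r]
    counts the letters I_z already produced. *)
Definition dual_word lam (r : nat) : seq int := [seq i.+1%:Z | i <- lam] ++ nseq r 0.

Lemma dual_word_sum lam r : total (dual_word lam r) = weight lam.
Proof.
rewrite /total big_cat /= big_map; suff -> : \sum_(x <- nseq r 0) x = 0 :> int by rewrite addr0.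
by rewrite big1_seq // => x /andP[_ /nseqP []].
Qed.

Lemma dual_word_nonzeros lam r : nonzeros (dual_word lam r) = size lam.
Proof.
rewrite /nonzeros count_cat count_nseq eqxx mul0n addn0.
by rewrite -size_filter size_filter count_map -[RHS]count_predT; apply: eq_count.
Qed.

Lemma dual_word_rem lam r i : i \in lam ->
  perm_eq (0 :: rem i.+1%:Z (dual_word lam r)) (dual_word (rem i lam) r.+1).
Proof.
move=> il; have p1 : perm_eq (dual_word lam r) (i.+1%:Z :: dual_word (rem i lam) r).
  by rewrite /dual_word -cat_cons perm_cat2r -map_cons perm_map // perm_to_rem.
have iw : i.+1%:Z \in dual_word lam r by rewrite (perm_mem p1) mem_head.
have : perm_eq (rem i.+1%:Z (dual_word lam r)) (dual_word (rem i lam) r).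
  rewrite -(perm_cons i.+1%:Z) (perm_trans _ p1) // perm_sym.
  exact: perm_to_rem.
move=> p2; apply: (perm_trans (y := 0 :: dual_word (rem i lam) r)).
  by rewrite perm_cons.
exact: (permEl (perm_catCA [:: 0 : int] _ (nseq r 0))).
Qed.

(* With [Iword_vanish], this says that the pairing between I-words and L-words
   is triangular for the order by weight, then by length. *)
Lemma Iword_dual s lam r b : B b -> size s = size lam -> weight s = weight lam ->
  exists c : K, (c != 0) = perm_eq s lam /\
    Iword (dual_word lam r) (foldr Lneg b s) = c *: iter (size lam + r) (op (genI z)) b.
Proof.
move=> Bb; elim: s lam r => [|i s IH] lam r.
  move=> /esym/size0nil -> _; exists 1; rewrite oner_eq0 scale1r; split=> //.
  by rewrite /dual_word /=; elim: r => //= r ->; rewrite addr0.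
move=> /= sz; rewrite /weight big_cons -/(weight s) -/(weight lam) => wt.
set t := dual_word lam r; have tsum := dual_word_sum lam r; have tnz := dual_word_nonzeros lam r.
rewrite Iword_Lneg (Iword_vanish Bb); last by left; rewrite tsum; lia.
rewrite (lin0 (Lneg_linear i)) add0r.
(* Lowering an index other than i + 1 creates no zero, so there are more nonzero indices left than
   letters in s. *)
have off x : x \in t -> x != i.+1%:Z ->
    Iword ((x - i.+1%:Z) :: rem x t) (foldr Lneg b s) = 0.
  move=> xt xi; apply: Iword_vanish => //; right; rewrite total_cons.
  have := total_rem xt; have := nonzeros_rem xt; rewrite tsum tnz => e1 e2.
  by split; [lia|]; move: e1; rewrite /nonzeros /= subr_eq0 xi; case: (x != 0) => /=; lia.
have [il|nil] := boolP (i \in lam); last first.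
  exists 0; rewrite eqxx scale0r; split.
    by apply/esym; apply: contraNF nil => /perm_mem <-; exact: mem_head.
  rewrite big_seq big1 // => x xt; rewrite off ?scaler0 //.
  apply: contraNneq nil => e; move: xt; rewrite e mem_cat => /orP[|/nseqP []//].
  by move/mapP => [j jl [->]].
have szr : size s = size (rem i lam) by rewrite size_rem // -sz.
have [|c [c0 hc]] := IH (rem i lam) r.+1 szr.
  apply: (addrI i.+1%:Z); rewrite wt /weight.
  by rewrite (perm_big _ (perm_to_rem il)) big_cons.
pose n := count_mem i.+1%:Z t.
have n0 : (0 < n)%N.
  rewrite -has_count has_pred1 mem_cat map_f //.
(* Each of the n occurrences of the index i + 1 in t contributes the bracket coefficient -(z + i +
   1) times c. *)
exists ((- (z%:Z + i.+1%:Z)%:~R * c) *+ n); split.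
  rewrite -mulr_natr !mulf_eq0 pnatr_eq0 oppr_eq0 intr_eq0 -[n == 0%N]negbK -lt0n n0.
  rewrite orbF (_ : (z%:Z + i.+1%:Z == 0) = false) /=; last by apply/negbTE; lia.
  by rewrite c0 -(perm_cons i) (permPr (perm_to_rem il)).
transitivity (\sum_(x <- t | x == i.+1%:Z) (- (z%:Z + i.+1%:Z)%:~R) *:
    Iword (dual_word (rem i lam) r.+1) (foldr Lneg b s)).
  rewrite [RHS]big_mkcond big_seq [RHS]big_seq; apply: eq_bigr => x xt.
  case: eqVneq => [e|xi]; last by rewrite off ?scaler0.
  by rewrite e subrr (Iword_perm _ (dual_word_rem r il)).
rewrite big_const_seq iter_addr_0 hc scalerA -scalerMnl; congr (_ *: _ *+ _).
by rewrite size_rem // addnS -addSn prednK // -sz.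
Qed.

End Base.
End LowerL.

(** * Removing the L-letters of negative degree *)

Section LowerReach.
Context {K : numFieldType} (M : smodule (hv K)) (z : nat) (T : pred hv_gen).
Local Notation op := (@hv_op K M).
Local Notation Lneg := (@Lneg K M).
Hypothesis T_I : forall l, z%:Z < l -> T (genI l).
Variable B : set M.
Hypothesis sB : subspace B.
Hypothesis B_kill : forall b l, B b -> z%:Z < l -> op (genI l) b = 0.
Hypothesis B_inj : forall b, B b -> op (genI z) b = 0 -> b = 0.
Hypothesis B_op : forall a b, B b -> (if a is genL m then 0 <= m else true) -> B (op a b).

Local Notation O m := (sorted_words Lneg xpredT B m).

Lemma Lneg_comm i j : exists (e c : K) k, forall w,
  Lneg i (Lneg j w) = e *: Lneg j (Lneg i w) + c *: Lneg k w.
Proof.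
exists 1, (- j.+1%:Z - - i.+1%:Z)%:~R, (i + j).+1 => w.
rewrite /Lneg hv_opLL scale1r; congr (_ + _ *: op (genL _) w); lia.
Qed.

Lemma Lneg_sorted_stable j v :
  v \in lspan (\bigcup_m O m) -> Lneg j v \in lspan (\bigcup_m O m).
Proof. by apply: sorted_words_stable => //; [exact: Lneg_linear|exact: Lneg_comm]. Qed.

(** The letter a moves through the word down to [B]. A commutator acts on a word shorter by one, so
    even if it is a negative L-letter the length bound m is not exceeded. *)
Lemma upper_sorted_step m a v : (if a is genL m then 0 <= m else true) ->
  v \in lspan (O m) -> op a v \in lspan (O m).
Proof.
elim: m a v => [|m IH] a v ha.
  apply: lspan_stable; first exact: hv_op_linear.
  move=> _ [[|i s] [b [_ _ ls Bb ->]]] //=.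
  by apply: lspan_mem; exists [::], (op a b); split=> //; exact: B_op.
apply: lspan_stable; first exact: hv_op_linear.
move=> _ [[|i s] [b [ss _ ls Bb ->]]] /=.
  by apply: lspan_mem; exists [::], (op a b); split=> //; exact: B_op.
have ws : foldr Lneg b s \in lspan (O m).
  by apply: lspan_mem; exists s, b; split=> //; [exact: path_sorted ss|exact: all_predT].
have step k u : u \in lspan (O m) -> Lneg k u \in lspan (O m.+1).
  by apply: sorted_words_step => //; [exact: Lneg_linear|exact: Lneg_comm].
rewrite {1}/Lneg hv_opC -/(Lneg i _) rpredD ?rpredZ //; first by apply: step; apply: IH.
have [hi|ni] := boolP (if hv_idx a (genL (- i.+1%:Z)) is genL m then 0 <= m else true).
  by apply: (sorted_words_mono (leqnSn m)); apply: IH.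
case: a ha ni => //= k k0 ni.
have -> : k - i.+1%:Z = - (`|k - i.+1%:Z|.-1.+1)%:Z by lia.
exact: step.
Qed.

(** The spanning half of a Poincare-Birkhoff-Witt decomposition over [B]. *)
Lemma generated_sorted V w : V `<=` B -> generated xpredT V w ->
  w \in lspan (\bigcup_m O m).
Proof.
move=> VB; move: w; apply: generated_ind.
- exact: subspace_lspan.
- by move=> v /VB Bv; apply: lspan_mem; exists 0%N => //; exists [::], v.
move=> a w _ /=; have [ha|na] := boolP (if a is genL m then 0 <= m else true).
  apply: (lspan_le (W := [set w | op a w \in lspan (\bigcup_m O m)])).
    exact: (subspace_preim (hv_op_linear a) (subspace_lspan _)).
  move=> u [m _ um] /=; have /(upper_sorted_step ha) := lspan_mem um.
  by apply: lspan_mono => x xm; exists m.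
case: a na => // k nk.
have -> : k = - (`|k|.-1.+1)%:Z by lia.
exact: Lneg_sorted_stable.
Qed.

Lemma sum_support (I : eqType) (S S' : seq I) (F : I -> M) : uniq S -> uniq S' ->
  {subset S <= S'} -> (forall s, s \notin S -> F s = 0) ->
  \sum_(s <- S') F s = \sum_(s <- S) F s.
Proof.
move=> uS uS' sub F0; rewrite (bigID (mem S)) /= [X in _ + X]big1 ?addr0 //.
rewrite -big_filter; apply: perm_big; apply: uniq_perm; rewrite ?filter_uniq //.
by move=> s; rewrite mem_filter; case: (boolP (s \in S)) => //= /sub ->.
Qed.

(** Terms with the same sorted word are collected. The coefficients are defined on all words and
    vanish outside S, so that two decompositions add up over the union of their supports. *)
Lemma sorted_decomposition w : w \in lspan (\bigcup_m O m) ->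
  exists (S : seq (seq nat)) (b : seq nat -> M),
    [/\ uniq S, forall s, s \in S -> sorted leq s, forall s, B (b s),
        forall s, s \notin S -> b s = 0 & w = \sum_(s <- S) foldr Lneg (b s) s].
Proof.
have fl s : linear (fun x => foldr Lneg x s).
  elim: s => [|i s IH] a u v //.
  exact: etrans (congr1 _ (IH a u v)) (Lneg_linear _ _ _ _).
apply: (lspan_le (W := [set w | exists (S : seq (seq nat)) (b : seq nat -> M),
    [/\ uniq S, forall s, s \in S -> sorted leq s, forall s, B (b s),
        forall s, s \notin S -> b s = 0 & w = \sum_(s <- S) foldr Lneg (b s) s]])).
  split=> [|c _ _ [S [b [uS oS Bb b0 ->]]] [S' [b' [uS' oS' Bb' b0' ->]]]].
    by exists [::], (fun=> 0); rewrite big_nil; split=> // s; exact: sB.1.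
  pose R := undup (S ++ S').
  have uR : uniq R by exact: undup_uniq.
  exists R, (fun s => c *: b s + b' s); split=> //.
  - by move=> s; rewrite mem_undup mem_cat => /orP[/oS|/oS'].
  - by move=> s; apply: sB.2.
  - move=> s; rewrite mem_undup mem_cat negb_or => /andP[/b0 -> /b0' ->].
    by rewrite scaler0 addr0.
  rewrite -(@sum_support _ S R) //; first last.
  - by move=> s /b0 ->; exact: lin0 (fl s).
  - by move=> s sS; rewrite mem_undup mem_cat sS.
  rewrite -(@sum_support _ S' R) //; first last.
  - by move=> s /b0' ->; exact: lin0 (fl s).
  - by move=> s sS; rewrite mem_undup mem_cat sS orbT.
  rewrite scaler_sumr -big_split /=; apply: eq_bigr => s _.
  by rewrite (fl s c (b s) (b' s)).
move=> _ [m _ [s [b [ss _ _ Bb ->]]]].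
exists [:: s], (fun r => if r == s then b else 0); split=> //.
- by move=> r; rewrite inE => /eqP ->.
- by move=> r; case: ifP => // _; exact: sB.1.
- by move=> r; rewrite inE => /negbTE ->.
by rewrite big_seq1 eqxx.
Qed.

Lemma max_key_ex (I : eqType) (S : seq I) (key : I -> nat) s0 : s0 \in S ->
  exists2 s, s \in S & forall r, r \in S -> (key r <= key s)%N.
Proof.
elim: S s0 => // s S IH s0 _.
case: S IH => [|s1 S] IH; first by exists s; rewrite ?mem_head // => r; rewrite inE => /eqP ->.
have [s' s'S hs'] := IH s1 (mem_head _ _).
have [le|lt] := leqP (key s) (key s').
  exists s'; first by rewrite inE s'S orbT.
  by move=> r; rewrite inE => /orP[/eqP ->|/hs'].
exists s; first exact: mem_head.
move=> r; rewrite inE => /orP[/eqP -> //|/hs' h].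
by apply: leq_trans (ltnW lt).
Qed.

Lemma size_le_weight s : (size s)%:Z <= weight s.
Proof.
by elim: s => [|i s IH]; rewrite /weight ?big_nil // big_cons -/(weight s) /=; lia.
Qed.

(** Choose [lam] maximal by weight, then length, among the words with nonzero coefficient. The dual
    I-word kills every other term and turns that of [lam] into a nonzero multiple of a power of I_z
    applied to its coefficient. *)
Lemma lower_reach w : w \in lspan (\bigcup_m O m) -> reaches T B w.
Proof.
move=> /sorted_decomposition [S [b [uS oS Bb b0 ->]]].
have [[s0 [s0n bs0]]|allz] := pselect (exists s, s <> [::] /\ b s <> 0); last first.
  left; apply: subspace_sum => // -[_|i s _]; first exact: Bb.
  have -> : b (i :: s) = 0 by apply: contrapT => bn; apply: allz; exists (i :: s).
  suff -> : foldr Lneg 0 (i :: s) = 0 :> M by exact: sB.1.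
  by elim: (i :: s) => //= j r ->; exact: lin0 (Lneg_linear j).
pose S' := [seq s <- S | `[< b s <> 0 >]].
have inS' s : (s \in S') = (`[< b s <> 0 >] && (s \in S)) by rewrite mem_filter.
have S_b s : b s <> 0 -> s \in S.
  by move=> bs; apply: contraT => /b0.
have s0S : s0 \in S' by rewrite inS' S_b // andbT; apply/asboolP.
(* For a word of weight w the key lies between w ^ 2 and w ^ 2 + w, below (w + 1) ^ 2, so it encodes
   the lexicographic order. *)
pose key s := (`|weight s| * `|weight s| + size s)%N.
have [lam lamS hlam] := max_key_ex key s0S.
have /andP[/asboolP blam lamS0] : `[< b lam <> 0 >] && (lam \in S) by rewrite -inS'.
(* The dual word must be nonempty: the empty word has key 0, while [s0] has a positive key. *)
have lam0 : lam <> [::].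
  move=> e; have := hlam _ s0S; rewrite e (_ : key [::] = 0%N); last first.
    by rewrite /key /weight big_nil.
  by case: (s0) s0n => // i s _; rewrite /key addnS.
have [c [c0 ec]] := Iword_dual B_kill 0 (Bb lam) (erefl (size lam)) (erefl (weight lam)).
rewrite perm_refl in c0.
have off s : s \in S -> s != lam -> Iword z (dual_word lam 0) (foldr Lneg (b s) s) = 0.
  move=> sS sl; have [bs0'|bs] := pselect (b s = 0).
    rewrite bs0' (_ : foldr Lneg 0 s = 0) ?(lin0 (Iword_linear _ _)) //.
    by elim: (s) => //= j r ->; exact: lin0 (Lneg_linear j).
  have sS' : s \in S' by rewrite inS' sS andbT; apply/asboolP.
  (* The key orders words by weight, then by length, as the length of a word
     is at most its weight. *)
  have := hlam s sS'; rewrite /key => hk.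
  have hs := size_le_weight s; have hl := size_le_weight lam.
  have wle : weight s <= weight lam.
    rewrite leNgt; apply/negP => lt; nia.
  have [wlt|wge] := ltP (weight s) (weight lam).
    by apply: (Iword_vanish B_kill (Bb s)); left; rewrite dual_word_sum.
  have we : weight s = weight lam by lia.
  have sle : (size s <= size lam)%N by move: hk; rewrite we leq_add2l.
  have [slt|sge] := ltnP (size s) (size lam).
    by apply: (Iword_vanish B_kill (Bb s)); right; rewrite dual_word_sum dual_word_nonzeros.
  have se : size s = size lam by lia.
  have [d [d0 ->]] := Iword_dual B_kill 0 (Bb s) se we.
  (* [d] is nonzero only if s is a permutation of [lam], and two sorted words that are permutations
     of each other are equal. *)
  suff /eqP -> : d == 0 by rewrite scale0r.
  rewrite -[_ == _]negbK d0; apply: contra sl => ps; apply/eqP.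
  by apply: (sorted_eq leq_trans anti_leq (oS _ sS) (oS _ lamS0) ps).
have e : Iword z (dual_word lam 0) (\sum_(s <- S) foldr Lneg (b s) s) =
    c *: iter (size lam + 0) (op (genI z)) (b lam).
  rewrite (lin_sum _ _ _ (Iword_linear _ _)) (bigD1_seq lam) //= -ec big_seq_cond big1 ?addr0 //.
  by move=> s /andP[sS sl]; exact: off.
right; exists [seq genI (z%:Z + i.+1%:Z) | i <- lam].
have ef u : foldr op u [seq genI (z%:Z + i.+1%:Z) | i <- lam] = Iword z (dual_word lam 0) u.
  by rewrite /dual_word cats0; elim: lam {lamS hlam blam lamS0 lam0 c c0 ec off e} => //= i s ->.
rewrite ef e; have CU u : B u -> B (op (genI z) u) by move=> Bu; apply: B_op.
split.
- by case: (lam) lam0.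
- by apply/allP => _ /mapP [i _ ->]; apply: T_I; lia.
- by apply: subspaceZ => //; apply: iter_stable_on.
move=> /eqP; rewrite scaler_eq0 (negbTE c0) => /eqP.
by move=> /(iter_injective_on CU B_inj (Bb _)).
Qed.

End LowerReach.

(** * Returning to V from any vector it generates *)

Section Reach.
Context {K : numFieldType} (M : smodule (hv K)) (alpha beta z : nat).
Hypothesis le_ab : (2 * beta <= alpha)%N.
Local Notation op := (@hv_op K M).
Context (V : set M).
Hypothesis sV : subspace V.
Hypothesis V_ab : forall a v, hv_ab_gen alpha beta a -> V v -> V (op a v).
Hypothesis V_top : forall a v, hv_top alpha beta z a -> V v -> op a v = 0.
Hypothesis V_inj : forall v, V v -> op (genI z) v = 0 -> v = 0.

(** The negative L-letters are removed first, over the space [B] of G- and I-words on V; the towers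
    then lead from [B] to V. *)
Lemma generated_reach w : generated xpredT V w -> reaches (hv_top alpha beta z) V w.
Proof.
move=> hw; pose B := generated GI_all V.
apply: (@reaches_trans _ _ _ B).
  by move=> u; exact: (GI_all_reach le_ab sV V_ab V_top V_inj).
have B_kill b l : B b -> z%:Z < l -> op (genI l) b = 0.
  by move=> Bb lz; apply: (I_killed_GI V_top _ Bb).
have B_op a b : B b -> (if a is genL m then 0 <= m else true) -> B (op a b).
  move=> Bb; case: a => m ma; first exact: (GI_all_L V_ab ma Bb).
    exact: generated_op.
  exact: generated_op.
have sB : subspace B by exact: generated_subspace.
have B_inj b : B b -> op (genI z) b = 0 -> b = 0.
  exact: (GI_all_inj le_ab sV V_ab V_top V_inj).
apply: (lower_reach _ sB B_kill B_inj B_op) => //.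
by apply: (generated_sorted B_op _ hw) => v; exact: generated_sub.
Qed.

(** The first letter to act in a nonempty word of top letters already kills w, so w must lie in
    V. *)
Lemma generated_top_killed w : generated xpredT V w ->
  (forall a, hv_top alpha beta z a -> op a w = 0) -> V w.
Proof.
move=> /generated_reach [//|[s [s0 Ts _ ns]]] kw; case: ns.
case/lastP: s s0 Ts => // s a _; rewrite all_rcons foldr_rcons => /andP[/kw -> _].
by elim: (s) => //= b r ->; exact: lin0 (hv_op_linear b).
Qed.

End Reach.

(** * Restricted and induced modules *)

Section Restriction.
Context {K : numFieldType} {g : lie_superalgebra K} (h : subalgebra g).
Context (M : smodule g) (W : set M).
Hypothesis gW : graded_subspace W.
Hypothesis stW : forall x w, sub_set h x -> W w -> W (act M x w).

Definition res_pred : {pred M} := fun w => `[< W w >].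

Lemma res_predP w : reflect (W w) (w \in res_pred).
Proof. by rewrite unfold_in; exact: asboolP. Qed.

Lemma res_pred_submod : submod_closed res_pred.
Proof.
have [[W0 WD] _] := gW.
split=> [|a x y /res_predP hx /res_predP hy]; apply/res_predP => //.
exact: WD.
Qed.

HB.instance Definition _ := GRing.isSubmodClosed.Build K M res_pred res_pred_submod.

Record res_car := ResElt { res_val :> M; res_valP : res_val \in res_pred }.

HB.instance Definition _ := [isSub for res_val].
HB.instance Definition _ := [Choice of res_car by <:].
HB.instance Definition _ := [SubChoice_isSubLmodule of res_car by <:].

Definition res_elt (w : M) (Ww : W w) : res_car := ResElt (introT (res_predP w) Ww).

Lemma res_mem (v : res_car) : W (res_val v).
Proof. exact/res_predP/res_valP. Qed.

Lemma res_val_linear : linear res_val.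
Proof.
move=> a u v; rewrite [LHS](raddfD (val : res_car -> M)) /=.
by congr (_ + _); exact: (GRing.valZ (a : K) u).
Qed.

Definition res_hom (i : bool) : set res_car := [set v | ss_hom i (res_val v)].

Lemma res_hom_subspace i : subspace (res_hom i).
Proof. exact: (subspace_preim res_val_linear (@ss_hom_subspace K M i)). Qed.

Lemma res_hom_sum (v : res_car) : exists v0 v1 : res_car,
  [/\ res_hom false v0, res_hom true v1 & v = v0 + v1].
Proof.
have [_ /(_ _ (res_mem v)) [w0 [w1 [h0 h1 k0 k1 e]]]] := gW.
exists (res_elt h0), (res_elt h1); split=> //.
by apply: val_inj; rewrite [RHS](linD res_val_linear).
Qed.

Lemma res_hom_cap (v : res_car) : res_hom false v -> res_hom true v -> v = 0.
Proof.
move=> h0 h1; apply: val_inj; rewrite [val 0](lin0 res_val_linear).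
exact: ss_hom_cap.
Qed.

Definition res_space : superspace K :=
  Superspace res_hom_subspace res_hom_sum res_hom_cap.

Definition res_act (x : sub_lsa h) (v : res_space) : res_space :=
  res_elt (stW (Defs.sub_mem x) (res_mem v)).

Lemma res_act_linearl v : linear (res_act^~ v).
Proof.
move=> a x y; apply: val_inj; rewrite [RHS]res_val_linear.
by rewrite [LHS]/(act M _ _) sub_val_linear; exact: act_linearl.
Qed.

Lemma res_act_linearr x : linear (res_act x).
Proof.
move=> a u v; apply: val_inj; rewrite [RHS]res_val_linear.
by rewrite [LHS]/(act M _ _) res_val_linear; exact: act_linearr.
Qed.

Lemma res_act_hom i j (x : sub_lsa h) (v : res_space) :
  ss_hom i x -> ss_hom j v -> ss_hom (i (+) j) (res_act x v).
Proof. by move=> hx hv; exact: (@act_hom _ _ M i j (sub_val x) (res_val v) hx hv). Qed.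

Lemma res_act_br i j (x y : sub_lsa h) (v : res_space) : ss_hom i x -> ss_hom j y ->
  res_act (lsa_br x y) v =
    res_act x (res_act y v) - koszul K i j *: res_act y (res_act x v).
Proof.
move=> hx hy; apply: val_inj; rewrite [RHS](linB res_val_linear) (linZ res_val_linear).
exact: act_br.
Qed.

Definition res_module : smodule (sub_lsa h) :=
  Smodule res_act_linearl res_act_linearr res_act_hom res_act_br.

End Restriction.

Lemma env_act_hom (K : numFieldType) (g : lie_superalgebra K) (M : smodule g) i j u (m : M) :
  u \in @env_hom K g i -> ss_hom j m -> ss_hom (i (+) j) (env_act u m).
Proof.
move=> + hm; have sP := @ss_hom_subspace K M (i (+) j).
apply: (lspan_le (W := [set u | ss_hom (i (+) j) (env_act u m)])).
  exact: (subspace_preim (env_act_linearl m) sP).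
move=> _ [s [hs -> ->]] /=; clear sP.
elim: s hs => [|p s IH] hs; first by rewrite !big_nil env_act1.
rewrite !big_cons env_actM env_act_in -addbA; apply: act_hom; first by apply: hs; rewrite mem_head.
by apply: IH => q qs; apply: hs; rewrite inE qs orbT.
Qed.

(** Frobenius reciprocity: u ⊗ v goes to u f(v), which is balanced because f commutes with U(h). *)
Lemma Ind_universal (K : numFieldType) (g : lie_superalgebra K) (h : subalgebra g)
    (V : smodule (sub_lsa h)) (M : smodule g) (f : V -> M) :
    linear f -> (forall i v, ss_hom i v -> ss_hom i (f v)) ->
    (forall x v, f (act V x v) = act M (sub_val x) (f v)) ->
  exists F : Ind V -> M, [/\ linear F, forall i q, ss_hom i q -> ss_hom i (F q),
    forall x q, F (act (Ind V) x q) = act M x (F q) & forall v, F (tens 1 v) = f v].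
Proof.
move=> lf hf fact.
have [iL iM i1 iin] := env_incl_morphism h.
have fenv b v : f (env_act b v) = env_act (env_incl b) (f v).
  move: b v; apply: (@env_ind _ _ [set b | forall v, f (env_act b v) =
    env_act (env_incl b) (f v)]) => [||x u IH v] /=.
  - split=> [v|a u u' hu hu' v].
      rewrite (lin0 (env_act_linearl v)) (lin0 lf) (lin0 iL).
      by rewrite (lin0 (env_act_linearl (f v))).
    by rewrite (env_act_linearl v) lf hu hu' iL (env_act_linearl (f v)).
  - by move=> v; rewrite i1 !env_act1.
  - by rewrite env_actM env_act_in fact IH iM env_actM iin env_act_in.
have := @ind_liftE _ _ h V M (fun u v => env_act u (f v)).
case=> [v|u a v v'|u b v|lF FE].
- exact: env_act_linearl.
- by rewrite lf env_act_linearr.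
- by rewrite env_actM fenv.
exists (fun q => flift (fun p => env_act p.1 (f p.2)) (qrepr q)); split=> //.
- move=> i q; apply: (lspan_le (W := [set q | ss_hom i (flift _ (qrepr q))])).
    exact: (subspace_preim lF (@ss_hom_subspace K M i)).
  move=> _ [j [k [u [v [-> hu hv ->]]]]] /=; rewrite FE.
  by apply: env_act_hom => //; exact: hf.
- move=> x; apply: (@ind_ind _ _ h V [set q |
      flift _ (qrepr (ind_act x q)) = act M x (flift _ (qrepr q))]).
    split=> [|a q r /= hq hr] /=.
      by rewrite (lin0 (ind_act_linearr x)) (lin0 lF) (lin0 (act_linearr _)).
    by rewrite ind_act_linearr lF hq hr lF act_linearr.
  move=> u v /=; rewrite /ind_act ind_mul_tens !FE.
  by rewrite env_actM env_act_in.
by move=> v; rewrite FE env_act1.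
Qed.

(** * Realization of a simple module as an induced one *)

Section SimpleModules.
Context {K : numFieldType} (P : smodule (hv K)).
Local Notation op := (@hv_op K P).
Hypothesis P_simple : simple_module P.

(** I_l commutes with all letters but L_m, and [I_l, L_m] is a multiple of I_(l+m), which commutes
    with I_l. So one more power of I_l suffices on L_m w. *)
Lemma I_nilpotent_submodule l :
  submodule [set w : P | exists n, iter n (op (genI l)) w = 0].
Proof.
have li n : linear (iter n (op (genI l))) by exact: iter_linear (hv_op_linear _).
apply: submoduleP => [|a w [n hn]].
  apply: graded_homP => [|w0 w1 h0 h1 [n]].
    split=> [|c u v [m hu] [n hv]]; first by exists 0%N.
    exists (m + n)%N; rewrite li [X in _ + X]iterD hv (lin0 (li m)) addnC iterD hu.
    by rewrite (lin0 (li n)) scaler0 addr0.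
  have it i w : ss_hom i w -> ss_hom i (iter n (op (genI l)) w).
    by move=> hw; elim: (n) => //= m hm; exact: (hv_op_hom (genI l) hm).
  rewrite (linD (li n)) => /(hom_sum_eq0 (i := false) (it _ _ h0) (it _ _ h1)) [e0 e1].
  by split; exists n.
have commute b : (forall u, op (genI l) (op b u) = op b (op (genI l) u)) ->
    exists m, iter m (op (genI l)) (op b w) = 0.
  move=> hb; exists n.
  suff -> : iter n (op (genI l)) (op b w) = op b (iter n (op (genI l)) w).
    by rewrite hn (lin0 (hv_op_linear b)).
  by elim: (n) => //= m ->.
case: a => m; last 2 first.
- by apply: commute => u; exact: hv_opIG.
- by apply: commute => u; exact: hv_opII.
exists n.+1; have [c ->] : exists c, iter n.+1 (op (genI l)) (op (genL m) w) =
    op (genL m) (iter n.+1 (op (genI l)) w)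
    + c *: op (genI (l + m)) (iter n (op (genI l)) w).
  elim: (n) => [|k [c IH]].
    by exists (- l%:~R); rewrite /= hv_opIL scaleNr.
  exists (c - l%:~R); rewrite iterS IH (linD (hv_op_linear _)) (linZ (hv_op_linear _)).
  rewrite hv_opIL [op (genI l) (op (genI (l + m)) _)]hv_opII.
  by rewrite -addrA; congr (_ + _); rewrite scalerBl addrC.
by rewrite iterS hn !(lin0 (hv_op_linear _)) scaler0 addr0.
Qed.

Lemma I_locally_nilpotent l : ~ injective (op (genI l)) ->
  forall w, exists n, iter n (op (genI l)) w = 0.
Proof.
move=> ninj; have [u [u0 eu]] : exists u, u <> 0 /\ op (genI l) u = 0.
  apply: contrapT => nu; apply: ninj => u v e; apply/eqP; rewrite -subr_eq0; apply/eqP.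
  apply: contrapT => uv; apply: nu; exists (u - v); split=> //.
  by rewrite (linB (hv_op_linear _)) e subrr.
by apply: (simple_full P_simple (I_nilpotent_submodule l) _ u0); exists 1%N.
Qed.

(** Injective indices are bounded, since I_j kills v for j >= N. *)
Lemma max_injective_I N (v : P) : v <> 0 -> killed_from N v ->
  (exists k : nat, injective (op (genI k))) ->
  exists z : nat, injective (op (genI z)) /\
    forall l : int, z%:Z < l -> ~ injective (op (genI l)).
Proof.
move=> v0 kv [k hk]; pose Q := [pred k : nat | `[< injective (op (genI k)) >]].
have exQ : exists k, Q k by exists k; apply/asboolP.
have ubQ j : Q j -> (j <= `|N|)%N.
  move=> /asboolP hj; rewrite leqNgt; apply/negP => lt; apply: v0; apply: hj.
  by rewrite kv ?(lin0 (hv_op_linear _)) //=; lia.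
have [z /asboolP hz zmax] := ex_maxnP exQ ubQ; exists z; split=> // l zl il.
suff : (`|l| <= z)%N by lia.
by apply: zmax; apply/asboolP; rewrite gez0_abs //; lia.
Qed.

(** Only finitely many l with z < l < N are at stake. For each in turn, u is replaced by the last
    nonzero I_l^m u; as the I-letters commute, those treated before still kill it. *)
Lemma I_killed_vector N (v : P) (z : nat) : v <> 0 -> killed_from N v ->
  (forall l : int, z%:Z < l -> ~ injective (op (genI l))) ->
  exists u : P, u <> 0 /\ forall l : int, z%:Z < l -> op (genI l) u = 0.
Proof.
move=> v0 kv ninj.
have [u [u0 ku hu]] : exists u : P, [/\ u <> 0,
    forall l, N <= l -> op (genI l) u = 0 &
    forall l, z%:Z < l -> l < z%:Z + 1 + `|N|%N%:Z -> op (genI l) u = 0].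
  elim: `|N|%N => [|j [u [u0 ku hu]]].
    by exists v; split=> // [l lN|l zl]; [exact: kv|lia].
  pose l := z%:Z + 1 + j%:Z.
  have [|n hn] := I_locally_nilpotent _ u (l := l); first by apply: ninj; lia.
  have exn : exists n, (iter n (op (genI l)) u == 0) by exists n; apply/eqP.
  case: (ex_minnP exn) => -[|m] /eqP hm mmin; first by [].
  have comm i : op (genI i) (iter m (op (genI l)) u) = iter m (op (genI l)) (op (genI i) u).
    by elim: (m) => //= p IH; rewrite hv_opII IH.
  have li : linear (iter m (op (genI l))) by exact: iter_linear (hv_op_linear _).
  exists (iter m (op (genI l)) u); split.
  - by move=> e; have := mmin m; rewrite e eqxx ltnn => /(_ isT).
  - by move=> i iN; rewrite comm ku // (lin0 li).
  move=> i zi ilt; have [->|il] := eqVneq i l; first exact: hm.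
  by rewrite comm hu // ?(lin0 li) //; lia.
exists u; split=> // l zl; have [lN|Nl] := leP N l; first exact: ku.
by apply: hu => //; lia.
Qed.

End SimpleModules.

(** * The subspace killed by the top letters and its induced module *)

Section Realization.
Context {K : numFieldType} (P : smodule (hv K)) (alpha beta z : nat).
Hypothesis le_ab : (2 * beta <= alpha)%N.
Hypothesis P_simple : simple_module P.
Hypothesis Iz_inj : injective (hv_op (M := P) (genI z)).
Local Notation op := (@hv_op K P).
Local Notation h := (hv_ab K le_ab).

Definition top_killed : set P := [set w | forall a, hv_top alpha beta z a -> op a w = 0].

Lemma top_killed_subspace : subspace top_killed.
Proof.
apply: (@subspace_forall _ _ _ _ (fun a => [set w | op a w = 0])) => a _.
exact: subspace_ker (hv_op_linear _).
Qed.

Lemma top_killed_graded : graded_subspace top_killed.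
Proof.
apply: graded_homP; first exact: top_killed_subspace.
by move=> w0 w1 h0 h1 kw; split=> a /kw /(hv_op_split h0 h1) [].
Qed.

(** The bracket of a top letter with a letter of S_{alpha,beta} vanishes or is again top; for L and
    G this uses alpha - beta >= beta. *)
Lemma top_killed_ab a w : hv_ab_gen alpha beta a -> top_killed w -> top_killed (op a w).
Proof.
move=> ha kw b hb; rewrite hv_opC kw // (lin0 (hv_op_linear _)) scaler0 add0r.
have [top|ntop] := boolP (hv_top alpha beta z (hv_idx b a)).
  by rewrite kw // scaler0.
suff -> : hv_coef K b a = 0 by rewrite scale0r.
by case: a b ha hb ntop {w kw} => m [] n //=; lia.
Qed.

Lemma top_killed_act x w : sub_set h x -> top_killed w -> top_killed (act P x w).
Proof.
move=> hx kw; apply: (act_basis_span (D := hv_ab_gen alpha beta)) => //.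
  exact: top_killed_subspace.
by move=> a ha; exact: top_killed_ab.
Qed.

Definition top_module : smodule (sub_lsa h) := res_module top_killed_graded top_killed_act.
Local Notation V := top_module.
Local Notation val := (@res_val _ _ P top_killed).

Lemma op_res_val a (ha : sub_set h (<< a >> : {malg K[hv_gen]})) (v : V) :
  op a (val v) = val (act V (sub_elt ha) v).
Proof. by []. Qed.

Lemma hv_ab_mem a : hv_ab_gen alpha beta a -> sub_set h (<< a >> : {malg K[hv_gen]}).
Proof. exact: basis_spanU. Qed.

Lemma val_linear : linear (val : V -> P).
Proof. exact: res_val_linear. Qed.

Lemma val_injective : injective (val : V -> P).
Proof. exact: val_inj. Qed.

Lemma Iz_eq0 w : op (genI z) w = 0 -> w = 0.
Proof. by rewrite -[RHS](lin0 (hv_op_linear (genI z))) => /Iz_inj. Qed.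

Lemma generated_submodule (W : set P) : graded_subspace W -> submodule (generated xpredT W).
Proof.
move=> [sW hW]; apply: submoduleP => [|a w]; last exact: generated_op.
have sg := generated_subspace xpredT W.
split=> // w; move: w.
apply: (@generated_ind _ _ _ _ [set w | exists w0 w1,
   [/\ generated xpredT W w0, generated xpredT W w1, ss_hom false w0,
       ss_hom true w1 & w = w0 + w1]]).
- have s0 := @ss_hom_subspace K P false; have s1 := @ss_hom_subspace K P true.
  split=> [|c _ _ [u0 [u1 [gu0 gu1 h0 h1 ->]]] [v0 [v1 [gv0 gv1 k0 k1 ->]]]].
    by exists 0, 0; rewrite addr0; split=> //; [exact: sg.1|exact: sg.1|exact: s0.1|exact: s1.1].
  exists (c *: u0 + v0), (c *: u1 + v1); rewrite scalerDr addrACA.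
  by split=> //; [exact: sg.2|exact: sg.2|exact: s0.2|exact: s1.2].
- move=> w /hW [w0 [w1 [W0 W1 h0 h1 ->]]]; exists w0, w1.
  by split=> //; exact: generated_sub.
move=> a _ _ [w0 [w1 [g0 g1 h0 h1 ->]]]; rewrite (linD (hv_op_linear a)).
have k0 := hv_op_hom a h0; have k1 := hv_op_hom a h1.
have o0 : generated xpredT W (op a w0) by exact: generated_op.
have o1 : generated xpredT W (op a w1) by exact: generated_op.
case: (hv_odd a) k0 k1 => /= k0 k1; last by exists (op a w0), (op a w1).
by exists (op a w1), (op a w0); rewrite addrC.
Qed.

Lemma generated_full (W : set P) w : graded_subspace W -> W w -> w <> 0 ->
  forall u, generated xpredT W u.
Proof.
move=> gW Ww w0; apply: (simple_full P_simple (generated_submodule gW) _ w0).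
exact: generated_sub.
Qed.

(** A nonzero submodule, seen in P, generates P. Every vector of V is thus generated by it and
    killed by the top letters, hence belongs to it. *)
Lemma top_module_simple w : top_killed w -> w <> 0 -> simple_module V.
Proof.
move=> kw w0; split.
  have hz : hv_ab_gen alpha beta (genI z) by rewrite /=; lia.
  exists (sub_elt (hv_ab_mem hz)), (res_elt kw) => e; apply: w0; apply: Iz_eq0.
  by have := op_res_val (hv_ab_mem hz) (res_elt kw); rewrite e (lin0 val_linear).
move=> W [[sW hW] stW].
have [W0|nW0] := pselect (forall v, W v -> v = 0).
  left; apply/seteqP; split=> v; first by move/W0.
  by move=> ->; exact: sW.1.
right; apply/seteqP; split=> // v _.
have [u [Wu u0]] : exists u, W u /\ u <> 0.
  apply: contrapT => nu; apply: nW0 => u Wu; apply: contrapT => u0; apply: nu.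
  by exists u.
pose U : set P := [set x | exists2 y, W y & val y = x].
have sU : subspace U.
  split=> [|c _ _ [y Wy <-] [y' Wy' <-]]; first by exists 0; [exact: sW.1|exact: lin0 val_linear].
  by exists (c *: y + y'); [exact: sW.2|exact: val_linear].
have gU : graded_subspace U.
  split=> // _ [y /hW [y0 [y1 [W0 W1 h0 h1 ->]]] <-].
  by exists (val y0), (val y1); rewrite (linD val_linear); split=> //; [exists y0|exists y1].
have U_ab a x : hv_ab_gen alpha beta a -> U x -> U (op a x).
  move=> ha [y Wy <-]; exists (act V (sub_elt (hv_ab_mem ha)) y) => //.
  exact: stW.
have U_top a x : hv_top alpha beta z a -> U x -> op a x = 0.
  by move=> ta [y _ <-]; exact: (res_mem y).
have u0' : val u <> 0.
  by move=> e; apply: u0; apply: val_injective; rewrite e (lin0 val_linear).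
have Uu : U (val u) by exists u.
have gv := generated_full gU Uu u0' (val v).
have [y Wy e] : U (val v).
  apply: (generated_top_killed le_ab sU U_ab U_top _ gv); last exact: (res_mem v).
  by move=> x _; exact: Iz_eq0.
by rewrite -(val_injective e).
Qed.

(** The inclusion of V extends to F from Ind V to P, onto since V generates P. A nonzero vector of
    its kernel would be carried by top letters to a nonzero vector of 1 ⊗ V in the kernel, or lie
    there already, but F is injective on 1 ⊗ V. *)
Lemma top_module_Ind w : top_killed w -> w <> 0 -> isomorphic P (Ind V).
Proof.
move=> kw w0.
have [|//|F [lF hF Fact F1]] := @Ind_universal K (hv K) h V P val val_linear.
  by [].
have Fop a q : F (hv_op a q) = op a (F q) by exact: Fact.
have surj p : exists q, F q = p.
  move: (generated_full top_killed_graded kw w0 p); move: p.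
  apply: (@generated_ind _ _ _ _ [set p | exists q, F q = p]).
  - split=> [|c _ _ [q <-] [r <-]]; first by exists 0; exact: lin0 lF.
    by exists (c *: q + r); exact: lF.
  - by move=> v kv; exists (tens 1 (res_elt kv : V)); rewrite F1.
  by move=> a _ _ [q <-]; exists (hv_op a q).
(* [T1] is 1 ⊗ V; it inherits from V, through F, the properties required by [generated_reach]. *)
pose T1 : set (Ind V) := [set q | exists v : V, q = tens 1 v].
have T1_0 q : T1 q -> F q = 0 -> q = 0.
  move=> [v ->]; rewrite F1 => e.
  have -> : v = 0 by apply: val_injective; rewrite e (lin0 val_linear).
  exact: lin0 (tens_linearr 1).
have T1_op a (ha : hv_ab_gen alpha beta a) v :
    hv_op a (tens 1 v : Ind V) = tens 1 (act V (sub_elt (hv_ab_mem ha)) v).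
  exact: (act_tens1 (sub_elt (hv_ab_mem ha) : sub_lsa h) v).
have sT1 : subspace T1.
  split=> [|c _ _ [v ->] [v' ->]]; first by exists 0; rewrite (lin0 (tens_linearr 1)).
  by exists (c *: v + v'); rewrite tens_linearr.
have T1_ab a q : hv_ab_gen alpha beta a -> T1 q -> T1 (hv_op a q).
  by move=> ha [v ->]; rewrite (T1_op a ha); eexists.
have T1_top a q : hv_top alpha beta z a -> T1 q -> hv_op a q = 0.
  move=> ta T1q; apply: T1_0; first exact: T1_ab (hv_top_ab le_ab ta) T1q.
  by case: T1q => v ->; rewrite Fop F1; exact: (res_mem v).
have T1_inj q : T1 q -> hv_op (genI z) q = 0 -> q = 0.
  by move=> T1q e; apply: T1_0 => //; apply: Iz_eq0; rewrite -Fop e (lin0 lF).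
have T1_gen (q : Ind V) : generated xpredT T1 q.
  have sg := generated_subspace xpredT T1.
  move: q; apply: (@ind_ind _ _ h V (generated xpredT T1)) => // u v.
  move: u; apply: (@env_ind _ _ [set u | generated xpredT T1 (tens u v : Ind V)]).
  - exact: (subspace_preim (tens_linearl v) sg).
  - by apply: generated_sub; exists v.
  move=> x u /= gu; rewrite -ind_mul_tens.
  apply: (@act_ops _ (Ind V) (generated xpredT T1) x (tens u v)) => // a.
  exact: generated_op.
have F0 q : F q = 0 -> q = 0.
  move=> e; have [T1q|[s [_ _ T1s ns]]] :=
    generated_reach le_ab sT1 T1_ab T1_top T1_inj (T1_gen q).
    exact: T1_0.
  case: ns; apply: T1_0 => //.
  by elim: (s) => //= a r IH; rewrite Fop IH (lin0 (hv_op_linear a)).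
have Finj : injective F.
  move=> q r e; apply/eqP; rewrite -subr_eq0; apply/eqP; apply: F0.
  by rewrite (linB lF) e subrr.
have [G GK] := choice surj.
have FK q : G (F q) = q by apply: Finj; rewrite GK.
exists G; split.
- by move=> c p p'; apply: Finj; rewrite lF !GK.
- by exists F.
(* The inverse is even: F is even and injective, so the component of G p of the wrong parity has
   image 0 and vanishes. *)
- move=> i p hp; have [q0 [q1 [h0 h1 e]]] := ss_hom_sum (G p).
  have ep : p = F q0 + F q1 by rewrite -(linD lF) -e GK.
  have k0 := hF _ _ h0; have k1 := hF _ _ h1.
  rewrite e; case: i hp => hp.
    have /F0 -> : F q0 = 0; last by rewrite add0r.
    apply: ss_hom_cap => //; rewrite -[F q0](addrK (F q1)) -ep.
    by apply: subspaceB => //; exact: ss_hom_subspace.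
  have /F0 -> : F q1 = 0; last by rewrite addr0.
  apply: ss_hom_cap => //; rewrite -[F q1](addrK (F q0)) addrC [F q1 + _]addrC -ep addrC.
  by apply: subspaceB => //; exact: ss_hom_subspace.
by move=> x p; apply: Finj; rewrite Fact !GK.
Qed.

End Realization.

(** * The equivalences *)

Section Conditions.
Context {K : numFieldType} (P : smodule (hv K)).
Local Notation op := (@hv_op K P).

Definition killed_vector := exists N (v : P), v <> 0 /\ killed_from N v.

Lemma simple_neq0 : simple_module P -> exists v : P, v <> 0.
Proof. by move=> [[x [v nv]] _]; exists (act P x v). Qed.

Lemma elements_bounded (z : nat) :
  (forall i : nat, (z <= i)%N -> [/\ locally_finite_elt P (hvL i%:Z),
     locally_finite_elt P (hvG i%:Z) & locally_finite_elt P (hvI i%:Z)]) ->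
  forall a, z%:Z <= hv_deg a -> orbit_bounded (op a).
Proof.
move=> h a za; apply: locally_finite_elt_bounded.
have [i ei] : exists i : nat, hv_deg a = i%:Z by exists `|hv_deg a|%N; lia.
have zi : (z <= i)%N by lia.
have [hL hG hI] := h i zi.
by case: a ei {za} => m /= ->.
Qed.

Lemma killed_words (N : int) (v : P) : simple_module P -> v <> 0 -> killed_from N v ->
  forall w : P, exists p, words_kill (`|N|.+1)%:Z p w.
Proof.
move=> sP v0 kv; apply: (simple_words_kill sP _ v0); first by lia.
by apply: killed_from_mono kv; lia.
Qed.

Lemma killed_vector_nilpotent : simple_module P -> killed_vector ->
  exists r s t : nat, locally_nilpotent P (hv_trunc r s t).
Proof.
move=> sP [N [v [v0 kv]]]; exists `|N|.+1, `|N|.+1, `|N|.+1.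
exact: words_kill_locally_nilpotent (killed_words sP v0 kv).
Qed.

Lemma killed_vector_finite : simple_module P -> killed_vector ->
  exists r s t : nat, locally_finite P (hv_trunc r s t).
Proof.
move=> sP [N [v [v0 kv]]]; exists `|N|.+1, `|N|.+1, `|N|.+1.
apply: words_kill_locally_finite (killed_words sP v0 kv) _.
exact: simple_killed_from v0 kv.
Qed.

Lemma nilpotent_elements :
  (exists r s t : nat, locally_nilpotent P (hv_trunc r s t)) ->
  exists z : nat, forall i : nat, (z <= i)%N -> [/\ locally_nilpotent_elt P (hvL i%:Z),
     locally_nilpotent_elt P (hvG i%:Z) & locally_nilpotent_elt P (hvI i%:Z)].
Proof.
move=> [r [s [t h]]]; exists (r + s + t)%N => i hi.
by split; apply: (locally_nilpotent_elt_trunc (a := _ _) h).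
Qed.

Definition induced_from_top := exists (alpha beta : nat) (le_ab : (2 * beta <= alpha)%N)
    (V : smodule (sub_lsa (hv_ab K le_ab))),
  [/\ simple_module V,
      exists c0 : K, forall v, act V (abI K le_ab 0) v = c0 *: v,
      exists z : nat,
        [/\ injective (act V (abI K le_ab z)),
            forall i : nat, (z + alpha < i)%N -> forall v, act V (abL K le_ab i) v = 0,
            forall j : nat, (z + beta < j)%N -> forall v, act V (abG K le_ab j) v = 0
          & forall l : nat, (z < l)%N -> forall v, act V (abI K le_ab l) v = 0]
    & isomorphic P (Ind V)].

(** Some 1 ⊗ v is nonzero, and the letters of degree above z + alpha + beta kill it because they
    kill V. *)
Lemma induced_killed_vector : simple_module P -> induced_from_top -> killed_vector.
Proof.
move=> sP [alpha [beta [le_ab [V [_ _ [z [_ hL hG hI]] iso]]]]].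
have [p p0] := simple_neq0 sP.
have [f [lf [f' fK _] _ _]] := iso.
have fp0 : f p <> 0 by move=> e; apply: p0; rewrite -[p]fK e -(lin0 lf) fK.
have [v v0] := Ind_tens1_neq0 fp0.
exists (z + alpha + beta).+1%:Z; apply: (isomorphic_killed_from iso v0) => a la.
have [i ei] : exists i : nat, hv_deg a = i%:Z by exists `|hv_deg a|%N; lia.
have tens0 : tens 1 0 = 0 :> Ind V := lin0 (tens_linearr 1).
case: a la ei => m /= la ei; subst m.
- by rewrite [LHS](act_tens1 (abL K le_ab i)) hL //; lia.
- by rewrite [LHS](act_tens1 (abG K le_ab i)) hG //; lia.
- by rewrite [LHS](act_tens1 (abI K le_ab i)) hI //; lia.
Qed.

Lemma killed_vector_induced : simple_module P ->
  (exists c0 : K, forall v, act P (hvI 0) v = c0 *: v) ->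
  (exists k : nat, injective (act P (hvI k%:Z))) ->
  killed_vector -> induced_from_top.
Proof.
move=> sP [c0 hc0] hk [N [v [v0 kv]]].
have [z [zinj zmax]] := max_injective_I v0 kv hk.
have [u [u0 ku]] := I_killed_vector sP v0 kv zmax.
have [N' kN'] := simple_killed_from sP v0 kv u.
(* As beta >= N', the letters L above z + alpha and G above z + beta kill u. *)
pose beta := `|N'|%N; pose alpha := (2 * beta)%N.
have le_ab : (2 * beta <= alpha)%N by [].
have tu : top_killed alpha beta z u.
  case=> m /= hm; [apply: kN' | apply: kN' | exact: ku] => /=.
    by move: hm; rewrite /alpha /beta; lia.
  by move: hm; rewrite /beta; lia.
exists alpha, beta, le_ab, (top_module P z le_ab); split.
- exact: (top_module_simple le_ab sP zinj tu u0).
- exists c0 => w; apply: val_inj; rewrite [RHS](linZ (@val_linear K P alpha beta z le_ab)).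
  exact: hc0.
- exists z; split=> [w w' e|i hi w|j hj w|l hl w]; apply: val_inj.
  + by apply: zinj; exact: (congr1 (fun x => res_val x) e).
  + by rewrite [RHS](lin0 (@val_linear K P alpha beta z le_ab)); apply: (res_mem w (genL i)) => /=; lia.
  + by rewrite [RHS](lin0 (@val_linear K P alpha beta z le_ab)); apply: (res_mem w (genG j)) => /=; lia.
  + by rewrite [RHS](lin0 (@val_linear K P alpha beta z le_ab)); apply: (res_mem w (genI l)) => /=; lia.
- exact: (top_module_Ind le_ab sP zinj tu u0).
Qed.

End Conditions.

Theorem proposition5p1 (R : realType) (P : smodule (hv R[i]))
    (P_simple : simple_module P)
    (P_I0 : exists c0 : R[i], forall v, act P (hvI 0) v = c0 *: v)
    (P_inj : exists k : nat, injective (act P (hvI k%:Z))) :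
  [<->
    (* (1) *)
    exists z : nat, forall i : nat, (z <= i)%N ->
      [/\ locally_finite_elt P (hvL i%:Z), locally_finite_elt P (hvG i%:Z)
        & locally_finite_elt P (hvI i%:Z)];
    (* (2) *)
    exists z : nat, forall i : nat, (z <= i)%N ->
      [/\ locally_nilpotent_elt P (hvL i%:Z), locally_nilpotent_elt P (hvG i%:Z)
        & locally_nilpotent_elt P (hvI i%:Z)];
    (* (3) *)
    exists r s t : nat, locally_finite P (hv_trunc r s t);
    (* (4) *)
    exists r s t : nat, locally_nilpotent P (hv_trunc r s t);
    (* (5) *)
    exists (alpha beta : nat) (le_ab : (2 * beta <= alpha)%N)
           (V : smodule (sub_lsa (hv_ab R[i] le_ab))),
      [/\ simple_module V,
          exists c0 : R[i], forall v, act V (abI R[i] le_ab 0) v = c0 *: v,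
          exists z : nat,
            [/\ injective (act V (abI R[i] le_ab z)),
                forall i : nat, (z + alpha < i)%N ->
                  forall v, act V (abL R[i] le_ab i) v = 0,
                forall j : nat, (z + beta < j)%N ->
                  forall v, act V (abG R[i] le_ab j) v = 0
              & forall l : nat, (z < l)%N ->
                  forall v, act V (abI R[i] le_ab l) v = 0]
        & isomorphic P (Ind V)]].
Proof.
have [u u0] := simple_neq0 P_simple.
have bounded_killed z : (forall a, z%:Z <= hv_deg a -> orbit_bounded (hv_op (M := P) a)) ->
    killed_vector P.
  exact: (locally_finite_killed (K := R[i]) u0).
have finite_killed : (exists z : nat, forall i : nat, (z <= i)%N ->
    [/\ locally_finite_elt P (hvL i%:Z), locally_finite_elt P (hvG i%:Z)
      & locally_finite_elt P (hvI i%:Z)]) -> killed_vector P.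
  by move=> [z /elements_bounded hz]; exact: bounded_killed hz.
have nilpotent_finite : (exists z : nat, forall i : nat, (z <= i)%N ->
    [/\ locally_nilpotent_elt P (hvL i%:Z), locally_nilpotent_elt P (hvG i%:Z)
      & locally_nilpotent_elt P (hvI i%:Z)]) ->
    exists z : nat, forall i : nat, (z <= i)%N ->
    [/\ locally_finite_elt P (hvL i%:Z), locally_finite_elt P (hvG i%:Z)
      & locally_finite_elt P (hvI i%:Z)].
  move=> [z hz]; exists z => i /hz [hL hG hI].
  by split; exact: locally_nilpotent_elt_finite.
have killed_nilpotent := killed_vector_nilpotent P_simple.
(* The implications form the cycle (1), (2), (3), (4), (5), (1), each passing through a killed
   vector. *)
tfae.
- by move=> /finite_killed /killed_nilpotent; exact: nilpotent_elements.
- by move=> /nilpotent_finite /finite_killed; exact: killed_vector_finite.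
- move=> [r [s [t h]]]; apply: killed_nilpotent.
  by apply: (bounded_killed (r + s + t)%N) => a; exact: locally_finite_trunc_bounded h.
- move=> /nilpotent_elements /nilpotent_finite /finite_killed.
  exact: killed_vector_induced P_simple P_I0 P_inj.
move=> /(induced_killed_vector P_simple) /killed_nilpotent /nilpotent_elements.
exact: nilpotent_finite.
Qed.
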